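(* Let $S=\operatorname{Sys}(A,B,C)$ be a $(U,X,Y)$-relation that is stabilizable, detectable and quasi-finite. Then there exists a finite-dimensional $(Y,W,U)$-relation $T=\operatorname{Sys}(E,F,G)$ such that $\operatorname{Close}(T\circ S)$ is exponentially stable.
   Context: A $(U,X,Y)$-relation is a subset of $C^0(\mathbb{R}_{\ge 0},U)\times C^0(\mathbb{R}_{\ge 0},X)\times C^0(\mathbb{R}_{\ge 0},Y)$ (elements $(u,x,y)$: input, state, output); finite-dimensional means $\dim X<\infty$. For $A$ generating a strongly continuous semigroup on $X$, bounded $B:U\to X$ and $C:\operatorname{Dom}(A)\to Y$ bounded in the graph norm, $\operatorname{Sys}(A,B,C)$ is the relation of all $(u,x,y)$ with $u\in C^0(\mathbb{R}_{\ge0},U)$, $x\in C^0(\mathbb{R}_{\ge0},\operatorname{Dom}(A))\cap C^1(\mathbb{R}_{\ge0},X)$, $y\in C^0(\mathbb{R}_{\ge0},Y)$, $\dot x=Ax+Bu$, $y=Cx$ (same conditions for $\operatorname{Sys}(E,F,G)$). $S_2\circ S_1$: all $(u_1,(x_1,x_2),y_2)$ such that some $y_1$ has $(u_1,x_1,y_1)\in S_1$, $(y_1,x_2,y_2)\in S_2$. $S_1+S_2$ (same input/output spaces): all $(u,(x_1,x_2),y_1+y_2)$ with $(u,x_j,y_j)\in S_j$. $\operatorname{Close}(S)$ for a $(U,X,U)$-relation: all $(0,x,0)$ with $(u,x,u)\in S$ for some $u$. $S_1\cong S_2$: a topological linear isomorphism $\phi$ of state spaces with $(u,x,y)\in S_1\iff(u,\phi\circ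 x,y)\in S_2$. Exponentially stable: $\exists\beta>0,M$ with $\|x(t)\|\le Me^{-\beta t}\|x(0)\|$ for all elements $(0,x,y)$, $t\ge0$. Stabilizable: $\{x(0)\mid(u,x,y)\in S,\lim_{t\to\infty}\|x(t)\|=0\}$ dense in $X$. Detectable: every $(0,x,0)\in S$ has $x(t)\to0$. IO-$(1,0)$-gain: for $\beta\in\mathbb{R}$, $g(\beta)$ is the infimum of $\alpha\ge0$ for which some $b:S\to\mathbb{R}_{\ge0}$ gives $\|e^{\beta t}y(t)\|\le\alpha\max_{j\in\{0,1\}}\|e^{\beta s}\partial_s^ju(s)\|_{L^\infty([0,t])}+b(u,x,y)$ for all $t\ge0$ and $(u,x,y)\in S$ with $u\in C^1$; the IO-$(1,0)$-gain of $S$ is $\inf_{\beta>0}g(\beta)$. $S$ is quasi-finite if for every $\epsilon>0$ there is a decomposition $S\cong S_u+S_s$ with $S_u=\operatorname{Sys}(A_u,B_u,C_u)$ finite-dimensional and $S_s=\operatorname{Sys}(A_s,B_s,C_s)$ exponentially stable with IO-$(1,0)$-gain less than $\epsilon$. *)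

(* Defs.v *)
From mathcomp Require Import all_boot all_algebra all_classical all_reals all_analysis.
Import numFieldNormedType.Exports.
Set Implicit Arguments. Unset Strict Implicit. Unset Printing Implicit Defensive.
Import GRing.Theory Num.Theory.
Local Open Scope classical_set_scope.
Local Open Scope ring_scope.

(* Functions on R_{>=0} are represented by functions R -> V whose values at
   negative times are irrelevant: every notion below only looks at t >= 0. *)

Section Defs.
Variable R : realType.

Definition C0 (V : normedModType R) (f : R -> V) : Prop :=
  {within `[0, +oo[, continuous f}.

Definition has_deriv0 (V : normedModType R) (f f' : R -> V) : Prop :=
  forall t : R, 0 <= t ->
    (h^-1 *: (f (t + h) - f t)) @[h --> within [set h : R | h != 0 /\ 0 <= t + h] (nbhs 0)]
      --> f' t.

Definition C1 (V : normedModType R) (f f' : R -> V) : Prop :=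
  C0 f /\ has_deriv0 f f' /\ C0 f'.

Definition lin_map (V W : normedModType R) (L : V -> W) : Prop :=
  forall (a : R) (x y : V), L (a *: x + y) = a *: L x + L y.

Definition bounded_lin (V W : normedModType R) (L : V -> W) : Prop :=
  lin_map L /\ continuous L.

(* A : Dom(A) -> X (given as a total function of which only the values on
   Dom A matter) generates a strongly continuous semigroup on X *)
Definition generator (X : normedModType R) (A : X -> X) (DomA : set X) : Prop :=
  exists T : R -> X -> X,
    (forall t : R, 0 <= t -> bounded_lin (T t)) /\
    (forall x : X, T 0 x = x) /\
    (forall s t : R, 0 <= s -> 0 <= t -> forall x : X, T (s + t) x = T s (T t x)) /\
    (forall x : X, T t x @[t --> 0^'+] --> x) /\
    (forall x : X, DomA x <-> exists l : X, (h^-1 *: (T h x - x)) @[h --> 0^'+] --> l) /\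
    (forall x : X, DomA x -> (h^-1 *: (T h x - x)) @[h --> 0^'+] --> A x).

Definition graph_bounded (X Y : normedModType R) (A : X -> X) (DomA : set X)
    (C : X -> Y) : Prop :=
  (forall (a : R) (x y : X), DomA x -> DomA y -> C (a *: x + y) = a *: C x + C y) /\
  exists M : R, forall x : X, DomA x -> `|C x| <= M * (`|x| + `|A x|).

Definition sys_data (U X Y : normedModType R) (A : X -> X) (DomA : set X)
    (B : U -> X) (C : X -> Y) : Prop :=
  generator A DomA /\ bounded_lin B /\ graph_bounded A DomA C.

Definition relation (U X Y : Type) := (R -> U) -> (R -> X) -> (R -> Y) -> Prop.

Definition Sys (U X Y : normedModType R) (A : X -> X) (DomA : set X)
    (B : U -> X) (C : X -> Y) : relation U X Y :=
  fun u x y =>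
    C0 u /\ C0 y /\
    (* x in C^0(R_{>=0}, Dom(A)) with the graph norm *)
    (forall t : R, 0 <= t -> DomA (x t)) /\ C0 x /\ C0 (A \o x) /\
    exists x' : R -> X, C1 x x' /\
      forall t : R, 0 <= t -> x' t = A (x t) + B (u t) /\ y t = C (x t).

Definition rcomp (U X1 Y1 X2 Y2 : Type) (S2 : relation Y1 X2 Y2)
    (S1 : relation U X1 Y1) : relation U (X1 * X2) Y2 :=
  fun u x y2 => exists y1 : R -> Y1, S1 u (fst \o x) y1 /\ S2 y1 (snd \o x) y2.

Definition rsum (U Y : normedModType R) (X1 X2 : Type)
    (S1 : relation U X1 Y) (S2 : relation U X2 Y) : relation U (X1 * X2) Y :=
  fun u x y => exists (y1 y2 : R -> Y),
    S1 u (fst \o x) y1 /\ S2 u (snd \o x) y2 /\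
    forall t : R, 0 <= t -> y t = y1 t + y2 t.

Definition Close (U : normedModType R) (X : Type) (S : relation U X U) :
    relation U X U :=
  fun u x y => (forall t : R, 0 <= t -> u t = 0 /\ y t = 0) /\
               exists v : R -> U, S v x v.

Definition rel_iso (U Y X1 X2 : normedModType R)
    (S1 : relation U X1 Y) (S2 : relation U X2 Y) : Prop :=
  exists (phi : X1 -> X2) (psi : X2 -> X1),
    lin_map phi /\ continuous phi /\ continuous psi /\
    cancel phi psi /\ cancel psi phi /\
    forall u x y, S1 u x y <-> S2 u (phi \o x) y.

Definition exp_stable (U X Y : normedModType R) (S : relation U X Y) : Prop :=
  exists (beta : R) (M : R), 0 < beta /\
    forall u x y, S u x y -> (forall t : R, 0 <= t -> u t = 0) ->
      forall t : R, 0 <= t -> `|x t| <= M * expR (- (beta * t)) * `|x 0|.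

Definition stabilizable (U X Y : normedModType R) (S : relation U X Y) : Prop :=
  dense [set x 0 | x in [set x : R -> X |
           exists u y, S u x y /\ (x t @[t --> +oo] --> (0 : X))]].

Definition detectable (U X Y : normedModType R) (S : relation U X Y) : Prop :=
  forall u x y, S u x y -> (forall t : R, 0 <= t -> u t = 0 /\ y t = 0) ->
    x t @[t --> +oo] --> (0 : X).

(* max_{j in {0,1}} || e^{beta s} d^j_s u(s) ||_{L^oo([0,t])} for continuous u, u' *)
Definition sup_C1_weighted (U : normedModType R) (beta : R) (u u' : R -> U) (t : R) : R :=
  Num.max (sup [set `|expR (beta * s) *: u s| | s in `[0, t]])
          (sup [set `|expR (beta * s) *: u' s| | s in `[0, t]]).

Definition io_bound (U X Y : normedModType R) (S : relation U X Y) (beta alpha : R) : Prop :=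
  exists b : (R -> U) -> (R -> X) -> (R -> Y) -> R,
    (forall u x y, S u x y -> 0 <= b u x y) /\
    forall u x y (u' : R -> U), S u x y -> C1 u u' ->
      forall t : R, 0 <= t ->
        `|expR (beta * t) *: y t| <= alpha * sup_C1_weighted beta u u' t + b u x y.

Definition io_g (U X Y : normedModType R) (S : relation U X Y) (beta : R) : \bar R :=
  ereal_inf [set alpha%:E | alpha in [set alpha : R | 0 <= alpha /\ io_bound S beta alpha]].

Definition io_gain (U X Y : normedModType R) (S : relation U X Y) : \bar R :=
  ereal_inf [set io_g S beta | beta in [set beta : R | 0 < beta]].

Definition quasi_finite (U X Y : normedModType R) (S : relation U X Y) : Prop :=
  forall eps : R, 0 < eps ->
    exists (n : nat) (Xs : normedModType R)
           (Au : 'rV[R]_n -> 'rV[R]_n) (DomAu : set 'rV[R]_n)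
           (Bu : U -> 'rV[R]_n) (Cu : 'rV[R]_n -> Y)
           (As : Xs -> Xs) (DomAs : set Xs) (Bs : U -> Xs) (Cs : Xs -> Y),
      sys_data Au DomAu Bu Cu /\ sys_data As DomAs Bs Cs /\
      rel_iso S (rsum (Sys Au DomAu Bu Cu) (Sys As DomAs Bs Cs)) /\
      exp_stable (Sys As DomAs Bs Cs) /\
      (io_gain (Sys As DomAs Bs Cs) < eps%:E)%E.

End Defs.

(* Main.v *)
Require Import Defs.
From HB Require Import structures.
From mathcomp Require Import all_boot all_order all_algebra all_classical all_reals all_analysis.
From mathcomp Require Import ring lra.
Import numFieldNormedType.Exports.
Import Order.TTheory GRing.Theory Num.Theory.
Set Implicit Arguments. Unset Strict Implicit. Unset Printing Implicit Defensive.
Local Open Scope classical_set_scope.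
Local Open Scope ring_scope.

(** A first decomposition isolates the finite-dimensional part [A0] of the dynamics none of whose
    orbits decays.  Stabilizability makes [A0] null-controllable, whence a feedback [K] with
    [A0 + B0 K] stable; detectability makes it observable, whence [L] with [A0 + L C0] stable.
    [A0], [K] and [L] fix the gain [k] from a disturbance [d] of the measured output to [(u, u')]
    in the loop closed by the observer.  A second decomposition, with IO-gain below [1 / (2 (k + 1))],
    contains the same [A0]: a linear map intertwining [A0] with an exponentially stable semigroup
    vanishes, in either direction.  So the state consists of [x0] (driven by [A0]), a stable
    finite-dimensional part [p] and a small-gain part [q] with output [d], and the controller
    observes [x0] while simulating [p]:
      [h0' = h0 A0 + B0 u + L (C0 h0 + C1 h1 - y)],  [h1' = h1 A1 + B1 u],  [u = K h0].
    The small-gain inequality bounds [e^{beta t} d(t)], hence the whole loop, by the graph norm of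
    the initial state; the offset [b] in the definition of the gain is removed by a gliding hump
    argument.  The closed-loop generator is invertible, so every trajectory is the derivative of
    another one, and this turns the graph-norm bound into exponential stability in norm.

    Vectors are rows, so that [x' = A x] reads [x' = x *m A]. *)

(** * Linear identities in modules, and calculus on the half-line *)

(** The obstacle is a circularity: the gain of the stable part must be small against the gain [k] of
    the controlled loop, while the finite-dimensional part, hence the controller, changes with the
    gain that is asked for. It is broken because the simulation error [e1 = h1 - p] obeys
    [e1' = e1 A1] whatever the input: [p] contributes only a decaying disturbance, and [k] depends
    on the unstable part, [K] and [L] alone. The bound [1 / (2 (k + 1))] gives [al k <= 1/2], so the
    supremum of [e^{be s} |d s|] over a compact time interval can be absorbed.

    The graph norm enters because [C] is bounded only on the domain: a gain inequality without
    offset asks for zero initial data, and removing the initial state, [u 0] and [u' 0] from a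
    trajectory costs the output of a free orbit.

    Eigenvalues never appear. Instability means that no nonzero orbit decays, stability that all
    orbits decay, and intertwining relations link the two; all spaces stay real. The closed-loop
    bounds are a priori bounds along a given trajectory. *)

Section LinearCombinations.
Variables (R : comPzRingType) (V : lmodType R).

Inductive lin_expr : Type :=
  LVar of nat | LZero | LAdd of lin_expr & lin_expr | LOpp of lin_expr
| LScale of R & lin_expr.

Fixpoint lin_eval (env : seq V) e : V :=
  match e with
  | LVar i => nth 0 env i | LZero => 0 | LAdd a b => lin_eval env a + lin_eval env b
  | LOpp a => - lin_eval env a | LScale r a => r *: lin_eval env a
  end.

(** [Nat.eqb] rather than [==], so that [cbn] computes the coefficients in [linear_comb]. *)
Fixpoint lin_coef (i : nat) e : R :=
  match e with
  | LVar j => if Nat.eqb i j then 1 else 0 | LZero => 0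
  | LAdd a b => lin_coef i a + lin_coef i b
  | LOpp a => - lin_coef i a | LScale r a => r * lin_coef i a
  end.

Fixpoint lin_eqs n e1 e2 : Prop :=
  if n is n'.+1 then lin_coef n' e1 = lin_coef n' e2 /\ lin_eqs n' e1 e2 else True.

Lemma lin_evalE env e : lin_eval env e = \sum_(i < size env) lin_coef i e *: nth 0 env i.
Proof.
elim: e => [j||a IHa b IHb|a IHa|r a IHa] /=.
- have eqb i : Nat.eqb i j = (i == j :> nat) by apply/PeanoNat.Nat.eqb_spec/eqP.
  have [js|js] := ltnP j (size env); last first.
    rewrite nth_default // big1 // => i _; rewrite eqb ifN ?scale0r //.
    by apply: contraTneq (ltn_ord i) => ->; rewrite -leqNgt.
  rewrite (bigD1 (Ordinal js)) //= eqb eqxx scale1r big1 ?addr0 // => i ij.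
  by rewrite eqb ifN ?scale0r //; apply: contra ij => /eqP ij; apply/eqP/val_inj.
- by rewrite big1 // => i _; rewrite scale0r.
- by rewrite IHa IHb -big_split; apply: eq_bigr => i _; rewrite scalerDl.
- by rewrite IHa -sumrN; apply: eq_bigr => i _; rewrite scaleNr.
- by rewrite IHa scaler_sumr; apply: eq_bigr => i _; rewrite scalerA.
Qed.

Lemma lin_eq env e1 e2 : lin_eqs (size env) e1 e2 -> lin_eval env e1 = lin_eval env e2.
Proof.
move=> H; rewrite !lin_evalE; apply: eq_bigr => i _; congr (_ *: _).
move: H (ltn_ord i); elim: (size env) (nat_of_ord i) => // n IHn k /= [H1 H2].
by rewrite ltnS leq_eqVlt => /orP[/eqP->//|]; apply: IHn.
Qed.
End LinearCombinations.

Ltac lin_index x l k :=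
  lazymatch l with
  | x :: _ => k O
  | _ :: ?l' => lin_index x l' ltac:(fun n => k (S n))
  end.
Ltac lin_mem x l :=
  lazymatch l with
  | nil => constr:(false) | x :: _ => constr:(true) | _ :: ?l' => lin_mem x l'
  end.
Ltac lin_atoms e l :=
  lazymatch e with
  | (?a + ?b)%R => let l' := lin_atoms a l in lin_atoms b l'
  | (- ?a)%R => lin_atoms a l
  | (_ *: ?a)%R => lin_atoms a l
  | 0%R => l
  | _ => let b := lin_mem e l in
         lazymatch b with true => l | false => constr:(e :: l) end
  end.
Ltac lin_reify R e l k :=
  lazymatch e with
  | (?a + ?b)%R => lin_reify R a l ltac:(fun a' => lin_reify R b l ltac:(fun b' => k (@LAdd R a' b')))
  | (- ?a)%R => lin_reify R a l ltac:(fun a' => k (@LOpp R a'))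
  | (?r *: ?a)%R => lin_reify R a l ltac:(fun a' => k (@LScale R r a'))
  | 0%R => k (@LZero R)
  | _ => lin_index e l ltac:(fun n => k (@LVar R n))
  end.
(* Proves an identity in an [R]-module by comparing with [ring] the coefficients of each atom;
   atoms are identified syntactically. *)
Ltac linear_comb R :=
  lazymatch goal with
  | |- @eq ?T ?a ?b =>
    let l0 := lin_atoms a (@nil T) in let l := lin_atoms b l0 in
    lin_reify R a l ltac:(fun a' => lin_reify R b l ltac:(fun b' =>
      apply: (@lin_eq R _ l a' b'); cbn [lin_eqs lin_coef size Nat.eqb]; repeat split; try ring))
  end.

(** * Induction over a compact interval and the mean value inequality *)

Section IntervalInduction.
Variable R : realType.

(** Compactness of [[a, b]] in the form of Cousin's lemma: the supremum of the [s] with [P a s]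
    satisfies it too, and below [b] the local hypothesis would carry it further. *)
Lemma interval_induction (P : R -> R -> Prop) (a b : R) : a <= b ->
  (forall x y z, a <= x -> x <= y -> y <= z -> z <= b -> P x y -> P y z -> P x z) ->
  (forall c, a <= c -> c <= b -> exists2 d : R, 0 < d &
     forall x y, a <= x -> x <= c -> c <= y -> y <= b -> y - x < d -> P x y) ->
  P a b.
Proof.
move=> ab Padd Ploc.
have Paa : P a a.
  by have [d d0 Pd] := Ploc a (lexx a) ab; apply: Pd => //; rewrite subrr.
pose E := [set s : R | a <= s /\ s <= b /\ P a s].
have Ea : E a by [].
have Eub : has_ubound E by exists b => s [_ []].
have supE : has_sup E by split => //; exists a.
have ac : a <= sup E by apply: ub_le_sup.
have cb : sup E <= b by apply: ge_sup; [exists a|move=> s [_ []]].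
have [d d0 Pd] := Ploc _ ac cb.
have Pac : P a (sup E).
  have [s [as_ [sb Pas]] ls] := sup_adherent d0 supE.
  have sc : s <= sup E by apply: ub_le_sup.
  apply: (Padd _ s) => //; apply: Pd => //; lra.
have [bc|cb'] := leP b (sup E).
  by have -> : b = sup E by apply/le_anti; rewrite bc cb.
pose c' := Num.min b (sup E + d / 2).
have cc' : sup E < c' by rewrite /c' lt_min cb'; lra.
have c'b : c' <= b by rewrite /c' ge_min lexx.
have c'd : c' <= sup E + d / 2 by rewrite /c' ge_min lexx orbT.
have : E c'.
  split; first lra; split => //; apply: (Padd _ (sup E)) => //; try lra.
  apply: Pd => //; try lra.
by move=> /(ub_le_sup Eub); lra.
Qed.

(** Differentiability relative to [[a, b]], one-sided at the end points. It serves beside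
    [has_deriv0] for functions such as [s |-> T (t - s) (x s)], which have a meaning on [[0, t]]
    only. *)
Definition dvon (V : normedModType R) (a b : R) (f f' : R -> V) : Prop :=
  forall t, a <= t -> t <= b -> forall e : R, 0 < e -> exists2 d : R, 0 < d &
    forall s, a <= s -> s <= b -> `|s - t| < d ->
      `|f s - f t - (s - t) *: f' t| <= e * `|s - t|.

(** With the slack [e1 * (y - x)] the inequality is additive over adjacent intervals, and near a
    point [c] it follows from the two difference quotients, each with error [e1 / 2]. *)
Lemma mean_value_ineq (V : normedModType R) (f f' : R -> V) (g g' : R -> R) (a b : R) :
  a <= b -> dvon a b f f' -> dvon a b (g : R -> R^o) g' ->
  (forall s, a <= s -> s <= b -> `|f' s| <= g' s) ->
  `|f b - f a| <= g b - g a.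
Proof.
move=> ab df dg fg; apply/ler_addgt0Pr => e e0.
have ba1 : 0 < (b - a) + 1 by lra.
pose e1 := e / ((b - a) + 1).
have e10 : 0 < e1 by rewrite divr_gt0.
suff H : `|f b - f a| <= g b - g a + e1 * (b - a).
  apply: (le_trans H); rewrite lerD2l /e1 -mulrA ger_pMr // mulrC ler_pdivrMr //; lra.
apply: (@interval_induction (fun x y => `|f y - f x| <= g y - g x + e1 * (y - x))) => //.
  move=> x y z ax xy yz zb h1 h2.
  have -> : f z - f x = (f z - f y) + (f y - f x) by rewrite addrA subrK.
  apply: (le_trans (ler_normD _ _)); nra.
move=> c ac cb.
have e20 : 0 < e1 / 2 by lra.
have [d1 d10 H1] := df c ac cb _ e20.
have [d2 d20 H2] := dg c ac cb _ e20.
have fgc := fg c ac cb.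
exists (Num.min d1 d2); first by rewrite lt_min d10.
move=> x y ax xc cy yb; rewrite lt_min => /andP[yx1 yx2].
have loc z : a <= z -> z <= b -> `|z - c| < d1 -> `|z - c| < d2 ->
    `|f z - f c| <= `|z - c| * g' c + e1 / 2 * `|z - c| /\
    `|g z - g c - (z - c) * g' c| <= e1 / 2 * `|z - c|.
  move=> az zb z1 z2; split; last exact: H2.
  have -> : f z - f c = (f z - f c - (z - c) *: f' c) + (z - c) *: f' c by rewrite subrK.
  apply: (le_trans (ler_normD _ _)); rewrite normrZ addrC; apply: lerD; last exact: H1.
  by rewrite ler_wpM2l.
have yc : `|y - c| = y - c by rewrite ger0_norm //; lra.
have xc' : `|x - c| = c - x by rewrite ler0_norm; lra.
have [||||fy /ler_normlP[gy1 gy2]] := loc y; rewrite ?yc; try lra.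
have [||||fx /ler_normlP[gx1 gx2]] := loc x; rewrite ?xc'; try lra.
rewrite yc in fy gy1 gy2; rewrite xc' in fx gx1 gx2.
have -> : f y - f x = (f y - f c) - (f x - f c) by rewrite opprB addrA subrK.
apply: (le_trans (ler_normB _ _)); lra.
Qed.

End IntervalInduction.

(** * Continuity and derivatives on the half-line; bounded linear and bilinear maps *)

Section Calculus.
Variable R : realType.
Implicit Types V W Z : normedModType R.

Lemma C0P V (f : R -> V) :
  C0 f <-> forall t : R, 0 <= t -> forall e : R, 0 < e -> exists2 d : R, 0 < d &
    forall s : R, 0 <= s -> `|s - t| < d -> `|f s - f t| <= e.
Proof.
rewrite /C0 subspace_continuousP; split.
  move=> H t t0 e e0; have /H /cvgrPdist_le /(_ e e0) : `[0, +oo[%classic t by rewrite /= in_itv /= t0.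
  rewrite near_withinE near_simpl => /nbhs_ballP[d /= d0 Hd]; exists d => // s s0 st.
  rewrite distrC; apply: Hd; last by rewrite /= in_itv /= s0.
  by rewrite /ball /= distrC.
move=> H t; rewrite /= in_itv /= andbT => t0; apply/cvgrPdist_le => e e0.
have [d d0 Hd] := H t t0 e e0.
rewrite near_withinE; apply/nbhs_ballP; exists d => // s /=; rewrite /ball /= => st.
by rewrite in_itv /= andbT => s0; rewrite distrC; apply: Hd => //; rewrite distrC.
Qed.

Lemma has_deriv0P V (f f' : R -> V) :
  has_deriv0 f f' <-> forall t : R, 0 <= t -> forall e : R, 0 < e -> exists2 d : R, 0 < d &
    forall s : R, 0 <= s -> `|s - t| < d -> `|f s - f t - (s - t) *: f' t| <= e * `|s - t|.
Proof.
split.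
  move=> H t t0 e e0; have /cvgrPdist_le /(_ e e0) := H t t0.
  rewrite near_withinE near_simpl => /nbhs_ballP[d /= d0 Hd]; exists d => // s s0 st.
  have [->|/eqP st0] := eqVneq s t; first by rewrite !subrr scale0r subrr !normr0 mulr0.
  have h0 : s - t != 0 by rewrite subr_eq0; apply/eqP.
  have := Hd (s - t); rewrite /ball /= sub0r normrN => /(_ st).
  rewrite [t + _]addrC subrK => /(_ (conj h0 s0)) Hle.
  rewrite -(ler_pM2l (x := `|s - t|)) ?normr_gt0 // in Hle.
  rewrite mulrC; apply: le_trans Hle; rewrite -normrZ scalerBr scalerA divff // scale1r.
  by rewrite distrC.
move=> H t t0; apply/cvgrPdist_le => e e0.
have [d d0 Hd] := H t t0 e e0.
rewrite near_withinE; apply/nbhs_ballP; exists d => // h /=.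
rewrite /ball /= sub0r normrN => hd [h0 th].
have := Hd (t + h) th; rewrite addrAC subrr add0r => /(_ hd) Hle.
rewrite -(ler_pM2l (x := `|h|)) ?normr_gt0 // -normrZ scalerBr scalerA divff // scale1r.
by rewrite distrC [_ * e]mulrC.
Qed.

Lemma has_deriv0_dvon V (f f' : R -> V) a b : 0 <= a -> has_deriv0 f f' -> dvon a b f f'.
Proof.
move=> a0 /has_deriv0P H t ta tb e e0; have [|d d0 Hd] := H t _ e e0; first lra.
by exists d => // s sa sb; apply: Hd; lra.
Qed.

Lemma has_deriv0_C0 V (f f' : R -> V) : has_deriv0 f f' -> C0 f.
Proof.
move=> /has_deriv0P H; apply/C0P => t t0 e e0.
have [d d0 Hd] := H t t0 1 ltr01.
have c0 : 0 < 1 + `|f' t| by rewrite ltr_pwDl.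
exists (Num.min d (e / (1 + `|f' t|))); first by rewrite lt_min d0 divr_gt0.
move=> s s0; rewrite lt_min => /andP[sd]; rewrite ltr_pdivlMr // => se.
have -> : f s - f t = (f s - f t - (s - t) *: f' t) + (s - t) *: f' t by rewrite subrK.
apply: (le_trans (ler_normD _ _)); rewrite normrZ.
apply: (le_trans (lerD (Hd s s0 sd) (lexx _))).
by rewrite mul1r -{1}[`|s - t|]mulr1 -mulrDr; apply: ltW.
Qed.

Lemma C0_ext V (f g : R -> V) : (forall t : R, 0 <= t -> f t = g t) -> C0 f -> C0 g.
Proof.
move=> fg /C0P H; apply/C0P => t t0 e e0; have [d d0 Hd] := H t t0 e e0.
by exists d => // s s0 sd; rewrite -!fg //; apply: Hd.
Qed.

Lemma has_deriv0_ext V (f g f' g' : R -> V) : (forall t : R, 0 <= t -> f t = g t) ->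
  (forall t : R, 0 <= t -> f' t = g' t) -> has_deriv0 f f' -> has_deriv0 g g'.
Proof.
move=> fg fg' /has_deriv0P H; apply/has_deriv0P => t t0 e e0; have [d d0 Hd] := H t t0 e e0.
by exists d => // s s0 sd; rewrite -!fg // -fg' //; apply: Hd.
Qed.

Lemma C0_cst V (v : V) : C0 (fun=> v : V).
Proof. by apply: continuous_subspaceT => x; apply: cst_continuous. Qed.

Lemma C0_comp V W (g : V -> W) (f : R -> V) : continuous g -> C0 f -> C0 (g \o f).
Proof. by move=> cg cf x; apply: (@cvg_comp _ _ _ f g _ (nbhs (f x))); [apply: cf|apply: cg]. Qed.

Lemma C0D V (f g : R -> V) : C0 f -> C0 g -> C0 (fun t => f t + g t).
Proof. by move=> cf cg x; apply: cvgD; [apply: cf|apply: cg]. Qed.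

Lemma C0N V (f : R -> V) : C0 f -> C0 (fun t => - f t).
Proof. by move=> cf x; apply: cvgN; apply: cf. Qed.

Lemma C0B V (f g : R -> V) : C0 f -> C0 g -> C0 (fun t => f t - g t).
Proof. by move=> cf cg; apply: C0D => //; apply: C0N. Qed.

Lemma C0Z V (a : R -> R) (f : R -> V) : C0 (a : R -> R^o) -> C0 f -> C0 (fun t => a t *: f t).
Proof. by move=> ca cf x; apply: cvgZ; [apply: ca|apply: cf]. Qed.

Lemma C0Zc V (a : R) (f : R -> V) : C0 f -> C0 (fun t => a *: f t).
Proof. by move=> cf; apply: C0Z => //; apply: C0_cst. Qed.

Lemma C0_bounded V (f : R -> V) (T : R) : C0 f ->
  exists M, forall s : R, 0 <= s -> s <= T -> `|f s| <= M.
Proof.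
move=> cf; have [T0|T0] := leP 0 T; last by exists 0 => s s0 sT; exfalso; lra.
suff [M HM] : exists M, forall s : R, 0 <= s -> s <= T -> `|f s| <= M by exists M.
pose P x y := exists M, forall s, x <= s -> s <= y -> `|f s| <= M.
apply: (@interval_induction _ P 0 T) => //.
  move=> x y z _ xy yz _ [M1 H1] [M2 H2]; exists (Num.max M1 M2) => s xs sz.
  by rewrite le_max; apply/orP; have [sy|/ltW sy] := leP s y; [left; exact: H1|right; exact: H2].
move=> c c0 cT; have /C0P /(_ c c0 1 ltr01)[d d0 Hd] := cf.
exists d => // x y x0 xc cy yT yx; exists (1 + `|f c|) => s xs sy.
have -> : f s = (f s - f c) + f c by rewrite subrK.
apply: (le_trans (ler_normD _ _)); apply: lerD => //; apply: Hd; first lra.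
by apply/ltr_normlP; split; lra.
Qed.

Lemma has_deriv0_cst V (v : V) : has_deriv0 (fun=> v) (fun=> 0).
Proof.
apply/has_deriv0P => t t0 e e0; exists 1 => // s _ _.
by rewrite subrr scaler0 subrr normr0 mulr_ge0 // ltW.
Qed.

Lemma dq_filter (t : R) : Filter (within [set h : R | h != 0 /\ 0 <= t + h] (nbhs 0)).
Proof. exact: within_filter. Qed.

Lemma has_deriv0D V (f f' g g' : R -> V) : has_deriv0 f f' -> has_deriv0 g g' ->
  has_deriv0 (fun t => f t + g t) (fun t => f' t + g' t).
Proof.
move=> df dg t t0; have /(_ (dq_filter t)) := cvgD (df t t0) (dg t t0).
apply: cvg_trans; apply: near_eq_cvg; near=> h.
by rewrite -[LHS]/(_ *: _ + _ *: _) -scalerDr opprD addrACA.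
Unshelve. all: by end_near. Qed.

Lemma bounded_lin0 V W (L : V -> W) : bounded_lin L -> L 0 = 0.
Proof. by case=> HL _; have := HL (-1) 0 0; rewrite scaler0 addr0 scaleN1r addNr. Qed.
Lemma bounded_linD V W (L : V -> W) x y : bounded_lin L -> L (x + y) = L x + L y.
Proof. by case=> HL _; have := HL 1 x y; rewrite !scale1r. Qed.
Lemma bounded_linZ V W (L : V -> W) a x : bounded_lin L -> L (a *: x) = a *: L x.
Proof. by move=> bL; have [HL _] := bL; have := HL a x 0; rewrite addr0 bounded_lin0 // addr0. Qed.
Lemma bounded_linN V W (L : V -> W) x : bounded_lin L -> L (- x) = - L x.
Proof. by move=> bL; rewrite -scaleN1r bounded_linZ // scaleN1r. Qed.
Lemma bounded_linB V W (L : V -> W) x y : bounded_lin L -> L (x - y) = L x - L y.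
Proof. by move=> bL; rewrite bounded_linD // bounded_linN. Qed.

Lemma bounded_lin_bound V W (L : V -> W) : bounded_lin L ->
  exists2 M, 0 < M & forall x, `|L x| <= M * `|x|.
Proof.
move=> bL; have [_ cL] := bL; have /cvgrPdist_le /(_ 1 ltr01) := cL 0.
rewrite (bounded_lin0 bL) near_simpl => /nbhs_ballP[d /= d0 Hd].
exists (2 / d); first by rewrite divr_gt0.
move=> x; have [->|x0] := eqVneq x 0; first by rewrite bounded_lin0 // !normr0 mulr0.
have nx : 0 < `|x| by rewrite normr_gt0.
pose c := d / 2 / `|x|; have c0 : 0 < c by rewrite !divr_gt0.
have nc : `|c| = c by rewrite ger0_norm // ltW.
have cx : c * `|x| = d / 2 by rewrite /c divfK // gt_eqF.
have : `|0 - L (c *: x)| <= 1.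
  by apply: Hd; rewrite -ball_normE /ball_ /= sub0r normrN normrZ nc cx; lra.
rewrite sub0r normrN (bounded_linZ _ _ bL) normrZ nc => H.
have -> : 2 / d * `|x| = c^-1 by rewrite /c !invf_div; field; lra.
by rewrite -[c^-1]mul1r ler_pdivlMr // mulrC.
Qed.

Lemma bounded_linP V W (L : V -> W) M : lin_map L -> (forall x, `|L x| <= M * `|x|) ->
  bounded_lin L.
Proof.
move=> HL HM; split => // x; apply/cvgrPdist_le => e e0.
have M0 : 0 < `|M| + 1 by rewrite ltr_wpDl.
near=> y.
have -> : L x - L y = L (x - y).
  by have := HL (-1) y x; rewrite !scaleN1r addrC [in RHS]addrC => ->.
apply: (le_trans (HM _)).
apply: (@le_trans _ _ ((`|M| + 1) * `|x - y|)).
  by rewrite ler_wpM2r //; have := ler_norm M; lra.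
rewrite mulrC -ler_pdivlMr //.
near: y; apply: cvgr_dist_le; first exact: cvg_id.
by rewrite divr_gt0.
Unshelve. all: by end_near. Qed.

Lemma bounded_lin_comp V W Z (L : V -> W) (K : W -> Z) :
  bounded_lin L -> bounded_lin K -> bounded_lin (K \o L).
Proof.
move=> [lL cL] [lK cK]; split; first by move=> a x y /=; rewrite lL lK.
by move=> x; apply: continuous_comp; [apply: cL|apply: cK].
Qed.

Lemma bounded_lin_add V W (L K : V -> W) :
  bounded_lin L -> bounded_lin K -> bounded_lin (fun x => L x + K x).
Proof.
move=> [lL cL] [lK cK]; split; first by move=> a x y /=; rewrite lL lK scalerDr addrACA.
by move=> x; apply: continuousD; [apply: cL|apply: cK].
Qed.

Lemma bounded_lin_scale V W (L : V -> W) a : bounded_lin L -> bounded_lin (fun x => a *: L x).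
Proof.
move=> bL; have [lL cL] := bL; split => [c x y|x] /=.
  by rewrite lL scalerDr !scalerA mulrC.
by apply: cvgZr; apply: cL.
Qed.

Lemma bounded_lin_id V : bounded_lin (fun x : V => x).
Proof. by split => // x; apply: cvg_id. Qed.

Lemma bounded_lin_zero V W : bounded_lin (fun _ : V => 0 : W).
Proof. by split => [a x y|]; [rewrite scaler0 addr0|apply: cst_continuous]. Qed.

Lemma has_deriv0_lin V W (L : V -> W) (f f' : R -> V) : bounded_lin L ->
  has_deriv0 f f' -> has_deriv0 (fun t => L (f t)) (fun t => L (f' t)).
Proof.
move=> bL df t t0; have [_ cL] := bL.
have /(_ (dq_filter t)) := continuous_cvg _ (cL (f' t)) (df t t0).
apply: cvg_trans; apply: near_eq_cvg; near=> h.
by rewrite /= bounded_linZ // bounded_linB.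
Unshelve. all: by end_near. Qed.

Lemma C0_lin V W (L : V -> W) (f : R -> V) : bounded_lin L -> C0 f -> C0 (fun t => L (f t)).
Proof. by move=> [_ cL]; apply: C0_comp. Qed.

Lemma has_deriv0N V (f f' : R -> V) : has_deriv0 f f' ->
  has_deriv0 (fun t => - f t) (fun t => - f' t).
Proof.
apply: (@has_deriv0_lin V V (fun x => - x)); split => [a x y|x].
  by rewrite opprD scalerN.
exact: opp_continuous.
Qed.

Lemma has_deriv0B V (f f' g g' : R -> V) : has_deriv0 f f' -> has_deriv0 g g' ->
  has_deriv0 (fun t => f t - g t) (fun t => f' t - g' t).
Proof. by move=> df dg; apply: has_deriv0D => //; apply: has_deriv0N. Qed.

Lemma has_deriv0Zc V (a : R) (f f' : R -> V) : has_deriv0 f f' ->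
  has_deriv0 (fun t => a *: f t) (fun t => a *: f' t).
Proof.
by apply: (@has_deriv0_lin V V (fun x => a *: x)); apply/bounded_lin_scale/bounded_lin_id.
Qed.

Lemma bilin_bounded V W Z (op : V -> W -> Z) (M : R) :
  (forall v, lin_map (op v)) -> (forall w, lin_map (op^~ w)) ->
  (forall v w, `|op v w| <= M * `|v| * `|w|) ->
  (forall v, bounded_lin (op v)) /\ (forall w, bounded_lin (op^~ w)).
Proof.
move=> lr ll HM; split=> [v|w]; first by apply: (@bounded_linP _ _ _ (M * `|v|)).
by apply: (@bounded_linP _ _ _ (M * `|w|)) => // x; rewrite mulrAC; apply: HM.
Qed.

Lemma bilin_cvg V W Z (op : V -> W -> Z) (M : R) T (F : set_system T) (FF : Filter F)
    (a : T -> V) (b : T -> W) v0 w0 :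
  (forall v, lin_map (op v)) -> (forall w, lin_map (op^~ w)) ->
  (forall v w, `|op v w| <= M * `|v| * `|w|) ->
  a @ F --> v0 -> b @ F --> w0 -> op (a x) (b x) @[x --> F] --> op v0 w0.
Proof.
move=> lr ll HM ca cb; have [br bl] := bilin_bounded lr ll HM.
(* The sum on the left is [op (a x) (b x)]. Its first term is a product of two small factors, each
   of the other two is continuous in one argument. *)
have H1 : op (a x - v0) (b x - w0) + (op v0 (b x) + op (a x - v0) w0) @[x --> F]
   --> 0 + (op v0 w0 + 0).
  apply: cvgD; last first.
    apply: cvgD; first exact: (continuous_cvg _ (proj2 (br v0) w0) cb).
    have -> : (0 : Z) = op (v0 - v0) w0 by rewrite subrr; rewrite (bounded_lin0 (bl w0)).
    apply: (@cvg_comp _ _ _ (fun x => a x - v0) (op^~ w0) _ (nbhs (v0 - v0))); last exact: (proj2 (bl w0)).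
    by apply: cvgB => //; exact: cvg_cst.
  apply/cvgr0Pnorm_le => e e0.
  have M0 : 0 < `|M| + 1 by rewrite ltr_wpDl.
  near=> x; apply: (le_trans (HM _ _)).
  have Hp1 : `|a x - v0| <= 1.
    by near: x; move/cvgrPdistC_le: ca; apply.
  have Hp2 : `|b x - w0| <= e / (`|M| + 1).
    by near: x; move/cvgrPdistC_le: cb; apply; rewrite divr_gt0.
  rewrite -mulrA; apply: (@le_trans _ _ ((`|M| + 1) * (1 * (e / (`|M| + 1))))); last first.
    by rewrite mul1r mulrC divfK // gt_eqF.
  apply: (@le_trans _ _ ((`|M| + 1) * (`|a x - v0| * `|b x - w0|))).
    by rewrite ler_wpM2r ?mulr_ge0 //; have := ler_norm M; lra.
  by rewrite ler_wpM2l ?(ltW M0) // ler_pM.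
rewrite add0r addr0 in H1; apply: cvg_trans H1; apply: near_eq_cvg; near=> x => /=.
rewrite (bounded_linB _ _ (bl _)) (bounded_linB _ _ (bl _)) !(bounded_linB _ _ (br _)).
move: (op (a x) (b x)) (op (a x) w0) (op v0 (b x)) (op v0 w0) => p q r s.
by linear_comb R.
Unshelve. all: by end_near. Qed.

Lemma C0_bilin V W Z (op : V -> W -> Z) (M : R) (f : R -> V) (g : R -> W) :
  (forall v, lin_map (op v)) -> (forall w, lin_map (op^~ w)) ->
  (forall v w, `|op v w| <= M * `|v| * `|w|) ->
  C0 f -> C0 g -> C0 (fun t => op (f t) (g t)).
Proof.
by move=> lr ll HM cf cg x; apply: (bilin_cvg _ lr ll HM); [apply: cf|apply: cg].
Qed.

Lemma has_deriv0_bilin V W Z (op : V -> W -> Z) (M : R) (f f' : R -> V) (g g' : R -> W) :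
  (forall v, lin_map (op v)) -> (forall w, lin_map (op^~ w)) ->
  (forall v w, `|op v w| <= M * `|v| * `|w|) ->
  has_deriv0 f f' -> has_deriv0 g g' ->
  has_deriv0 (fun t => op (f t) (g t)) (fun t => op (f' t) (g t) + op (f t) (g' t)).
Proof.
move=> lr ll HM df dg t t0; have [br bl] := bilin_bounded lr ll HM.
have cg : g (t + h) @[h --> within [set h : R | h != 0 /\ 0 <= t + h] (nbhs 0)] --> g t.
  apply/cvgrPdist_le => e e0; have /C0P /(_ t t0 e e0)[d d0 Hd] := has_deriv0_C0 dg.
  rewrite near_withinE; apply/nbhs_ballP; exists d => // h /=.
  rewrite /ball /= sub0r normrN => hd [_ th]; rewrite distrC; apply: Hd => //.
  by rewrite addrAC subrr add0r.
have FF := dq_filter t.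
have /(_ FF FF) := cvgD (bilin_cvg FF lr ll HM (df t t0) cg) (continuous_cvg _ (proj2 (br (f t)) (g' t)) (dg t t0)).
apply: cvg_trans; apply: near_eq_cvg; near=> h => /=.
rewrite -[LHS]/(op _ _ + op _ _).
rewrite (bounded_linZ _ _ (bl _)) (bounded_linZ _ _ (br _)) -scalerDr; congr (_ *: _).
by rewrite (bounded_linB _ _ (bl _)) (bounded_linB _ _ (br _)) addrA subrK.
Unshelve. all: by end_near. Qed.

Lemma has_deriv0_eq V (f g f' g' : R -> V) : has_deriv0 f f' -> has_deriv0 g g' ->
  (forall t : R, 0 <= t -> f' t = g' t) -> f 0 = g 0 -> forall t : R, 0 <= t -> f t = g t.
Proof.
move=> df dg fg fg0 t t0.
have /(has_deriv0_dvon (b := t) (lexx 0)) D := has_deriv0B df dg.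
have D0 : dvon 0 t (fun=> 0 : R^o) (fun=> 0) := has_deriv0_dvon (b := t) (lexx 0) (has_deriv0_cst (0 : R^o)).
have := mean_value_ineq t0 D D0; rewrite fg0 !subrr subr0 => H.
apply/eqP; rewrite -subr_eq0 -normr_le0; apply: H => s s0 st.
by rewrite fg // subrr normr0.
Qed.

Lemma has_deriv0_le (f f' g g' : R -> R^o) : has_deriv0 f f' -> has_deriv0 g g' ->
  (forall t : R, 0 <= t -> f' t <= g' t) -> f 0 <= g 0 -> forall t : R, 0 <= t -> f t <= g t.
Proof.
move=> df dg fg fg0 t t0.
have /(has_deriv0_dvon (b := t) (lexx 0)) D := has_deriv0B dg df.
have D0 : dvon 0 t (fun=> 0 : R^o) (fun=> 0) := has_deriv0_dvon (b := t) (lexx 0) (has_deriv0_cst (0 : R^o)).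
have := mean_value_ineq t0 D0 D; rewrite subrr normr0 => H.
have : 0 <= g t - f t - (g 0 - f 0) by apply: H => s s0 _; rewrite subr_ge0; apply: fg.
by lra.
Qed.

Lemma has_deriv0_uniq V (f f' g' : R -> V) : has_deriv0 f f' -> has_deriv0 f g' ->
  forall t : R, 0 <= t -> f' t = g' t.
Proof.
move=> /has_deriv0P df /has_deriv0P dg t t0.
apply/eqP; rewrite -subr_eq0 -normr_le0; apply/ler_addgt0Pr => e e0; rewrite add0r.
have e20 : 0 < e / 2 by lra.
have [d d0 Hd] := df t t0 _ e20; have [d' d'0 Hd'] := dg t t0 _ e20.
pose h := Num.min d d' / 2.
have m0 : 0 < Num.min d d' by rewrite lt_min d0.
have h0 : 0 < h by rewrite /h; lra.
have hd : h < d by have : Num.min d d' <= d; [rewrite ge_min lexx|rewrite /h; lra].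
have hd' : h < d' by have : Num.min d d' <= d'; [rewrite ge_min lexx orbT|rewrite /h; lra].
have eh : t + h - t = h by ring.
have th : 0 <= t + h by lra.
have := Hd (t + h) th; have := Hd' (t + h) th; rewrite eh (gtr0_norm h0) => /(_ hd') H1 /(_ hd) H2.
rewrite -(ler_pM2l h0) -[X in X * `|_|](gtr0_norm h0) -normrZ scalerBr.
have -> : h *: f' t - h *: g' t = (f (t + h) - f t - h *: g' t) - (f (t + h) - f t - h *: f' t).
  by linear_comb R.
apply: (le_trans (ler_normB _ _)); lra.
Qed.

Lemma C1_of V (f f' : R -> V) : has_deriv0 f f' -> C0 f' -> C1 f f'.
Proof. by move=> df cf; split; [exact: has_deriv0_C0 df|]. Qed.

Lemma has_deriv0_exp (b : R) : has_deriv0 (fun t => expR (b * t) : R^o) (fun t => b * expR (b * t)).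
Proof.
move=> t t0.
have : is_derive t 1 (fun t => expR (b * t) : R^o) (b * expR (b * t)).
  have D1 : is_derive t (1 : R) ( *%R b : R -> R) b.
    by apply: is_derive_eq (is_deriveZ b (is_derive_id t 1)) _; rewrite [_ *: _]mulr1.
  by apply: is_derive_eq (is_derive1_comp (is_derive_expR (b * t)) D1) _; rewrite mulrC.
move=> [/cvg_ex [l Hl] D].
have El : l = b * expR (b * t) by rewrite -D; apply/esym/cvg_lim.
rewrite -El.
have : (fun h : R => h^-1 *: (expR (b * (t + h)) - expR (b * t) : R^o)) h @[h --> 0^'] --> l.
  apply: cvg_trans Hl; apply: near_eq_cvg; near=> h => /=.
  by rewrite [h%:A]mulr1 [h + t]addrC.
apply: cvg_trans; apply: cvg_app.
move=> A HA; apply: (@filterS _ (nbhs (0 : R)) _ _ _ _ HA) => h H [h0 _]; exact: H.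
Unshelve. all: by end_near. Qed.

Lemma has_deriv0Z V (a a' : R -> R) (f f' : R -> V) : has_deriv0 (a : R -> R^o) a' ->
  has_deriv0 f f' -> has_deriv0 (fun t => a t *: f t) (fun t => a' t *: f t + a t *: f' t).
Proof.
apply: (@has_deriv0_bilin R^o V V (fun a v => a *: v) 1).
- by move=> v k x y; rewrite scalerDr !scalerA mulrC.
- by move=> w k x y; rewrite scalerDl -scalerA.
- by move=> v w; rewrite mul1r normrZ.
Qed.
End Calculus.
Arguments C0_cst {R V} v.
Arguments has_deriv0_cst {R V} v.
Arguments has_deriv0_exp {R} b.
Arguments has_deriv0Zc {R V} a {f f'} _.
Arguments C0Zc {R V} a {f} _.

(** * Primitives *)

Ltac minmax := repeat (match goal with
  | |- context [Num.min ?a ?b] => case: (leP a b)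
  | |- context [Num.max ?a ?b] => case: (leP a b) end); intros; lra.

Section Primitive.
Variables (R : realType) (V : completeNormedModType R) (f : R -> V).

(** Length of the part of the cell [[k w, (k + 1) w]] that lies to the left of [t]. *)
Definition cell_part (w : R) (k : nat) (t : R) : R :=
  Num.min (Num.max (t - k%:R * w) 0) w.

(** Integral up to [t] of the step function equal to [f (k w)] on the [k]-th of [M] cells. *)
Definition riemann_sum (w : R) (M : nat) (t : R) : V :=
  \sum_(k < M) cell_part w k t *: f (k%:R * w).

Lemma cell_part_sum (w : R) (M : nat) (t : R) : 0 < w -> 0 <= t ->
  \sum_(k < M) cell_part w k t = Num.min t (M%:R * w).
Proof.
move=> w0 t0; elim: M => [|M IHM].
  by rewrite big_ord0 mul0r; apply/esym/min_idPr.
rewrite big_ord_recr /= IHM /cell_part -addn1 natrD mulrDl mul1r.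
set a := M%:R * w.
by minmax.
Qed.

Lemma cell_part_mono (w : R) (k : nat) (s t : R) : s <= t ->
  cell_part w k s <= cell_part w k t.
Proof.
move=> st; rewrite /cell_part; set a := _ * w.
by minmax.
Qed.

Lemma cell_part_supp (w : R) (k : nat) (s t : R) : 0 < w -> s <= t ->
  t <= k%:R * w \/ k%:R * w + w <= s -> cell_part w k s = cell_part w k t.
Proof.
move=> w0 st; rewrite /cell_part; set a := _ * w => H.
by minmax.
Qed.

Lemma riemann_sum_ext (w : R) (M M' : nat) (t : R) : 0 < w -> 0 <= t ->
  t <= M%:R * w -> (M <= M')%N -> riemann_sum w M' t = riemann_sum w M t.
Proof.
move=> w0 t0 tM; elim: M' => [|M' IH]; first by rewrite leqn0 => /eqP ->.
rewrite leq_eqVlt => /orP[/eqP-> //|]; rewrite ltnS => MM'.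
rewrite /riemann_sum big_ord_recr /= -/(riemann_sum w M' t) IH //.
have tM' : t <= M'%:R * w by apply: (le_trans tM); rewrite ler_pM2r // ler_nat.
suff -> : cell_part w M' t = 0 by rewrite scale0r addr0.
rewrite /cell_part; set a := _ * w in tM' *.
by minmax.
Qed.

(** A cell that contributes to the increment from [s] to [t] has its node [k w] strictly between
    [s - w] and [t]; this is why [f] must be close to [v] already from [s - w] on. *)
Lemma riemann_sum_est (w : R) (M : nat) (s t : R) (v : V) (e : R) :
  0 < w -> 0 <= s -> s <= t -> t <= M%:R * w ->
  (forall r : R, 0 <= r -> s - w <= r -> r <= t -> `|f r - v| <= e) ->
  `|riemann_sum w M t - riemann_sum w M s - (t - s) *: v| <= e * (t - s).
Proof.
move=> w0 s0 st tM H.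
have Et : t - s = \sum_(k < M) (cell_part w k t - cell_part w k s).
  rewrite sumrB !cell_part_sum //; last lra.
  by congr (_ - _); apply/esym/min_idPl; lra.
rewrite {1}Et scaler_suml /riemann_sum -!sumrB.
apply: (le_trans (ler_norm_sum _ _ _)); rewrite Et mulr_sumr; apply: ler_sum => k _.
have -> : cell_part w k t *: f (k%:R * w) - cell_part w k s *: f (k%:R * w) -
    (cell_part w k t - cell_part w k s) *: v =
    (cell_part w k t - cell_part w k s) *: (f (k%:R * w) - v) by linear_comb R.
have [H1|/not_orP[/negP H1 /negP H2]] := pselect (t <= k%:R * w \/ k%:R * w + w <= s).
  by rewrite (cell_part_supp w0 st H1) subrr scale0r normr0 mulr0.
move: H1 H2; rewrite -!ltNge => H1 H2.
rewrite normrZ ger0_norm ?subr_ge0 ?cell_part_mono // mulrC ler_wpM2r ?subr_ge0 ?cell_part_mono //.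
apply: H; [by rewrite mulr_ge0 // ltW|lra|lra].
Qed.

Let w (N : nat) : R := N.+1%:R^-1.
(** The number of cells varies with [t] so that they always reach beyond [t]; by [riemann_sum_ext]
    surplus cells do not change the value. *)
Let G N t := riemann_sum (w N) (N.+1 * (Num.truncn t).+1) t.

Let w0 N : 0 < w N. Proof. by rewrite invr_gt0 ltr0n. Qed.

Let G_hor N t : 0 <= t -> t <= (N.+1 * (Num.truncn t).+1)%N%:R * w N.
Proof.
move=> t0; rewrite natrM mulrAC /w divff ?mul1r ?pnatr_eq0 //.
by have := truncnS_gt t; apply: ltW.
Qed.

Let G_est N (s t : R) (v : V) (e : R) : 0 <= s -> s <= t ->
  (forall r : R, 0 <= r -> s - w N <= r -> r <= t -> `|f r - v| <= e) ->
  `|G N t - G N s - (t - s) *: v| <= e * (t - s).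
Proof.
move=> s0 st H; rewrite /G.
rewrite -(@riemann_sum_ext _ (N.+1 * (Num.truncn s).+1) (N.+1 * (Num.truncn t).+1) s) //.
- by apply: riemann_sum_est => //; apply: G_hor; lra.
- exact: G_hor.
- by rewrite leq_mul2l /= ltnS; apply: le_truncn.
Qed.

Let w_small (d : R) : 0 < d -> exists N0, forall N, (N0 <= N)%N -> w N < d.
Proof.
move=> d0; exists (Num.truncn d^-1) => N H; rewrite /w invf_plt ?posrE ?ltr0n //.
apply: (lt_le_trans (truncnS_gt _)); by rewrite ler_nat ltnS.
Qed.

(** On a short interval around [c] all fine Riemann sums have an increment close to
    [(y - x) *: f c]; interval induction adds these comparisons up to the Cauchy property on
    [[0, t]], and completeness of [V] gives the limit. *)
Lemma primitive_exists : C0 f -> exists2 F : R -> V, F 0 = 0 & has_deriv0 F f.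
Proof.
move=> /C0P cf.
have G0 N : G N 0 = 0.
  rewrite /G /riemann_sum big1 // => k _; rewrite /cell_part.
  suff -> : Num.min (Num.max (0 - k%:R * w N) 0) (w N) = 0 by rewrite scale0r.
  have := mulr_ge0 (ler0n R k) (ltW (w0 N)); have := w0 N.
  by minmax.
have Gcauchy t : 0 <= t -> forall e : R, 0 < e -> exists N0, forall N N',
    (N0 <= N)%N -> (N0 <= N')%N -> `|G N t - G N' t| <= e * t.
  move=> t0 e e0.
  suff : exists N0, forall N N', (N0 <= N)%N -> (N0 <= N')%N ->
    `|(G N t - G N 0) - (G N' t - G N' 0)| <= e * (t - 0).
    by move=> [N0 H]; exists N0 => N N' h h'; have := H N N' h h'; rewrite !G0 !subr0.
  apply: (@interval_induction _ (fun x y => exists N0, forall N N', (N0 <= N)%N -> (N0 <= N')%N ->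
    `|(G N y - G N x) - (G N' y - G N' x)| <= e * (y - x)) 0 t t0).
    move=> x y z _ xy yz _ [N1 H1] [N2 H2]; exists (maxn N1 N2) => N N'.
    rewrite !geq_max => /andP[a1 a2] /andP[b1 b2].
    have -> : G N z - G N x - (G N' z - G N' x) =
      (G N z - G N y - (G N' z - G N' y)) + (G N y - G N x - (G N' y - G N' x)) by linear_comb R.
    apply: (le_trans (ler_normD _ _)); have := H1 _ _ a1 b1; have := H2 _ _ a2 b2; nra.
  move=> c c0 ct; have e20 : 0 < e / 2 by lra.
  have [d d0 Hd] := cf c c0 _ e20.
  exists (d / 2); first lra.
  move=> x y x0 xc cy yt yx.
  have [|N0 HN0] := @w_small (d / 2); first lra.
  exists N0 => N N' /HN0 wN /HN0 wN'.
  have est K : w K < d / 2 -> `|G K y - G K x - (y - x) *: f c| <= e / 2 * (y - x).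
    move=> wK; apply: G_est; [lra|lra|] => r r0 rx ry; apply: Hd => //.
    by apply/ltr_normlP; split; lra.
  have -> : G N y - G N x - (G N' y - G N' x) =
     (G N y - G N x - (y - x) *: f c) - (G N' y - G N' x - (y - x) *: f c) by linear_comb R.
  apply: (le_trans (ler_normB _ _)); have := est _ wN; have := est _ wN'; lra.
have Gcvg t : 0 <= t -> cvg (G N t @[N --> \oo]).
  move=> t0; apply/cauchy_cvgP; apply: cauchy_exP => e /= e0.
  have e'0 : 0 < e / (2 * (t + 1)) by apply: divr_gt0 => //; lra.
  have [N0 HN0] := Gcauchy t t0 _ e'0; exists (G N0 t).
  exists N0 => //= N /= hN; rewrite -ball_normE /ball_ /=.
  apply: (le_lt_trans (HN0 _ _ (leqnn _) hN)).
  rewrite mulrAC ltr_pdivrMr; [nra|lra].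
pose F t := lim (G N t @[N --> \oo]).
(* The estimate of [G] survives in the limit: once the mesh is below [d], the enlarged interval is
   covered by the hypothesis. *)
have F_est (s t : R) (v : V) (e d : R) : 0 < d -> 0 <= s -> s <= t ->
  (forall r : R, 0 <= r -> s - d <= r -> r <= t -> `|f r - v| <= e) ->
  `|F t - F s - (t - s) *: v| <= e * (t - s).
  move=> d0 s0 st H; apply/ler_addgt0Pr => del del0.
  have t0 : 0 <= t by lra.
  have del20 : 0 < del / 2 by lra.
  near \oo => N.
  have HFt : `|F t - G N t| <= del / 2.
    by near: N; have /cvgrPdist_le := Gcvg t t0; apply.
  have HFs : `|F s - G N s| <= del / 2.
    by near: N; have /cvgrPdist_le := Gcvg s s0; apply.
  have wN : w N < d.
    by near: N; have [N0 HN0] := w_small d0; exists N0.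
  have := @G_est N s t v e s0 st.
  have -> : F t - F s - (t - s) *: v =
   (F t - G N t) - (F s - G N s) + (G N t - G N s - (t - s) *: v) by linear_comb R.
  move=> /(_ _) HG; apply: (le_trans (ler_normD _ _)).
  have := ler_normB (F t - G N t) (F s - G N s).
  have : `|G N t - G N s - (t - s) *: v| <= e * (t - s).
    by apply: HG => r r0 r1 r2; apply: H => //; lra.
  lra.
exists F.
  by rewrite /F; under eq_fun do rewrite G0; apply: lim_cst.
apply/has_deriv0P => t t0 e e0; have [d d0 Hd] := cf t t0 e e0.
exists (d / 2); first lra.
move=> s s0 sd.
have [st|st] := leP s t.
  have -> : F s - F t - (s - t) *: f t = - (F t - F s - (t - s) *: f t) by linear_comb R.
  rewrite normrN (distrC s) ger0_norm ?subr_ge0 //; move: sd; rewrite distrC ger0_norm ?subr_ge0 // => sd.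
  apply: (@F_est _ _ _ _ (d / 2)) => //; first lra.
  by move=> r r0 r1 r2; apply: Hd => //; apply/ltr_normlP; split; lra.
rewrite ger0_norm ?subr_ge0 ?(ltW st) //; move: sd; rewrite ger0_norm ?subr_ge0 ?(ltW st) // => sd.
apply: (@F_est _ _ _ _ (d / 2)) => //; [lra|exact: ltW|].
by move=> r r0 r1 r2; apply: Hd => //; apply/ltr_normlP; split; lra.
Unshelve. all: by end_near. Qed.

End Primitive.

(** * Strongly continuous semigroups *)

HB.instance Definition _ (R : realType) (m n : nat) := Complete.copy 'M[R]_(m, n) 'M[R]_(m, n).

(** A decomposition provides the state space of its stable part as a mere [normedModType]. Its
    completeness is a theorem, and [complete_packE] allows the space to be replaced by its complete
    version. *)
Definition complete_pack (R : realType) (V : normedModType R)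
  (H : forall F : set_system V, ProperFilter F -> cauchy F -> cvg F) : completeNormedModType R :=
  HB.pack V (Uniform_isComplete.Build V H).

Lemma complete_packE (R : realType) (V : normedModType R)
  (H : forall F : set_system V, ProperFilter F -> cauchy F -> cvg F) :
  complete_pack H = V :> normedModType R.
Proof. by case: V H => T []. Qed.

Lemma bounded_lin_cvg (R : realType) (V W : normedModType R) (L : V -> W) T (F : set_system T)
  (FF : Filter F) (f : T -> V) (a : V) :
  bounded_lin L -> f x @[x --> F] --> a -> L (f x) @[x --> F] --> L a.
Proof. by move=> [_ c] H; exact: (continuous_cvg _ (c a) H). Qed.

Lemma bounded_lin_cvg_pinfty (R : realType) (V W : normedModType R) (L : V -> W) (f : R -> V) (a : V) :
  bounded_lin L -> f x @[x --> +oo] --> a -> L (f x) @[x --> +oo] --> L a.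
Proof. exact: bounded_lin_cvg. Qed.

Lemma cvg_pinfty_uniq (R : realType) (V : normedModType R) (f : R -> V) (a b : V) :
  f t @[t --> +oo] --> a -> f t @[t --> +oo] --> b -> a = b.
Proof. exact: cvg_unique. Qed.

Section RightLimit.
Variables (R : realType) (V : normedModType R).

Lemma cvg_right0P (f : R -> V) (l : V) : (f h @[h --> 0^'+] --> l) <->
  (forall e : R, 0 < e -> exists2 d : R, 0 < d & forall h : R, 0 < h -> h < d -> `|f h - l| <= e).
Proof.
split.
  move=> /cvgrPdist_le H e e0; have := H e e0; rewrite near_withinE => /nbhs_ballP[d /= d0 Hd].
  exists d => // h h0 hd; rewrite distrC; apply: Hd => //.
  by rewrite /ball /= sub0r normrN gtr0_norm.
move=> H; apply/cvgrPdist_le => e e0; have [d d0 Hd] := H e e0.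
rewrite near_withinE; apply/nbhs_ballP; exists d => //= h.
rewrite /ball /= sub0r normrN => hd h0; rewrite distrC; apply: Hd => //.
by rewrite gtr0_norm in hd.
Qed.

Lemma has_deriv0_right (f f' : R -> V) : has_deriv0 f f' ->
  h^-1 *: (f h - f 0) @[h --> 0^'+] --> f' 0.
Proof.
move=> /has_deriv0P df; apply/cvg_right0P => e e0.
have [d d0 Hd] := df 0 (lexx 0) e e0; exists d => // h h0 hd.
have := Hd h (ltW h0); rewrite subr0 gtr0_norm // => /(_ hd) K.
rewrite -(ler_pM2l h0) -[X in X * `|_|](gtr0_norm h0) -normrZ.
by rewrite scalerBr scalerA divff ?gt_eqF // scale1r mulrC.
Qed.

Lemma exp_small (K c e : R) : 0 < c -> 0 < e -> exists2 s : R, 0 <= s &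
  forall t : R, s <= t -> K * expR (- (c * t)) <= e.
Proof.
move=> c0 e0; exists (`|K| / e / c); first by rewrite !divr_ge0 // ltW.
move=> t st; have : `|K| / e <= expR (c * t).
  rewrite ler_pdivrMr // in st; apply: (le_trans st); rewrite mulrC.
  by apply: le_trans (expR_ge1Dx _); rewrite lerDr.
rewrite ler_pdivrMr // => H; rewrite expRN ler_pdivrMr ?expR_gt0 // mulrC.
exact: le_trans (ler_norm K) H.
Qed.

Lemma exp_decay_cvg (f : R -> V) (K c : R) : 0 < c ->
  (forall t : R, 0 <= t -> `|f t| <= K * expR (- (c * t))) -> f t @[t --> +oo] --> (0 : V).
Proof.
move=> c0 H; apply/cvgr0Pnorm_le => e e0; have [s s0 Hs] := exp_small K c0 e0.
near=> t; have ts : s <= t by near: t; exact/nbhs_pinfty_ge/num_real.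
by apply: le_trans (H t _) (Hs t ts); apply: le_trans s0 ts.
Unshelve. all: by end_near. Qed.

Lemma cvg_right0_uniq (f : R -> V) (l l' : V) :
  f h @[h --> 0^'+] --> l -> f h @[h --> 0^'+] --> l' -> l = l'.
Proof. exact: cvg_unique. Qed.

End RightLimit.

Record semigroup_gen (R : realType) (V : normedModType R) (A : V -> V) (D : set V)
  (T : R -> V -> V) : Prop := SemigroupGen {
  sg_lin : forall t : R, 0 <= t -> bounded_lin (T t);
  sg0 : forall x : V, T 0 x = x;
  sg_add : forall s t : R, 0 <= s -> 0 <= t -> forall x : V, T (s + t) x = T s (T t x);
  sg_cont : forall x : V, T t x @[t --> 0^'+] --> x;
  sg_dom : forall x : V, D x <-> exists l : V, (h^-1 *: (T h x - x)) @[h --> 0^'+] --> l;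
  sg_gen : forall x : V, D x -> (h^-1 *: (T h x - x)) @[h --> 0^'+] --> A x }.

Lemma generatorP (R : realType) (V : normedModType R) (A : V -> V) (D : set V) :
  generator A D <-> exists T, semigroup_gen A D T.
Proof.
split=> -[T]; first by move=> [? [? [? [? [? ?]]]]]; exists T; split.
by case=> *; exists T.
Qed.

Section Semigroup.
Variables (R : realType) (V : completeNormedModType R) (A : V -> V) (D : set V) (T : R -> V -> V).
Hypothesis SG : semigroup_gen A D T.
Let Tlin := sg_lin SG.
Let T0 := sg0 SG.
Let Tadd := sg_add SG.
Let Tcont := sg_cont SG.
Let TDom := sg_dom SG.
Let TA := sg_gen SG.

Lemma semigroup_near0 (x : V) (e : R) : 0 < e ->
  exists2 d : R, 0 < d & forall h : R, 0 <= h -> h < d -> `|T h x - x| <= e.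
Proof.
move=> e0; have /cvg_right0P /(_ e e0)[d d0 Hd] := @Tcont x.
exists d => // h; rewrite le_eqVlt => /orP[/eqP <- _|h0 hd]; last exact: Hd.
by rewrite T0 subrr normr0 ltW.
Qed.

(** Otherwise there are times [h n <= 1 / (n + 1)] at which the operator norm exceeds [n + 1]. The
    family [T (h n)] is pointwise bounded by strong continuity at 0, which contradicts
    Banach-Steinhaus. *)
Lemma semigroup_bound0 : exists2 d : R, 0 < d & exists M : R, 1 <= M /\
  forall h : R, 0 <= h -> h <= d -> forall x, `|T h x| <= M * `|x|.
Proof.
apply: contrapT => Hn.
have Hex (n : nat) : exists h : R, [/\ 0 <= h, h <= n.+1%:R^-1 & exists x, n.+1%:R * `|x| < `|T h x|].
  apply: contrapT => Hc; apply: Hn; exists n.+1%:R^-1; first by rewrite invr_gt0 ltr0n.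
  exists n.+1%:R; split=> [|h h0 hd x]; first by rewrite ler1n.
  rewrite leNgt; apply/negP => Hx; apply: Hc; exists h; split => //; by exists x.
have [h Hh] := choice Hex.
pose F : set (V -> V) := [set T (h n) | n in [set: nat]].
have : uniform_bounded F.
  apply: Banach_Steinhauss.
    move=> _ [n _ <-]; have [h0 _ _] := Hh n; have bT := Tlin h0; split; last first.
      by move=> a x y; have [l _] := bT; rewrite l.
    have [M M0 HM] := bounded_lin_bound bT => r; exists (M * r) => x xr.
    by apply: (le_trans (HM x)); rewrite ler_wpM2l // ltW.
  move=> x; have [d d0 Hd] := semigroup_near0 x ltr01.
  pose N := Num.truncn d^-1.
  (* From [N] on, [h n] lies in the range where [T h x] is within 1 of [x]; the finitely many
     earlier operators are covered by the sum. *)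
  exists (`|x| + 1 + \sum_(k < N) `|T (h k) x|) => _ [n _ <-].
  have [h0 hn _] := Hh n.
  have [nN|nN] := ltnP n N.
    rewrite (bigD1 (Ordinal nN)) //=; set S := bigop _ _ _.
    have : 0 <= S by apply: sumr_ge0.
    by have := normr_ge0 x; lra.
  rewrite -[leLHS]addr0; apply: lerD; last exact: sumr_ge0.
  have -> : T (h n) x = x + (T (h n) x - x) by rewrite addrC subrK.
  apply: (le_trans (ler_normD _ _)); rewrite lerD2l; apply: Hd => //.
  apply: (le_lt_trans hn); rewrite invf_plt ?posrE ?ltr0n //.
  by apply: (lt_le_trans (truncnS_gt _)); rewrite ler_nat ltnS.
move=> /(_ 1)[M HM].
pose n := Num.truncn M; have [h0 _ [x Hx]] := Hh n.
have bT := Tlin h0.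
have x0 : x != 0 by apply: contraTneq Hx => ->; rewrite (bounded_lin0 bT) normr0 mulr0 ltxx.
have nx : 0 < `|x| by rewrite normr_gt0.
have : `|T (h n) (`|x|^-1 *: x)| <= M.
  apply: HM; first by exists n.
  by rewrite normrZ normfV normr_id mulVf // gt_eqF.
rewrite bounded_linZ // normrZ normfV normr_id mulrC ler_pdivrMr // => H1.
have : n.+1%:R * `|x| < M * `|x| by apply: (lt_le_trans Hx).
rewrite ltr_pM2r // => H2; have := truncnS_gt M; rewrite -/n => H3.
by have := lt_trans H2 H3; rewrite ltxx.
Qed.

Lemma semigroup_bound (b : R) : exists2 M : R, 1 <= M &
  forall t : R, 0 <= t -> t <= b -> forall x, `|T t x| <= M * `|x|.
Proof.
have [d d0 [M [M1 HM]]] := semigroup_bound0.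
have M0 : 0 <= M by lra.
have Hn (n : nat) t : 0 <= t -> t <= n%:R * d -> forall x, `|T t x| <= M ^+ n * `|x|.
  elim: n t => [|n IHn] t t0 tn x.
    have -> : t = 0 by rewrite mul0r in tn; lra.
    by rewrite T0 expr0 mul1r.
  have [td|td] := leP t d.
    apply: (le_trans (HM _ t0 td x)); rewrite ler_wpM2r // exprS ler_peMr //.
    by rewrite exprn_ege1.
  have td0 : 0 <= t - d by lra.
  have -> : t = d + (t - d) by rewrite addrC subrK.
  rewrite Tadd ?(ltW d0) // exprS -mulrA.
  apply: (le_trans (HM d (ltW d0) (lexx d) _)); rewrite ler_wpM2l //.
  by apply: IHn => //; rewrite -addn1 natrD mulrDl mul1r in tn; lra.
pose n := (Num.truncn (b / d)).+1; exists (M ^+ n); first by rewrite exprn_ege1.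
move=> t t0 tb; apply: Hn => //; apply: (le_trans tb); rewrite -ler_pdivrMr //.
exact/ltW/truncnS_gt.
Qed.

Lemma orbit_C0 (x : V) : C0 (T^~ x).
Proof.
apply/C0P => t t0 e e0.
have [M M1 HM] := semigroup_bound t.
have M0 : 0 < M by lra.
have [d d0 Hd] := semigroup_near0 x (divr_gt0 e0 M0).
exists d => // s s0 sd.
have key u h : 0 <= u -> u <= t -> 0 <= h -> h < d -> `|T (u + h) x - T u x| <= e.
  move=> u0 ut h0 hd; rewrite Tadd // -(bounded_linB _ _ (Tlin u0)).
  apply: (le_trans (HM _ u0 ut _)); rewrite mulrC -ler_pdivlMr //; exact: Hd.
have [ts|st] := leP t s.
  have -> : s = t + (s - t) by rewrite addrC subrK.
  apply: key => //; first by rewrite subr_ge0.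
  by rewrite ger0_norm ?subr_ge0 // in sd.
rewrite distrC; have -> : T t x = T (s + (t - s)) x by rewrite addrC subrK.
apply: key => //; [exact: ltW|by rewrite subr_ge0 ltW|].
by rewrite ltr0_norm ?subr_lt0 // opprB in sd.
Qed.

Lemma Dom_near0 (x : V) (e : R) : D x -> 0 < e ->
  exists2 d : R, 0 < d & forall h : R, 0 <= h -> h < d -> `|T h x - x - h *: A x| <= e * h.
Proof.
move=> Dx e0; have /cvg_right0P /(_ e e0)[d d0 Hd] := TA Dx.
exists d => // h; rewrite le_eqVlt => /orP[/eqP <- _|h0 hd].
  by rewrite T0 subrr scale0r subrr normr0 mulr0.
have := Hd h h0 hd; rewrite -(ler_pM2l h0) -[X in X * `|_|](gtr0_norm h0) -normrZ.
by rewrite scalerBr scalerA divff ?gt_eqF // scale1r mulrC.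
Qed.

Lemma Dom_intro (x l : V) : h^-1 *: (T h x - x) @[h --> 0^'+] --> l -> D x /\ A x = l.
Proof.
move=> H; have Dx : D x by apply/TDom; exists l.
by split => //; apply: cvg_right0_uniq (TA Dx) H.
Qed.

Lemma Dom_lin (a : R) (x y : V) : D x -> D y -> D (a *: x + y) /\ A (a *: x + y) = a *: A x + A y.
Proof.
move=> Dx Dy; apply: Dom_intro.
have : a *: (h^-1 *: (T h x - x)) + h^-1 *: (T h y - y) @[h --> 0^'+] --> a *: A x + A y.
  by apply: cvgD; [apply: cvgZr; apply: TA|apply: TA].
apply: cvg_trans; apply: near_eq_cvg; near=> h.
have h0 : 0 <= h by apply: ltW; near: h; exact: nbhs_right_gt.
rewrite (bounded_linD _ _ (Tlin h0)) (bounded_linZ _ _ (Tlin h0)).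
by linear_comb R.
Unshelve. all: by end_near. Qed.

Lemma Dom0 : D 0 /\ A 0 = 0.
Proof.
apply: Dom_intro; apply: (@cvg_trans _ ((0 : V) @[h --> 0^'+])); last exact: cvg_cst.
apply: near_eq_cvg; near=> h.
have h0 : 0 <= h by apply: ltW; near: h; exact: nbhs_right_gt.
by rewrite (bounded_lin0 (Tlin h0)) subrr scaler0.
Unshelve. all: by end_near. Qed.

Lemma DomZ (a : R) (x : V) : D x -> D (a *: x) /\ A (a *: x) = a *: A x.
Proof.
move=> Dx; have [D0 A0] := Dom0; have := Dom_lin a Dx D0; by rewrite !addr0 A0 addr0.
Qed.

Lemma DomB (x y : V) : D x -> D y -> D (x - y) /\ A (x - y) = A x - A y.
Proof.
by move=> Dx Dy; have := Dom_lin (-1) Dy Dx; rewrite !scaleN1r addrC [- A y + _]addrC.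
Qed.

Lemma orbit_Dom (x : V) (t : R) : 0 <= t -> D x -> D (T t x) /\ A (T t x) = T t (A x).
Proof.
move=> t0 Dx; apply: Dom_intro.
have FF : Filter (0 : R)^'+ by exact: within_filter.
have := bounded_lin_cvg FF (Tlin t0) (TA Dx).
apply: cvg_trans; apply: near_eq_cvg; near=> h.
have h0 : 0 <= h by apply: ltW; near: h; exact: nbhs_right_gt.
by rewrite /= (bounded_linZ _ _ (Tlin t0)) (bounded_linB _ _ (Tlin t0)) -!Tadd // [t + h]addrC.
Unshelve. all: by end_near. Qed.

Lemma orbit_deriv (x : V) : D x -> has_deriv0 (T^~ x) (fun t => T t (A x)).
Proof.
move=> Dx; apply/has_deriv0P => t t0 e e0.
have [M M1 HM] := semigroup_bound t.
have M0 : 0 < M by lra.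
have e20 : 0 < e / 2 by lra.
have [d d0 Hd] := Dom_near0 Dx (divr_gt0 e20 M0).
have [d' d'0 Hd'] := (iffLR (C0P _) (@orbit_C0 (A x))) t t0 _ e20.
exists (Num.min d d'); first by rewrite lt_min d0.
move=> s s0; rewrite lt_min => /andP[sd sd'].
have key u h : 0 <= u -> u <= t -> 0 <= h -> h < d ->
   `|T (u + h) x - T u x - h *: T u (A x)| <= e / 2 * h.
  move=> u0 ut h0 hd; rewrite Tadd // -(bounded_linZ _ _ (Tlin u0)) -!(bounded_linB _ _ (Tlin u0)).
  apply: (le_trans (HM _ u0 ut _)); rewrite mulrC -ler_pdivlMr // mulrAC; exact: Hd.
have [ts|st] := leP t s.
  rewrite [`|s - t|]ger0_norm ?subr_ge0 // in sd *.
  have := @key t (s - t) t0 (lexx t); rewrite [t + _]addrC subrK subr_ge0 => /(_ ts sd) H.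
  by apply: (le_trans H); rewrite ler_wpM2r ?subr_ge0 //; lra.
have ts := ltW st.
have Est : s + (t - s) = t by rewrite addrC subrK.
have := @key s (t - s) s0 ts; rewrite Est subr_ge0 => H.
have Hs := Hd' s s0 sd'.
rewrite [`|s - t|]ltr0_norm ?subr_lt0 // opprB in sd *.
have -> : T s x - T t x - (s - t) *: T t (A x) =
  - (T t x - T s x - (t - s) *: T s (A x)) - (t - s) *: (T s (A x) - T t (A x)) by linear_comb R.
apply: (le_trans (ler_normB _ _)); rewrite normrN normrZ ger0_norm ?subr_ge0 //.
have := H ts sd; have : (t - s) * `|T s (A x) - T t (A x)| <= (t - s) * (e / 2).
  by rewrite ler_wpM2l ?subr_ge0.
lra.
Qed.

(** Variation of constants in differential form. With the mean value inequality it gives both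
    uniqueness and the estimate of forced trajectories without an integral. *)
Lemma variation_deriv (x x' : R -> V) (t : R) : 0 <= t -> has_deriv0 x x' ->
  (forall s : R, 0 <= s -> D (x s)) ->
  dvon 0 t (fun s => T (t - s) (x s)) (fun s => T (t - s) (x' s - A (x s))).
Proof.
move=> t0 dx Dx s s0 st e e0.
have [M M1 HM] := semigroup_bound t.
have M0 : 0 < M by lra.
have e30 : 0 < e / 3 by lra.
have [d1 d10 H1] := (iffLR (has_deriv0P _ _) dx) s s0 _ (divr_gt0 e30 M0).
have ts0 : 0 <= t - s by lra.
have [d2 d20 H2] := (iffLR (C0P _) (@orbit_C0 (x' s))) (t - s) ts0 _ e30.
have [d3 d30 H3] := (iffLR (has_deriv0P _ _) (orbit_deriv (Dx s s0))) (t - s) ts0 _ e30.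
exists (Num.min d1 (Num.min d2 d3)); first by rewrite !lt_min d10 d20.
move=> r r0 rt; rewrite !lt_min => /and3P[r1 r2 r3].
have tr0 : 0 <= t - r by lra.
have E : t - r - (t - s) = - (r - s) by ring.
have nE : `|t - r - (t - s)| = `|r - s| by rewrite E normrN.
have := H2 _ tr0; rewrite nE => /(_ r2) K2.
have := H3 _ tr0; rewrite nE E => /(_ r3) K3.
have K1 := H1 r r0 r1.
have -> : T (t - r) (x r) - T (t - s) (x s) - (r - s) *: T (t - s) (x' s - A (x s)) =
  T (t - r) (x r - x s - (r - s) *: x' s) + (r - s) *: (T (t - r) (x' s) - T (t - s) (x' s))
  + (T (t - r) (x s) - T (t - s) (x s) - (- (r - s)) *: T (t - s) (A (x s))).
  rewrite !(bounded_linB _ _ (Tlin tr0)) !(bounded_linZ _ _ (Tlin tr0)) !(bounded_linB _ _ (Tlin ts0)).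
  by linear_comb R.
apply: (le_trans (ler_normD _ _)).
have B1 : `|T (t - r) (x r - x s - (r - s) *: x' s)| <= e / 3 * `|r - s|.
  apply: (le_trans (HM _ tr0 _ _)); first lra.
  by rewrite mulrC -ler_pdivlMr // mulrAC.
have B2 : `|(r - s) *: (T (t - r) (x' s) - T (t - s) (x' s))| <= e / 3 * `|r - s|.
  by rewrite normrZ mulrC ler_wpM2r.
have := ler_normD (T (t - r) (x r - x s - (r - s) *: x' s))
  ((r - s) *: (T (t - r) (x' s) - T (t - s) (x' s))).
lra.
Qed.

Lemma semigroup_uniq (x x' : R -> V) : has_deriv0 x x' -> (forall s : R, 0 <= s -> D (x s)) ->
  (forall s : R, 0 <= s -> x' s = A (x s)) -> forall t : R, 0 <= t -> x t = T t (x 0).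
Proof.
move=> dx Dx xA t t0; have Dv := variation_deriv t0 dx Dx.
have D0 : dvon 0 t (fun=> 0 : R^o) (fun=> 0) := has_deriv0_dvon (b := t) (lexx 0) (has_deriv0_cst (0 : R^o)).
have := mean_value_ineq t0 Dv D0; rewrite subrr subr0 subrr T0 => H.
apply/eqP; rewrite -subr_eq0 -normr_le0; apply: H => s s0 st.
by rewrite xA // subrr bounded_lin0 ?normr0 //; apply: Tlin; lra.
Qed.

Lemma forced_estimate (M b b1 c : R) (x x' f : R -> V) (t : R) :
  (forall (t : R) x, 0 <= t -> `|T t x| <= M * expR (- (b * t)) * `|x|) -> 0 <= M ->
  b1 < b -> 0 <= t -> has_deriv0 x x' -> (forall s : R, 0 <= s -> D (x s)) ->
  (forall s : R, 0 <= s -> x' s = A (x s) + f s) ->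
  (forall s : R, 0 <= s -> s <= t -> `|f s| <= c * expR (- (b1 * s))) ->
  `|x t| <= M * expR (- (b * t)) * `|x 0| + c * (M / (b - b1)) * expR (- (b1 * t)).
Proof.
move=> HM M0 b1b t0 dx Dx xA Hf.
have c0 : 0 <= c.
  by have := Hf 0 (lexx 0) t0; rewrite mulr0 oppr0 expR0 mulr1; apply: le_trans.
have bb : 0 < b - b1 by lra.
(* Chosen so that [g] below is a primitive of [M e^{- b (t - s)} c e^{- b1 s}], the bound for the
   derivative of [T (t - s) (x s)]. *)
pose k := c * (M / (b - b1)) * expR (- (b * t)).
pose g s := k * expR ((b - b1) * s).
have dg : has_deriv0 (g : R -> R^o) (fun s => k * ((b - b1) * expR ((b - b1) * s))).
  exact: (@has_deriv0Zc _ R^o k _ _ (has_deriv0_exp (b - b1))).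
have Dv := variation_deriv t0 dx Dx.
have := mean_value_ineq t0 Dv (has_deriv0_dvon (b := t) (lexx 0) dg).
rewrite subrr subr0 T0 => H.
have {}H : `|x t - T t (x 0)| <= g t - g 0.
  apply: H => s s0 st.
  have -> : x' s - A (x s) = f s by rewrite xA // addrAC subrr add0r.
  have ts : 0 <= t - s by lra.
  apply: (le_trans (HM _ _ ts)).
  apply: (@le_trans _ _ (M * expR (- (b * (t - s))) * (c * expR (- (b1 * s))))).
    by rewrite ler_wpM2l ?Hf // mulr_ge0 // expR_ge0.
  rewrite /k.
  have -> : M * expR (- (b * (t - s))) * (c * expR (- (b1 * s))) =
     M * c * (expR (- (b * (t - s))) * expR (- (b1 * s))) by ring.
  have -> : c * (M / (b - b1)) * expR (- (b * t)) * ((b - b1) * expR ((b - b1) * s)) =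
    M * c * (expR (- (b * t)) * expR ((b - b1) * s)) by field; lra.
  rewrite -!expRD; suff -> : - (b * (t - s)) + - (b1 * s) = - (b * t) + (b - b1) * s by [].
  by ring.
have -> : x t = T t (x 0) + (x t - T t (x 0)) by rewrite addrC subrK.
apply: (le_trans (ler_normD _ _)); apply: lerD; first exact: HM.
apply: (le_trans H); rewrite /g mulr0 expR0 mulr1.
have k0 : 0 <= k by rewrite !mulr_ge0 ?expR_ge0 // invr_ge0 ltW.
have -> : k * expR ((b - b1) * t) = c * (M / (b - b1)) * expR (- (b1 * t)).
  rewrite /k -mulrA -expRD; suff -> : - (b * t) + (b - b1) * t = - (b1 * t) by [].
  by ring.
lra.
Qed.

(** With [F] the primitive of the orbit of [x], every [F t] lies in the domain, where the generator
    takes it to [T t x - x], and the averages [h^-1 *: F h] tend to [x]. *)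
Lemma Dom_dense (x : V) (e : R) : 0 < e -> exists2 y, D y & `|x - y| <= e.
Proof.
move=> e0; have [F F0 dF] := primitive_exists (@orbit_C0 x).
have FD t : 0 <= t -> D (F t).
  move=> t0; apply/TDom; exists (T t x - x).
  (* Both sides are functions of [t] with derivative [T (t + h) x] that vanish at 0. *)
  have TF h : 0 <= h -> T h (F t) = F (t + h) - F h.
    move=> h0.
    apply: (@has_deriv0_eq _ V (fun t => T h (F t)) (fun t => F (t + h) - F h)
      (fun t => T h (T t x)) (fun t => T (t + h) x)) => //.
    - exact: (has_deriv0_lin (Tlin h0) dF).
    - apply/has_deriv0P => s s0 e1 e10.
      have sh : 0 <= s + h by lra.
      have [d d0 Hd] := (iffLR (has_deriv0P _ _) dF) (s + h) sh _ e10.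
      exists d => // r r0 rs; have rh : 0 <= r + h by lra.
      have E : r + h - (s + h) = r - s by ring.
      have := Hd (r + h) rh; rewrite E => /(_ rs).
      by have -> : F (r + h) - F h - (F (s + h) - F h) = F (r + h) - F (s + h) by linear_comb R.
    - by move=> s s0; rewrite -Tadd // addrC.
    - by rewrite F0 add0r subrr (bounded_lin0 (Tlin h0)).
  apply/cvg_right0P => e1 e10; have e20 : 0 < e1 / 2 by lra.
  have [d d0 Hd] := (iffLR (has_deriv0P _ _) dF) t t0 _ e20.
  have [d' d'0 Hd'] := (iffLR (has_deriv0P _ _) dF) 0 (lexx 0) _ e20.
  exists (Num.min d d'); first by rewrite lt_min d0.
  move=> h h0; rewrite lt_min => /andP[hd hd'].
  have th : 0 <= t + h by lra.
  have E : t + h - t = h by ring.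
  have := Hd (t + h) th; rewrite E gtr0_norm // => /(_ hd) K1.
  have := Hd' h (ltW h0); rewrite subr0 gtr0_norm // F0 T0 subr0 => /(_ hd') K2.
  rewrite TF ?(ltW h0) // -(ler_pM2l h0) -[X in X * `|_|](gtr0_norm h0) -normrZ.
  rewrite [h *: _]scalerBr scalerA divff ?gt_eqF // scale1r.
  have -> : F (t + h) - F h - F t - h *: (T t x - x) =
     (F (t + h) - F t - h *: T t x) - (F h - h *: x) by linear_comb R.
  apply: (le_trans (ler_normB _ _)); lra.
have [d d0 Hd] := (iffLR (has_deriv0P _ _) dF) 0 (lexx 0) _ e0.
pose h := d / 2; have h0 : 0 < h by rewrite /h; lra.
exists (h^-1 *: F h).
  exact: (proj1 (DomZ _ (FD h (ltW h0)))).
have := Hd h (ltW h0); rewrite subr0 gtr0_norm // F0 T0 subr0 => K.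
rewrite -(ler_pM2l h0) -[X in X * `|_|](gtr0_norm h0) -normrZ scalerBr scalerA divff ?gt_eqF //.
by rewrite scale1r distrC mulrC; apply: K; rewrite /h; lra.
Qed.

(** Trajectories of [Sys] start in the domain; density and boundedness of each [T t] carry their
    decay to all states. The maximum with 0 is taken because nothing gives [M] a sign. *)
Lemma exp_bound_dense (M b : R) :
  (forall (t : R) x, D x -> 0 <= t -> `|T t x| <= M * expR (- (b * t)) * `|x|) ->
  forall (t : R) x, 0 <= t -> `|T t x| <= Num.max M 0 * expR (- (b * t)) * `|x|.
Proof.
move=> H t x t0; apply/ler_addgt0Pr => e e0.
have [K K0 HK] := bounded_lin_bound (Tlin t0).
pose c := Num.max M 0 * expR (- (b * t)).
have c0 : 0 <= c by rewrite mulr_ge0 ?expR_ge0 // le_max lexx orbT.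
have [|y Dy xy] := @Dom_dense x (e / (K + c)); first by rewrite divr_gt0 // ltr_wpDr.
have -> : T t x = T t (x - y) + T t y by rewrite (bounded_linB _ _ (Tlin t0)) subrK.
apply: (le_trans (ler_normD _ _)).
have H1 : `|T t y| <= c * `|y|.
  apply: (le_trans (H t y Dy t0)); rewrite ler_wpM2r // ler_wpM2r ?expR_ge0 //.
  by rewrite le_max lexx.
have H2 : `|y| <= `|x| + `|x - y|.
  have {1}-> : y = x - (x - y) by rewrite opprB addrC subrK.
  exact: ler_normB.
have H3 := HK (x - y).
rewrite ler_pdivlMr ?ltr_wpDr // in xy.
rewrite -/c; nra.
Qed.

(** [L x] is the improper integral of [e^{l t} T t x] over the half-line, that is [- (A + l)^-1 x];
    it converges because [l] is below the decay rate [b]. *)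
Lemma resolvent_exists (M b l : R) : 0 <= M -> 
  (forall (t : R) x, 0 <= t -> `|T t x| <= M * expR (- (b * t)) * `|x|) -> l < b ->
  exists L : V -> V, [/\ bounded_lin L, forall x, D (L x),
    forall x, A (L x) = - (l *: L x) - x & forall x, D x -> L (A x) = - (l *: L x) - x].
Proof.
move=> M0 HM lb.
pose orb x t := expR (l * t) *: T t x.
have cexp : C0 (fun t => expR (l * t) : R^o) := has_deriv0_C0 (has_deriv0_exp l).
have corb x : C0 (orb x) by apply: C0Z => //; apply: orbit_C0.
have orb0 x : orb x 0 = x by rewrite /orb mulr0 expR0 scale1r T0.
have c0 : 0 < b - l by lra.
pose c := b - l.
have orb_le x t : 0 <= t -> `|orb x t| <= M * `|x| * expR (- (c * t)).
  move=> t0; rewrite /orb normrZ gtr0_norm ?expR_gt0 //.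
  apply: (@le_trans _ _ (expR (l * t) * (M * expR (- (b * t)) * `|x|))).
    by rewrite ler_wpM2l ?expR_ge0 // HM.
  have -> : expR (l * t) * (M * expR (- (b * t)) * `|x|) = M * `|x| * (expR (l * t) * expR (- (b * t))) by ring.
  by rewrite -expRD; have -> : l * t + - (b * t) = - (c * t) by rewrite /c; ring.
have Fex x : exists f : R -> V, f 0 = 0 /\ has_deriv0 f (orb x).
  by have [f f0 df] := primitive_exists (corb x); exists f.
have [F HF] := choice Fex.
have F0 x : F x 0 = 0 by case: (HF x).
have dF x : has_deriv0 (F x) (orb x) by case: (HF x).
pose K (x : V) := M * `|x| / c.
have K0 x : 0 <= K x by rewrite !mulr_ge0 // invr_ge0 ltW.
have Fle x s t : 0 <= s -> s <= t -> `|F x t - F x s| <= K x * expR (- (c * s)).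
  move=> s0 st.
  have dg : has_deriv0 ((fun t => - K x * expR (- c * t)) : R -> R^o) (fun t => - K x * (- c * expR (- c * t))).
    exact: (@has_deriv0Zc _ R^o _ _ _ (has_deriv0_exp (- c))).
  have := mean_value_ineq st (has_deriv0_dvon (b := t) s0 (dF x)) (has_deriv0_dvon (b := t) s0 dg).
  move=> H; apply: le_trans (H _) _.
    move=> r r0 rt; have := orb_le x r (le_trans s0 r0); rewrite -[- (c * r)]mulNr.
    suff -> : - K x * (- c * expR (- c * r)) = M * `|x| * expR (- c * r) by [].
    by rewrite /K; field; rewrite gt_eqF.
  rewrite !mulNr opprK; have := mulr_ge0 (K0 x) (expR_ge0 (- (c * t))); lra.
have Fcvg x : cvg (F x t @[t --> +oo]).
  apply/cauchy_cvgP; apply: cauchy_exP => e /= e0.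
  have e20 : 0 < e / 2 by lra.
  have [s s0 Hs] := exp_small (K x) c0 e20; exists (F x s).
  near=> t; rewrite -ball_normE /ball_ /= distrC.
  have ts : s <= t by near: t; exact/nbhs_pinfty_ge/num_real.
  by apply: le_lt_trans (Fle x s t s0 ts) _; have := Hs s (lexx s); rewrite -/c; lra.
pose L x := lim (F x t @[t --> +oo]).
have Llim x : F x t @[t --> +oo] --> L x by apply: Fcvg.
have shift_oo (h : R) : (fun t : R => t + h) t @[t --> +oo] --> +oo.
  by apply/cvgryPge => a; near=> t; rewrite -lerBlDr; near: t; exact/nbhs_pinfty_ge/num_real.
(* Applying [e^{l h} T h] shifts the integrand by [h], so it removes the integral over [[0, h]]. *)
have Tshift x h : 0 <= h -> expR (l * h) *: T h (L x) = L x - F x h.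
  move=> h0.
  have E t : 0 <= t -> expR (l * h) *: T h (F x t) = F x (t + h) - F x h.
    apply: (@has_deriv0_eq _ V (fun t => expR (l * h) *: T h (F x t)) (fun t => F x (t + h) - F x h)
      (fun t => expR (l * h) *: T h (orb x t)) (fun t => orb x (t + h))).
    - exact: (has_deriv0_lin (bounded_lin_scale _ (Tlin h0)) (dF x)).
    - apply/has_deriv0P => s s0 e1 e10.
      have sh : 0 <= s + h by lra.
      have [d d0 Hd] := (iffLR (has_deriv0P _ _) (dF x)) (s + h) sh _ e10.
      exists d => // r r0 rs; have rh : 0 <= r + h by lra.
      have E : r + h - (s + h) = r - s by ring.
      have := Hd (r + h) rh; rewrite E => /(_ rs).
      by have -> : F x (r + h) - F x h - (F x (s + h) - F x h) = F x (r + h) - F x (s + h) by linear_comb R.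
    - move=> s s0; rewrite /orb (bounded_linZ _ _ (Tlin h0)) scalerA -expRD -Tadd //.
      by rewrite -mulrDr [h + s]addrC.
    - by rewrite F0 add0r subrr (bounded_lin0 (Tlin h0)) scaler0.
  have C1' : expR (l * h) *: T h (F x t) @[t --> +oo] --> expR (l * h) *: T h (L x).
    exact: (bounded_lin_cvg _ (bounded_lin_scale _ (Tlin h0)) (@Llim x)).
  apply: cvg_unique C1' _ => //.
  have : F x (t + h) - F x h @[t --> +oo] --> L x - F x h.
    apply: cvgB; last exact: cvg_cst.
    exact: (@cvg_comp _ _ _ (fun t => t + h) (F x) _ _ _ (shift_oo h) (@Llim x)).
  apply: cvg_trans; apply: near_eq_cvg; near=> t.
  by rewrite /= E //; near: t; exact/nbhs_pinfty_ge/num_real.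
have LD x : D (L x) /\ A (L x) = - (l *: L x) - x.
  apply: Dom_intro.
  (* By [Tshift] this is [T h (L x)], so its right derivative at 0 is the value of the generator at
     [L x]. *)
  pose phi h := expR (- l * h) *: (L x - F x h).
  have dphi := has_deriv0Z (has_deriv0_exp (- l)) (has_deriv0B (has_deriv0_cst (L x)) (dF x)).
  have := has_deriv0_right dphi.
  rewrite mulr0 expR0 F0 subr0 orb0 mulr1 !scale1r sub0r scaleNr.
  apply: cvg_trans; apply: near_eq_cvg; near=> h.
  have h0 : 0 <= h by apply: ltW; near: h; exact: nbhs_right_gt.
  by rewrite -Tshift // scalerA -expRD mulNr addNr expR0 scale1r.
exists L; split.
- apply: (@bounded_linP _ _ _ _ (M / c)).
    move=> a x y; apply: (cvg_pinfty_uniq (@Llim (a *: x + y))).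
    have : a *: F x t + F y t @[t --> +oo] --> a *: L x + L y.
      by apply: cvgD => //; apply: cvgZr.
    apply: cvg_trans; apply: near_eq_cvg; near=> t.
    suff E : forall s : R, 0 <= s -> a *: F x s + F y s = F (a *: x + y) s.
      by apply: E; near: t; exact/nbhs_pinfty_ge/num_real.
    have H1 := has_deriv0D (has_deriv0Zc a (dF x)) (dF y).
    have H2 := dF (a *: x + y).
    refine (has_deriv0_eq H1 H2 _ _).
    + move=> s s0; rewrite /orb (bounded_linD _ _ (Tlin s0)) (bounded_linZ _ _ (Tlin s0)).
      by linear_comb R.
    + by rewrite !F0 scaler0 addr0.
  move=> x; have : `|F x t| @[t --> +oo] --> `|L x| by apply: cvg_norm.
  move=> H; apply: (cvgr_to_le H); near=> t.
  have := Fle x 0 t (lexx 0); rewrite F0 subr0 mulr0 oppr0 expR0 mulr1 /K mulrAC; apply.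
  by near: t; exact/nbhs_pinfty_ge/num_real.
- by move=> x; case: (LD x).
- by move=> x; case: (LD x).
(* For [x] in the domain the derivative of [orb x] is [l *: orb x + orb (A x)]; integration from 0
   to infinity gives the identity. *)
- move=> x Dx.
  apply: (cvg_pinfty_uniq (@Llim (A x))).
  have : orb x t - l *: F x t - x @[t --> +oo] --> 0 - l *: L x - x.
    apply: cvgB; last exact: cvg_cst.
    by apply: cvgB; [exact: (exp_decay_cvg c0 (orb_le x))|apply: cvgZr].
  rewrite sub0r; apply: cvg_trans; apply: near_eq_cvg; near=> t.
  suff E : forall s : R, 0 <= s -> orb x s - l *: F x s - x = F (A x) s.
    by apply: E; near: t; exact/nbhs_pinfty_ge/num_real.
  apply: (has_deriv0_eq (has_deriv0B (has_deriv0B (has_deriv0Z (has_deriv0_exp l) (orbit_deriv Dx))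
    (has_deriv0Zc l (dF x))) (has_deriv0_cst x)) (dF (A x))).
  + by move=> s s0; rewrite /orb; linear_comb R.
  + by rewrite !F0 mulr0 expR0 T0; linear_comb R.
Unshelve. all: by end_near. Qed.
End Semigroup.

(** * Matrix exponentials *)

Section MatrixNorm.
Variable R : realType.

Lemma mx_entry_le m n (A : 'M[R]_(m, n)) i j : `|A i j| <= `|A|.
Proof.
rewrite [leRHS]/Num.norm /= mx_normrE; apply/bigmax_geP; right => /=; by exists (i, j).
Qed.

Lemma mx_norm_le m n (A : 'M[R]_(m, n)) (c : R) : 0 <= c ->
  (forall i j, `|A i j| <= c) -> `|A| <= c.
Proof.
move=> c0 H; rewrite [leLHS]/Num.norm /= mx_normrE; apply/bigmax_leP; by split.
Qed.

Lemma mx_norm_mul m n p (A : 'M[R]_(m, n)) (B : 'M[R]_(n, p)) :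
  `|A *m B| <= n%:R * `|A| * `|B|.
Proof.
apply: mx_norm_le; first by rewrite !mulr_ge0.
move=> i j; rewrite mxE; apply: (le_trans (ler_norm_sum _ _ _)).
have -> : n%:R * `|A| * `|B| = \sum_(k < n) (`|A| * `|B|).
  by rewrite sumr_const card_ord -mulrA mulr_natl.
apply: ler_sum => k _.
by rewrite normrM ler_pM // mx_entry_le.
Qed.

Lemma bounded_lin_mulmxl m n p (A : 'M[R]_(m, n)) :
  bounded_lin (fun B : 'M[R]_(n, p) => A *m B).
Proof.
apply: (@bounded_linP _ _ _ _ (n%:R * `|A|)); last exact: mx_norm_mul.
by move=> a x y; rewrite mulmxDr -scalemxAr.
Qed.

Lemma bounded_lin_mulmxr m n p (B : 'M[R]_(n, p)) :
  bounded_lin (fun A : 'M[R]_(m, n) => A *m B).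
Proof.
apply: (@bounded_linP _ _ _ _ (n%:R * `|B|)); last first.
  by move=> A; rewrite mulrAC; apply: mx_norm_mul.
by move=> a x y; rewrite mulmxDl -scalemxAl.
Qed.

Lemma bounded_lin_trmx m n : bounded_lin (fun A : 'M[R]_(m, n) => A^T).
Proof.
apply: (@bounded_linP _ _ _ _ 1); first by move=> a x y; rewrite linearP.
by move=> A; rewrite mul1r; apply: mx_norm_le => // i j; rewrite mxE mx_entry_le.
Qed.

Lemma bounded_lin_entry m n i j : bounded_lin (fun A : 'M[R]_(m, n) => A i j : R^o).
Proof.
apply: (@bounded_linP _ _ _ _ 1); first by move=> a x y; rewrite !mxE.
by move=> A; rewrite mul1r mx_entry_le.
Qed.

Lemma bounded_lin_row m n i : bounded_lin (fun A : 'M[R]_(m, n) => row i A).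
Proof.
apply: (@bounded_linP _ _ _ _ 1); first by move=> a x y; rewrite linearP.
by move=> A; rewrite mul1r; apply: mx_norm_le => // k j; rewrite mxE mx_entry_le.
Qed.

Lemma has_deriv0_mulmx m n p (f f' : R -> 'M[R]_(m, n)) (g g' : R -> 'M[R]_(n, p)) :
  has_deriv0 f f' -> has_deriv0 g g' ->
  has_deriv0 (fun t => f t *m g t) (fun t => f' t *m g t + f t *m g' t).
Proof.
apply: (@has_deriv0_bilin _ _ _ _ (fun A B => A *m B) n%:R).
- by move=> v; case: (bounded_lin_mulmxl p v).
- by move=> v; case: (bounded_lin_mulmxr m v).
- exact: mx_norm_mul.
Qed.

Lemma C0_mulmx m n p (f : R -> 'M[R]_(m, n)) (g : R -> 'M[R]_(n, p)) :
  C0 f -> C0 g -> C0 (fun t => f t *m g t).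
Proof.
apply: (@C0_bilin _ _ _ _ (fun A B => A *m B) n%:R).
- by move=> v; case: (bounded_lin_mulmxl p v).
- by move=> v; case: (bounded_lin_mulmxr m v).
- exact: mx_norm_mul.
Qed.

Lemma has_deriv0_mx m n (f f' : R -> 'M[R]_(m, n)) :
  (forall i j, has_deriv0 (fun t => f t i j : R^o) (fun t => f' t i j)) -> has_deriv0 f f'.
Proof.
move=> H; apply/has_deriv0P => t t0 e e0.
have Hij (ij : 'I_m * 'I_n) : exists d : R, 0 < d /\ forall s : R, 0 <= s -> `|s - t| < d ->
    `|f s ij.1 ij.2 - f t ij.1 ij.2 - (s - t) *: (f' t ij.1 ij.2 : R^o)| <= e * `|s - t|.
  by have [d d0 Hd] := (iffLR (has_deriv0P _ _) (H ij.1 ij.2)) t t0 e e0; exists d.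
have [d Hd] := choice Hij.
exists (\big[Num.min/1]_ij d ij).
  by apply: lt_bigmin => // ij _; case: (Hd ij).
move=> s s0 sd; apply: mx_norm_le => [|i j]; first by rewrite mulr_ge0 // ltW.
rewrite !mxE; have [_ /(_ s s0)] := Hd (i, j); apply.
by apply: (lt_le_trans sd); apply: bigmin_le_cond.
Qed.

Lemma lin_map_sum n (W : normedModType R) (f : 'rV[R]_n -> W) : lin_map f ->
  forall x, f x = \sum_i x 0 i *: f (delta_mx 0 i).
Proof.
move=> fl x.
have f0 : f 0 = 0 by have := fl (-1) 0 0; rewrite scaler0 addr0 scaleN1r addNr.
rewrite {1}(row_sum_delta x); elim/big_rec2: _ => [//|i y z _ <-].
by rewrite fl.
Qed.

Lemma lin_map_bounded n (W : normedModType R) (f : 'rV[R]_n -> W) : lin_map f -> bounded_lin f.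
Proof.
move=> fl; apply: (@bounded_linP _ _ _ _ (\sum_i `|f (delta_mx 0 i)|)) => // x.
rewrite (lin_map_sum fl); apply: (le_trans (ler_norm_sum _ _ _)).
rewrite mulr_suml; apply: ler_sum => i _; rewrite normrZ mulrC ler_wpM2l //; exact: mx_entry_le.
Qed.

Lemma mx_ofE n p (f : 'rV[R]_n -> 'rV[R]_p) : lin_map f ->
  forall x, x *m (\matrix_i f (delta_mx 0 i)) = f x.
Proof.
move=> fl x; rewrite (lin_map_sum fl) mulmx_sum_row; apply: eq_bigr => i _.
by rewrite rowK.
Qed.
End MatrixNorm.

Section MatrixExponential.
Variables (R : realType) (n : nat).
Implicit Types A : 'M[R]_n.

(** The factor [B] makes the family closed under termwise differentiation, which turns [B] into
    [B *m A]. *)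
Definition expm_coef (B A : 'M[R]_n) (i j : 'I_n) (k : nat) : R := (B *m A ^+ k) i j / k`!%:R.

Definition expm A (t : R) : 'M[R]_n := \matrix_(i, j) limn (pseries (expm_coef 1%:M A i j) t).

Lemma mx_norm_exp A k : `|A ^+ k| <= (n%:R * `|A| + 1) ^+ k.
Proof.
elim: k => [|k IHk].
  rewrite !expr0; apply: mx_norm_le => // i j; rewrite mxE.
  by case: eqP => _; rewrite ?normr0 ?normr1.
rewrite !exprS; apply: le_trans (mx_norm_mul _ _) _.
by apply: ler_pM => //; rewrite lerDl.
Qed.

Lemma expm_coef_cvg B A i j (x : R) : cvgn (pseries (expm_coef B A i j) x).
Proof.
pose a := (n%:R * `|A| + 1) * `|x|; pose c := n%:R * `|B|.
have c0 : 0 <= c by rewrite mulr_ge0.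
have a0 : 0 <= a by rewrite mulr_ge0 // addr_ge0 // mulr_ge0.
apply: normed_cvg; apply: (@series_le_cvg _ _ (c *: exp_coeff a)).
- by move=> k; exact: normr_ge0.
- by move=> k; rewrite mulr_ge0 // exp_coeff_ge0.
- move=> k; rewrite /exp_coeff /= /expm_coef normrM normrM normfV normr_nat normrX.
  rewrite -[leRHS]/(c * (a ^+ k / k`!%:R)) /a exprMn mulrAC !mulrA ler_wpM2r ?invr_ge0 //.
  rewrite ler_wpM2r ?exprn_ge0 //; apply: le_trans (mx_entry_le _ _ _) _.
  by apply: le_trans (mx_norm_mul _ _) _; rewrite ler_wpM2l // mx_norm_exp.
- by apply: is_cvg_seriesZ; exact: is_cvg_series_exp_coeff.
Qed.

Lemma expm_coef_diffs B A i j : pseries_diffs (expm_coef B A i j) = expm_coef (B *m A) A i j.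
Proof.
apply/funext => k; rewrite /pseries_diffs /expm_coef exprS mulmxA.
by rewrite factS natrM invfM mulrCA mulVKf // pnatr_eq0.
Qed.

Lemma cvgn_sum (I : Type) (r : seq I) (u : I -> nat -> R) (v : I -> R) :
  (forall i, u i N @[N --> \oo] --> v i) ->
  \sum_(i <- r) u i N @[N --> \oo] --> \sum_(i <- r) v i.
Proof.
move=> H; elim: r => [|a r IH].
  by under eq_fun do rewrite big_nil; rewrite big_nil; exact: cvg_cst.
by under eq_fun do rewrite big_cons; rewrite big_cons; apply: cvgD => //; exact: H.
Qed.

Lemma expm_coef_lim B A (i j : 'I_n) (x : R) :
  limn (pseries (expm_coef B A i j) x) = (B *m expm A x) i j.
Proof.
rewrite mxE; apply/cvg_lim => //.
have -> : pseries (expm_coef B A i j) x =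
   (fun N => \sum_l B i l * pseries (expm_coef 1%:M A l j) x N).
  apply/funext => N; under [in RHS]eq_bigr do rewrite mulr_sumr.
  rewrite exchange_big /=; apply: eq_bigr => k _.
  rewrite -[LHS]/(expm_coef B A i j k * x ^+ k) /expm_coef mxE !mulr_suml.
  by apply: eq_bigr => l _; rewrite mul1mx !mulrA.
apply: cvgn_sum => l; apply: cvgZr; rewrite mxE; exact: expm_coef_cvg.
Qed.

Lemma expm_comm A (x : R) : A *m expm A x = expm A x *m A.
Proof.
apply/matrixP => i j; rewrite -expm_coef_lim [RHS]mxE; apply/cvg_lim => //.
have -> : pseries (expm_coef A A i j) x =
   (fun N => \sum_l A l j * pseries (expm_coef 1%:M A i l) x N).
  apply/funext => N; under [in RHS]eq_bigr do rewrite mulr_sumr.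
  rewrite exchange_big /=; apply: eq_bigr => k _.
  rewrite -[LHS]/(expm_coef A A i j k * x ^+ k) /expm_coef.
  have -> : A *m A ^+ k = A ^+ k *m A by rewrite -[LHS]exprS -[RHS]exprSr.
  rewrite mxE !mulr_suml.
  by apply: eq_bigr => l _; rewrite mul1mx !mulrA [A l j * _]mulrC.
under [X in _ --> X]eq_bigr do rewrite mulrC.
apply: cvgn_sum => l; apply: cvgZr; rewrite mxE; exact: expm_coef_cvg.
Qed.

Lemma expm_entry_derive A (i j : 'I_n) (x : R) :
  is_derive x (1 : R) (fun t : R => expm A t i j) ((A *m expm A x) i j).
Proof.
rewrite -expm_coef_lim -[X in expm_coef X]mul1mx -expm_coef_diffs.
have -> : (fun t => expm A t i j) = (fun t => limn (pseries (expm_coef 1%:M A i j) t)).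
  by apply/funext => t; rewrite expm_coef_lim mul1mx.
apply: (@pseries_snd_diffs _ _ (`|x| + 1)); rewrite ?expm_coef_diffs; try exact: expm_coef_cvg.
by rewrite [ltRHS]ger0_norm ?addr_ge0 // ltrDl.
Qed.

Lemma expm0 A : expm A 0 = 1%:M.
Proof.
apply/matrixP => i j; rewrite mxE; apply/cvg_lim => //.
rewrite -(cvg_shiftS (pseries _ _)).
have -> : (fun N => pseries (expm_coef 1%:M A i j) 0 N.+1) = (fun=> (1%:M : 'M[R]_n) i j).
  apply/funext => N; rewrite /pseries /series /= big_nat_recl // expr0 mulr1 big1 ?addr0.
    by rewrite /expm_coef expr0 mulmx1 fact0 divr1.
  by move=> k _; rewrite exprS mul0r mulr0.
exact: cvg_cst.
Qed.

Lemma is_derive_has_deriv0 (f f' : R -> R) (c d : R) :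
  (forall x : R, is_derive x (1 : R) f (f' x)) ->
  has_deriv0 ((fun t => f (c * t + d)) : R -> R^o) (fun t => c * f' (c * t + d)).
Proof.
move=> df t t0.
have : is_derive t (1 : R) (fun t => f (c * t + d)) (c * f' (c * t + d)).
  have D1 : is_derive t (1 : R) ((fun t => c * t + d) : R -> R) c.
    apply: is_derive_eq (is_deriveD (is_deriveZ c (is_derive_id t 1)) (is_derive_cst d t 1)) _.
    by rewrite [_ *: _]mulr1 addr0.
  by apply: is_derive_eq (@is_derive1_comp _ f (fun t => c * t + d) t _ _ (df (c * t + d)) D1) _; rewrite mulrC.
move=> [/cvg_ex [l Hl] D].
have El : l = c * f' (c * t + d) by rewrite -D; apply/esym/cvg_lim.
rewrite -El.
have : (fun h : R => h^-1 *: (f (c * (t + h) + d) - f (c * t + d) : R^o)) h @[h --> 0^'] --> l.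
  apply: cvg_trans Hl; apply: near_eq_cvg; near=> h => /=.
  by rewrite [h%:A]mulr1 [h + t]addrC.
apply: cvg_trans; apply: cvg_app.
move=> X HX; apply: (@filterS _ (nbhs (0 : R)) _ _ _ _ HX) => h H [h0 _]; exact: H.
Unshelve. all: by end_near. Qed.

(** [has_deriv0] sees times [t >= 0] only; the affine argument gives access to [expm A (- t)] and
    [expm A (tau - t)]. *)
Lemma expm_affine_deriv A (c d : R) :
  has_deriv0 (fun t => expm A (c * t + d)) (fun t => c *: (A *m expm A (c * t + d))).
Proof.
apply: has_deriv0_mx => i j.
have := @is_derive_has_deriv0 _ _ c d (@expm_entry_derive A i j).
by apply: has_deriv0_ext => // t t0; rewrite [RHS]mxE.
Qed.

Lemma expm_deriv A : has_deriv0 (expm A) (fun t => A *m expm A t).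
Proof.
have := @expm_affine_deriv A 1 0.
by apply: has_deriv0_ext => t t0; rewrite ?scale1r mul1r addr0.
Qed.

Lemma expm_cancel A (s t : R) : 0 <= s -> expm A (- s) *m expm A (s + t) = expm A t.
Proof.
move=> s0.
have D1 : has_deriv0 (fun s => expm A (- s)) (fun s => - (A *m expm A (- s))).
  have := @expm_affine_deriv A (-1) 0.
  by apply: has_deriv0_ext => r r0; rewrite ?scaleN1r mulN1r addr0.
have D2 : has_deriv0 (fun s => expm A (s + t)) (fun s => A *m expm A (s + t)).
  have := @expm_affine_deriv A 1 t.
  by apply: has_deriv0_ext => r r0; rewrite ?scale1r mul1r.
apply: (has_deriv0_eq (has_deriv0_mulmx D1 D2) (has_deriv0_cst (expm A t))) s0.
  by move=> r _; rewrite mulNmx mulmxA -expm_comm addNr.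
by rewrite oppr0 expm0 mul1mx add0r.
Qed.

Lemma expm_add A (s t : R) : 0 <= s -> expm A (s + t) = expm A s *m expm A t.
Proof.
move=> s0; rewrite -(expm_cancel A t s0) mulmxA.
have := expm_cancel A 0 s0; rewrite addr0 expm0 => /mulmx1C ->.
by rewrite mul1mx.
Qed.

Lemma expm_row_deriv A (x : 'rV[R]_n) : has_deriv0 (fun t => x *m expm A t) (fun t => x *m expm A t *m A).
Proof.
have := has_deriv0_lin (bounded_lin_mulmxl n x) (@expm_deriv A).
by apply: has_deriv0_ext => // t t0; rewrite expm_comm mulmxA.
Qed.

Lemma expm_semigroup A :
  semigroup_gen (fun x : 'rV[R]_n => x *m A) setT (fun t x => x *m expm A t).
Proof.
have rd (x : 'rV[R]_n) : h^-1 *: (x *m expm A h - x) @[h --> 0^'+] --> x *m A.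
  by have := has_deriv0_right (@expm_row_deriv A x); rewrite expm0 !mulmx1.
split.
- by move=> t t0; exact: bounded_lin_mulmxr.
- by move=> x; rewrite expm0 mulmx1.
- by move=> s t s0 t0 x; rewrite addrC expm_add // mulmxA.
- move=> x; apply/cvg_right0P => e e0.
  have /C0P /(_ 0 (lexx 0) e e0)[d d0 Hd] := has_deriv0_C0 (@expm_row_deriv A x).
  exists d => // h h0 hd; have := Hd h (ltW h0).
  by rewrite subr0 gtr0_norm // expm0 mulmx1; apply.
- by move=> x; split => // _; exists (x *m A).
- by move=> x _.
Qed.

Lemma expm_uniq A (x : R -> 'rV[R]_n) : has_deriv0 x (fun t => x t *m A) ->
  forall t : R, 0 <= t -> x t = x 0 *m expm A t.
Proof.
move=> dx t t0.
have K := @semigroup_uniq R 'rV[R]_n (mulmx^~ A) setT (fun t x => x *m expm A t) (expm_semigroup A).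
have K2 := K x (fun t => x t *m A) dx.
by apply: K2.
Qed.
End MatrixExponential.

(** * Intertwined flows, decaying orbits and stable matrices *)

Section DecayingMatrices.
Variable R : realType.

(** Each row of [expm A t *m H] solves [x' = x *m B] with the corresponding row of [H] as initial
    value. *)
Lemma expm_intertwine m n (A : 'M[R]_m) (B : 'M[R]_n) (H : 'M[R]_(m, n)) :
  A *m H = H *m B -> forall t : R, 0 <= t -> expm A t *m H = H *m expm B t.
Proof.
move=> AH t t0; apply/row_matrixP => i; rewrite !row_mul.
have := @expm_uniq _ _ B (fun t => row i (expm A t) *m H).
have -> : row i H = row i (expm A 0) *m H by rewrite expm0 -row_mul mul1mx.
move=> K; apply: K => //.
have := has_deriv0_lin (bounded_lin_mulmxr _ H) (has_deriv0_lin (@bounded_lin_row R _ _ i) (@expm_deriv _ _ A)).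
apply: has_deriv0_ext => // s s0.
by rewrite expm_comm -!row_mul -mulmxA AH mulmxA.
Qed.

Lemma expm_tr n (A : 'M[R]_n) (t : R) : 0 <= t -> expm A^T t = (expm A t)^T.
Proof.
move=> t0; apply/row_matrixP => i; rewrite !rowE.
have := @expm_uniq _ _ A^T (fun t => delta_mx 0 i *m (expm A t)^T).
rewrite expm0 trmx1 mulmx1 => K; rewrite -K //.
have := has_deriv0_lin (bounded_lin_mulmxl n (delta_mx 0 i : 'rV[R]_n))
  (has_deriv0_lin (@bounded_lin_trmx R n n) (@expm_deriv _ _ A)).
by apply: has_deriv0_ext => // s s0; rewrite trmx_mul mulmxA.
Qed.

Definition decays n (A : 'M[R]_n) (x : 'rV[R]_n) : Prop := x *m expm A t @[t --> +oo] --> (0 : 'rV[R]_n).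

Definition stable_mx n (A : 'M[R]_n) : Prop := exists M b : R, [/\ 0 <= M, 0 < b &
  forall (t : R) (x : 'rV[R]_n), 0 <= t -> `|x *m expm A t| <= M * expR (- (b * t)) * `|x|].

Lemma stable_decays n (A : 'M[R]_n) x : stable_mx A -> decays A x.
Proof.
move=> [M [b [M0 b0 H]]]; apply: (@exp_decay_cvg _ _ _ (M * `|x|) b b0) => t t0.
by rewrite mulrAC; apply: H.
Qed.

(* [|e^{tau A}| <= 1/2] for some [tau], and the semigroup law turns this into an exponential rate. *)
Lemma decays_stable n (A : 'M[R]_n) : (forall x, decays A x) -> stable_mx A.
Proof.
move=> H.
(* Basis orbits below [1 / (2 c)] give a contraction by [n / (2 c) <= 1/2]; the successor keeps [c]
   positive when [n = 0]. *)
pose c : R := n.+1%:R; have c0 : 0 < c by rewrite ltr0n.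
have [tau tau0 Htau] : exists2 tau : R, 0 < tau & forall x : 'rV[R]_n, `|x *m expm A tau| <= 2^-1 * `|x|.
  have e0 : 0 < 2^-1 / c :> R by rewrite divr_gt0 // invr_gt0.
  have : \forall t \near +oo, forall i : 'I_n, `|(delta_mx 0 i : 'rV[R]_n) *m expm A t| <= 2^-1 / c.
    apply: filter_forall => i; have /cvgr0Pnorm_le := H (delta_mx 0 i); exact.
  move=> HH; near (pinfty_nbhs R) => tau; exists tau.
    by near: tau; exact/nbhs_pinfty_gt/num_real.
  move=> x; have Hi i : `|(delta_mx 0 i : 'rV[R]_n) *m expm A tau| <= 2^-1 / c.
    by move: i; near: tau.
  rewrite (lin_map_sum (proj1 (bounded_lin_mulmxr 1 (expm A tau))) x).
  apply: (le_trans (ler_norm_sum _ _ _)).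
  apply: (@le_trans _ _ (\sum_(i < n) (`|x| * (2^-1 / c)))).
    by apply: ler_sum => i _; rewrite normrZ; apply: ler_pM => //; exact: mx_entry_le.
  rewrite sumr_const card_ord -[_ *+ n]mulr_natl.
  have -> : n%:R * (`|x| * (2^-1 / c)) = 2^-1 * `|x| * (n%:R / c) by ring.
  rewrite ler_piMr ?mulr_ge0 // ler_pdivrMr // mul1r ler_nat; exact: leqnSn.
have [M M1 HM] := semigroup_bound (expm_semigroup A) tau.
have M0 : 0 <= M by lra.
(* With this rate [e^{- b tau} = e^{- 1/2} >= 1/2] by [1 + x <= e^x]. The incomplete last period
   costs at most [e^{b tau} <= 2], the factor in [2 * M]. *)
pose b : R := (2 * tau)^-1.
have b0 : 0 < b by rewrite invr_gt0; lra.
have e1 : 2^-1 <= expR (- (b * tau)).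
  have -> : - (b * tau) = - 2^-1 by rewrite /b; field; lra.
  by apply: le_trans (expR_ge1Dx _); lra.
exists (2 * M), b; split => //; first lra.
move=> t x t0.
have key (k : nat) : forall (r : R) (x : 'rV[R]_n), 0 <= r -> r <= tau ->
    `|x *m expm A (k%:R * tau + r)| <= M * expR (- (b * (k%:R * tau))) * `|x|.
  elim: k => [|k IHk] r y r0 rt.
    by rewrite mul0r add0r mulr0 oppr0 expR0 mulr1; apply: HM.
  have -> : k.+1%:R * tau + r = tau + (k%:R * tau + r) by rewrite -natr1; ring.
  rewrite expm_add ?(ltW tau0) // mulmxA; apply: (le_trans (IHk _ _ r0 rt)).
  have -> : - (b * (k.+1%:R * tau)) = - (b * (k%:R * tau)) + - (b * tau) by rewrite -natr1; ring.
  rewrite expRD -!mulrA ler_wpM2l // ler_wpM2l ?expR_ge0 //.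
  by apply: (le_trans (Htau y)); rewrite ler_wpM2r.
pose k := Num.truncn (t / tau).
have kt : k%:R * tau <= t by rewrite -ler_pdivlMr // truncn_le // divr_ge0 // ltW.
have tk : t - k%:R * tau <= tau.
  have : t / tau < k.+1%:R by apply: truncnS_gt.
  by rewrite ltr_pdivrMr // -natr1; lra.
have {1}-> : t = k%:R * tau + (t - k%:R * tau) by rewrite addrC subrK.
have r0 : 0 <= t - k%:R * tau by lra.
apply: (le_trans (key k _ x r0 tk)); rewrite ler_wpM2r // [2 * M]mulrC -mulrA ler_wpM2l //.
have -> : - (b * (k%:R * tau)) = - (b * t) + b * (t - k%:R * tau) by ring.
rewrite expRD mulrC ler_wpM2r ?expR_ge0 //.
apply: (@le_trans _ _ (expR (b * tau))); first by rewrite ler_expR ler_wpM2l // ltW.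
by rewrite -[b * tau]opprK expRN -[leRHS]invrK lef_pV2 ?posrE ?invr_gt0 ?expR_gt0.
Unshelve. all: by end_near. Qed.

Lemma decaysD n (A : 'M[R]_n) a x y : decays A x -> decays A y -> decays A (a *: x + y).
Proof.
move=> dx dy; rewrite /decays; have -> : (0 : 'rV[R]_n) = a *: 0 + 0 by rewrite scaler0 addr0.
under eq_fun do rewrite mulmxDl -scalemxAl.
by apply: cvgD => //; apply: cvgZr.
Qed.

Lemma stable_tr n (A : 'M[R]_n) : stable_mx A -> stable_mx A^T.
Proof.
move=> [M [b [M0 b0 H]]].
have E (t : R) : 0 <= t -> `|expm A t| <= M * expR (- (b * t)).
  move=> t0; apply: mx_norm_le; first by rewrite mulr_ge0 ?expR_ge0.
  move=> i j; have := H t (delta_mx 0 i) t0; rewrite -rowE => K.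
  have -> : expm A t i j = row i (expm A t) 0 j by rewrite [RHS]mxE.
  apply: (le_trans (mx_entry_le _ _ _)); apply: (le_trans K).
  rewrite ler_piMr ?mulr_ge0 ?expR_ge0 //; apply: mx_norm_le => // k l; rewrite mxE.
  by case: (_ && _); rewrite ?normr1 ?normr0.
exists (n%:R * M), b; split => //; first by rewrite mulr_ge0.
move=> t x t0; rewrite expm_tr //; apply: (le_trans (mx_norm_mul _ _)).
have -> : n%:R * M * expR (- (b * t)) * `|x| = n%:R * `|x| * (M * expR (- (b * t))) by ring.
rewrite ler_wpM2l ?mulr_ge0 //; apply: le_trans (E t t0).
by apply: mx_norm_le => // i j; rewrite mxE mx_entry_le.
Qed.

End DecayingMatrices.

(** * Splitting off the unstable part of a matrix *)

Section LinearAlgebra.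
Variable R : realType.

(** A matrix of maximal rank among those with row space inside [P]: a further vector of [P] would
    raise the rank. This is how subspaces defined by analytic conditions (decaying vectors,
    steerable states, ranges, domains) become matrices. *)
Lemma subspace_mx n (P : 'rV[R]_n -> Prop) : P 0 ->
  (forall a x y, P x -> P y -> P (a *: x + y)) ->
  exists D : 'M[R]_n, forall x, P x <-> (x <= D)%MS.
Proof.
move=> P0 Pl.
pose Q (r : nat) := `[< exists D : 'M[R]_n, (forall x : 'rV[R]_n, (x <= D)%MS -> P x) /\ \rank D = r >].
have exQ : exists r, Q r.
  exists 0; apply/asboolP; exists 0; split; last exact: mxrank0.
  by move=> x; rewrite submx0 => /eqP ->.
have Qle r : Q r -> (r <= n)%N by move=> /asboolP[D [_ <-]]; exact: rank_leq_row.
have [r /asboolP[D [DP Dr]] rmax] := ex_maxnP exQ Qle.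
exists D => x; split; last exact: DP.
move=> Px; apply: contrapT => /negP xD.
have : Q (\rank (D + x)%MS).
  apply/asboolP; exists (D + x)%MS; split => // y /sub_addsmxP[[u v] /= ->].
  have -> : v *m x = v 0 0 *: x by rewrite [v]mx11_scalar mul_scalar_mx mxE.
  by rewrite addrC; apply: Pl => //; apply: DP; exact: submxMl.
move=> /rmax; rewrite -Dr leqNgt => /negP; apply; rewrite rank_ltmx // ltmxE addsmxSl.
by apply: contra xD => H; apply: submx_trans H; exact: addsmxSr.
Qed.

(** A row space is the kernel of the continuous map [x |-> x *m cokermx D], hence closed. *)
Lemma dense_full n (D : 'M[R]_n) :
  (forall (x : 'rV[R]_n) (e : R), 0 < e -> exists2 y, (y <= D)%MS & `|x - y| <= e) ->
  forall x : 'rV[R]_n, (x <= D)%MS.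
Proof.
move=> H x; rewrite submxE -normr_le0; apply/ler_addgt0Pr => e e0; rewrite add0r.
pose c := n%:R * `|cokermx D| + 1.
have c0 : 0 < c by rewrite ltr_wpDl // mulr_ge0.
have [y yD xy] := H x _ (divr_gt0 e0 c0).
rewrite submxE in yD.
have -> : x *m cokermx D = (x - y) *m cokermx D by rewrite mulmxBl (eqP yD) subr0.
apply: (le_trans (mx_norm_mul _ _)); rewrite ler_pdivlMr // in xy; apply: le_trans xy.
rewrite mulrAC mulrC ler_wpM2l // /c; lra.
Qed.

Lemma lin_map_inj_surj n (f : 'rV[R]_n -> 'rV[R]_n) : lin_map f ->
  (forall x, f x = 0 -> x = 0) -> forall y, exists x, f x = y.
Proof.
move=> fl f0; pose G : 'M[R]_n := \matrix_i f (delta_mx 0 i).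
have GE x : x *m G = f x := mx_ofE fl x.
have uG : G \in unitmx.
  rewrite -row_free_unit -kermx_eq0; apply/eqP/row_matrixP => i; rewrite row0.
  by apply: f0; rewrite -GE; apply/sub_kermxP; exact: row_sub.
by move=> y; exists (y *m invmx G); rewrite -GE mulmxKV.
Qed.

Lemma lin_map_mx_inj_surj m n (f : 'M[R]_(m, n) -> 'M[R]_(m, n)) :
  (forall a x y, f (a *: x + y) = a *: f x + f y) ->
  (forall x, f x = 0 -> x = 0) -> forall y, exists x, f x = y.
Proof.
move=> fl f0 y.
have [||x Hx] := @lin_map_inj_surj _ (fun v => mxvec (f (vec_mx v))) _ _ (mxvec y).
- by move=> a x z; rewrite linearP fl linearP.
- move=> x /eqP; rewrite mxvec_eq0 => /eqP /f0 /eqP; rewrite vec_mx_eq0 => /eqP; exact.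
- by exists (vec_mx x); apply: (can_inj mxvecK).
Qed.

Definition nodecay n (A : 'M[R]_n) : Prop := forall x, decays A x -> x = 0.

(** * Intertwining a non-decaying matrix with a stable one *)

Section Sylvester.
Variables (n r : nat) (A0 : 'M[R]_n) (A1 : 'M[R]_r).
Hypotheses (nd : nodecay A0) (st : stable_mx A1).

(** The flow of [A0] on the [i]-th row of [N] is [e_i e^{t A1} N], which decays, so the row is 0. *)
Lemma sylvester_left0 (N : 'M[R]_(r, n)) : N *m A0 = A1 *m N -> N = 0.
Proof.
move=> E; apply/row_matrixP => i; rewrite row0; apply: nd.
have := bounded_lin_cvg_pinfty (bounded_lin_mulmxr 1 N) (@stable_decays _ _ _ (delta_mx 0 i) st).
rewrite mul0mx; apply: cvg_trans; apply: near_eq_cvg; near=> t.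
have t0 : 0 <= t by near: t; exact/nbhs_pinfty_ge/num_real.
by rewrite -mulmxA (expm_intertwine (esym E)) // mulmxA -rowE.
Unshelve. all: by end_near. Qed.

(* The trace pairing makes [H |-> A0 H - H A1] adjoint to the injective map [N |-> N A0 - A1 N]. *)
Lemma sylvester_right0 (H : 'M[R]_(n, r)) : A0 *m H = H *m A1 -> H = 0.
Proof.
move=> E.
have surj := @lin_map_mx_inj_surj _ _ (fun N : 'M[R]_(r, n) => N *m A0 - A1 *m N).
have {}surj : forall N' : 'M[R]_(r, n), exists N, N *m A0 - A1 *m N = N'.
  apply: surj.
    move=> a x y; rewrite mulmxDl mulmxDr -scalemxAl -scalemxAr.
    by rewrite opprD addrACA -scalerBr.
  by move=> N /eqP; rewrite subr_eq0 => /eqP; exact: sylvester_left0.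
have tr0 (N' : 'M[R]_(r, n)) : \tr (N' *m H) = 0.
  have [N <-] := surj N'; rewrite mulmxBl linearB /= -mulmxA E mulmxA.
  by rewrite [X in X - _]mxtrace_mulC mulmxA subrr.
apply/matrixP => i j; rewrite mxE -(tr0 (delta_mx j i)) /mxtrace (bigD1 j) //=.
rewrite big1 ?addr0 => [|k kj].
  rewrite mxE (bigD1 i) //= big1 ?addr0; first by rewrite mxE !eqxx mul1r.
  by move=> k ki; rewrite mxE (negbTE ki) andbF mul0r.
by rewrite mxE big1 // => l _; rewrite mxE (negbTE kj) mul0r.
Qed.

Lemma sylvester_solve (C : 'M[R]_(n, r)) : exists H, A0 *m H - H *m A1 = C.
Proof.
apply: (@lin_map_mx_inj_surj _ _ (fun H => A0 *m H - H *m A1)).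
  move=> a x y; rewrite mulmxDl mulmxDr -scalemxAl -scalemxAr.
  by rewrite opprD addrACA -scalerBr.
by move=> N /eqP; rewrite subr_eq0 => /eqP; exact: sylvester_right0.
Qed.
End Sylvester.

(** The decaying vectors form an invariant subspace. In the coordinates of a basis [D] of it the
    restriction [A1] has only decaying orbits, so [decays_stable] applies. *)
Lemma decay_basis n (A : 'M[R]_n) : exists r (D : 'M[R]_(r, n)) (A1 : 'M[R]_r),
  [/\ row_free D, D *m A = A1 *m D, stable_mx A1 & forall x, decays A x <-> (x <= D)%MS].
Proof.
have [D0 HD0] : exists D0 : 'M[R]_n, forall x, decays A x <-> (x <= D0)%MS.
  apply: subspace_mx; last by move=> a x y; exact: decaysD.
  by rewrite /decays; under eq_fun do rewrite mul0mx; exact: cvg_cst.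
pose D := row_base D0.
have HD x : decays A x <-> (x <= D)%MS by rewrite HD0 eq_row_base.
have fD : row_free D := row_base_free D0.
have DA : (D *m A <= D)%MS.
  apply/row_subP => i; rewrite row_mul; apply/HD.
  have /HD di : (row i D <= D)%MS := row_sub i D.
  have := bounded_lin_cvg_pinfty (bounded_lin_mulmxr 1 A) di.
  rewrite mul0mx; apply: cvg_trans; apply: near_eq_cvg; near=> t.
  by rewrite -!mulmxA expm_comm.
pose A1 := D *m A *m pinvmx D.
have EA : D *m A = A1 *m D by rewrite /A1 mulmxKpV.
exists _, D, A1; split => //.
apply: decays_stable => a.
have /HD da : (a *m D <= D)%MS := submxMl a D.
have := bounded_lin_cvg_pinfty (bounded_lin_mulmxr 1 (pinvmx D)) da.
rewrite mul0mx; apply: cvg_trans; apply: near_eq_cvg; near=> t.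
have t0 : 0 <= t by near: t; exact/nbhs_pinfty_ge/num_real.
by rewrite -[a *m D *m _]mulmxA -(expm_intertwine (esym EA)) // mulmxA -mulmxA mulmxVp // mulmx1.
Unshelve. all: by end_near. Qed.

(** A basis [D] of the decaying vectors of [A^T] satisfies [A D^T = D^T A1^T] with [A1^T] stable,
    and [sylvester_right0] forces it to vanish. *)
Lemma nodecay_tr n (A : 'M[R]_n) : nodecay A -> nodecay A^T.
Proof.
move=> nd; have [r [D [A1 [fD EA st HD]]]] := decay_basis A^T.
have D0 : D^T = 0.
  apply: (sylvester_right0 nd (stable_tr st)).
  by rewrite -trmx_mul -EA trmx_mul trmxK.
have {}D0 : D = 0 by rewrite -[D]trmxK D0 trmx0.
by move=> x /HD; rewrite D0; exact: submx0null.
Qed.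

Lemma decays_exp n (A : 'M[R]_n) x : decays A x -> exists M b : R, [/\ 0 <= M, 0 < b &
  forall t : R, 0 <= t -> `|x *m expm A t| <= M * expR (- (b * t))].
Proof.
have [r [D [A1 [fD EA [M [b [M0 b0 H]]] HD]]]] := decay_basis A.
move=> /HD /submxP[a ->].
exists (M * `|a| * (r%:R * `|D|)), b; split => //; first by rewrite !mulr_ge0.
move=> t t0; rewrite -mulmxA -(expm_intertwine (esym EA)) // mulmxA.
apply: (le_trans (mx_norm_mul _ _)).
have -> : M * `|a| * (r%:R * `|D|) * expR (- (b * t)) = r%:R * (M * expR (- (b * t)) * `|a|) * `|D| by ring.
by rewrite ler_wpM2r // ler_wpM2l // H.
Qed.

(** [A] is block triangular with respect to the decaying subspace and any complement. The quotient
    block [A0] has no decaying orbit, and a Sylvester equation tilts the complement into an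
    invariant one. *)
Lemma split_unstable n (A : 'M[R]_n) : exists n0 (iota : 'M[R]_(n0, n)) (pi : 'M[R]_(n, n0)) (A0 : 'M[R]_n0),
  [/\ iota *m pi = 1%:M, iota *m A = A0 *m iota, A *m pi = pi *m A0, nodecay A0 &
      forall x : 'rV[R]_n, x *m pi = 0 -> decays A x].
Proof.
have [r [D1 [A1 [fD1 EA st HD]]]] := decay_basis A.
have [n2 [D2 [fD2 full cap0]]] : exists n2 (D2 : 'M[R]_(n2, n)), [/\ row_free D2, (1%:M <= D1 + D2)%MS &
    forall m (z : 'M[R]_(m, n)), (z <= D1)%MS -> (z <= D2)%MS -> z = 0].
  exists _, (row_base (<<D1>>^C)%MS); split; first exact: row_base_free.
    have H : (1%:M <= <<D1>> + <<D1>>^C)%MS by rewrite sub1mx addsmx_compl_full.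
    by apply: submx_trans H _; apply: addsmxS; rewrite ?genmxE // eq_row_base.
  move=> m z z1 z2; apply/eqP; rewrite -submx0.
  have <- : (<<D1>> :&: <<D1>>^C)%MS = 0 by apply: capmx_compl.
  by rewrite sub_capmx genmxE z1; move: z2; rewrite eq_row_base.
(* [Q1] and [Q2] give the coordinates along [D1] and [D2]: [1 = Q1 D1 + Q2 D2]. *)
have [[Q1 Q2] /= E1] := sub_addsmxP full.
have free_inj (m p : nat) (D : 'M[R]_(p, n)) (x : 'M[R]_(m, p)) : row_free D -> x *m D = 0 -> x = 0.
  by move=> fD xD; apply: (row_free_inj fD); rewrite mul0mx.
have dec (m : nat) (z : 'M[R]_(m, n)) : z = z *m Q1 *m D1 + z *m Q2 *m D2.
  by rewrite -!mulmxA -mulmxDr -E1 mulmx1.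
have Z1 : D1 *m Q2 *m D2 = 0.
  apply: (cap0 _ _ _ (submxMl _ _)).
  have -> : D1 *m Q2 *m D2 = (1%:M - D1 *m Q1) *m D1.
    by apply/esym/eqP; rewrite mulmxBl mul1mx subr_eq addrC -dec.
  exact: submxMl.
have Z2 : D2 *m Q1 *m D1 = 0.
  apply: (cap0 _ _ (submxMl _ _)).
  have -> : D2 *m Q1 *m D1 = (1%:M - D2 *m Q2) *m D2.
    by apply/esym/eqP; rewrite mulmxBl mul1mx subr_eq -dec.
  exact: submxMl.
have D1Q2 : D1 *m Q2 = 0 := free_inj _ _ _ _ fD2 Z1.
have D2Q1 : D2 *m Q1 = 0 := free_inj _ _ _ _ fD1 Z2.
have D2Q2 : D2 *m Q2 = 1%:M.
  apply/eqP; rewrite -subr_eq0; apply/eqP; apply: (free_inj _ _ _ _ fD2).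
  by rewrite mulmxBl mul1mx [X in _ - X]dec D2Q1 mul0mx add0r subrr.
(* The blocks in [D2 A = A01 D1 + A0 D2]; the other block row is [D1 A = A1 D1]. *)
pose A0 := D2 *m A *m Q2; pose A01 := D2 *m A *m Q1.
have AQ2 : A *m Q2 = Q2 *m A0.
  by rewrite -[A]mul1mx E1 mulmxDl -[Q1 *m D1 *m A]mulmxA EA !mulmxDl /A0 -!mulmxA D1Q2 !mulmx0 add0r.
have AQ1 : A *m Q1 = Q1 *m A1 + Q2 *m A01.
  have D1Q1 : D1 *m Q1 = 1%:M.
    apply/eqP; rewrite -subr_eq0; apply/eqP; apply: (free_inj _ _ _ _ fD1).
    by rewrite mulmxBl mul1mx [X in _ - X]dec D1Q2 mul0mx addr0 subrr.
  by rewrite -[A]mul1mx E1 mulmxDl -[Q1 *m D1 *m A]mulmxA EA !mulmxDl /A01 -!mulmxA D1Q1 !mulmx1.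
(* If [b] decays under [A0], then along the orbit of [b D2] the [D1] coordinate [z] obeys the stable
   equation of [A1] with exponentially decaying forcing. So [b D2] decays, hence lies in both
   subspaces and is 0. *)
have nd : nodecay A0.
  move=> b db.
  suff : decays A (b *m D2).
    move=> /HD bD; apply: (free_inj _ _ _ _ fD2); apply: cap0 => //; exact: submxMl.
  have [M [c [M0 c0 Hb]]] := decays_exp db.
  have [M1 [c1 [M10 c10 HA1]]] := st.
  pose x t := b *m D2 *m expm A t.
  have dx : has_deriv0 x (fun t => x t *m A) by exact: expm_row_deriv.
  have xQ2 (t : R) : 0 <= t -> x t *m Q2 = b *m expm A0 t.
    move=> t0; have E := expm_intertwine AQ2 t0.
    by rewrite /x -mulmxA E [LHS]mulmxA -[b *m D2 *m Q2]mulmxA D2Q2 mulmx1.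
  pose z t := x t *m Q1.
  have dz : has_deriv0 z (fun t => z t *m A1 + b *m expm A0 t *m A01).
    have := has_deriv0_lin (bounded_lin_mulmxr 1 Q1) dx.
    apply: has_deriv0_ext => // t t0.
    by rewrite -mulmxA AQ1 mulmxDr !mulmxA xQ2.
  pose b1 := Num.min c c1 / 2.
  have mn0 : 0 < Num.min c c1 by rewrite lt_min c0.
  have b10 : 0 < b1 by rewrite /b1; lra.
  have b1c : b1 <= c by have : Num.min c c1 <= c; [rewrite ge_min lexx|rewrite /b1; lra].
  have b1c1 : b1 < c1 by have : Num.min c c1 <= c1; [rewrite ge_min lexx orbT|rewrite /b1; lra].
  have fb (s : R) : 0 <= s -> `|b *m expm A0 s *m A01| <= (n2%:R * M * `|A01|) * expR (- (b1 * s)).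
    move=> s0; apply: (le_trans (mx_norm_mul _ _)).
    rewrite [leRHS]mulrAC ler_wpM2r // -mulrA ler_wpM2l //.
    apply: (le_trans (Hb s s0)); rewrite ler_wpM2l // ler_expR lerN2 ler_wpM2r //.
  have Hz (t : R) : 0 <= t -> `|z t| <= (M1 * `|z 0| + (n2%:R * M * `|A01|) * (M1 / (c1 - b1))) * expR (- (b1 * t)).
    move=> t0.
    have := @forced_estimate R 'rV[R]_r (mulmx^~ A1) setT (fun t x => x *m expm A1 t)
      (expm_semigroup A1) M1 c1 b1 _ z _ _ t HA1 M10 b1c1 t0 dz (fun _ _ => I) (fun _ _ => erefl)
      (fun s s0 _ => fb s s0).
    move=> H; apply: (le_trans H); rewrite mulrDl lerD2r mulrAC ler_wpM2l ?mulr_ge0 //.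
    by rewrite ler_expR lerN2 ler_wpM2r // ltW.
  have zd : z t @[t --> +oo] --> (0 : 'rV[R]_r) by exact: (exp_decay_cvg b10 Hz).
  have : z t *m D1 + b *m expm A0 t *m D2 @[t --> +oo] --> 0 *m D1 + 0 *m D2.
    apply: cvgD; first exact: (bounded_lin_cvg_pinfty (bounded_lin_mulmxr 1 D1) zd).
    exact: (bounded_lin_cvg_pinfty (bounded_lin_mulmxr 1 D2) db).
  rewrite !mul0mx addr0; apply: cvg_trans; apply: near_eq_cvg; near=> t.
  have t0 : 0 <= t by near: t; exact/nbhs_pinfty_ge/num_real.
  by rewrite -xQ2 // /z -dec.
(* [D2 + H D1] is invariant exactly when [A0 H - H A1 = A01]. *)
have [H HH] := sylvester_solve nd st A01.
exists _, (D2 + H *m D1), Q2, A0; split => //.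
- by rewrite mulmxDl -mulmxA D1Q2 mulmx0 addr0.
- have D2A : D2 *m A = A01 *m D1 + A0 *m D2 by rewrite -[D2 *m A]mulmx1 E1 mulmxDr !mulmxA.
  rewrite mulmxDl mulmxDr D2A -mulmxA EA !mulmxA addrAC -mulmxDl addrC; congr (_ + _ *m _).
  by rewrite -HH subrK.
- move=> x xQ2; apply/HD; rewrite -[x]mulmx1 E1 mulmxDr [x *m (Q2 *m _)]mulmxA xQ2 mul0mx addr0 mulmxA.
  exact: submxMl.
Unshelve. all: by end_near. Qed.
End LinearAlgebra.

(** * Bounded functionals *)

Section HahnBanach.
Variables (R : realType) (V : normedModType R).

Let lin_graph (G : set (V * R)) := forall (a : R) p q, G p -> G q -> G (a *: p.1 + q.1, a * p.2 + q.2).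
Let dominated (G : set (V * R)) := forall p, G p -> p.2 <= `|p.1|.

(** Hahn-Banach: Zorn's lemma is applied to graphs of partial linear functionals dominated by the
    norm, with value [|v|] at [v]. *)
Lemma functional_exists (v : V) : v != 0 -> exists f : V -> R^o, bounded_lin f /\ f v != 0.
Proof.
move=> v0.
pose P (G : set (V * R)) := [/\ G = set0 \/ G (v, `|v|), lin_graph G & dominated G].
have [|G [[G0 Gl Gd] Gmax]] := @Zorn_bigcup _ P.
  move=> F FP Ftot; split.
  - have [[X FX /eqP]|H] := pselect (exists2 X, F X & X <> set0); last first.
      left; apply/seteqP; split=> // x [X FX Xx]; exfalso; apply: H; exists X => //.
      by move=> X0; rewrite X0 in Xx.
    move=> /eqP X0; right; exists X => //; have [[E|//] _ _] := FP X FX.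
    by exfalso; exact: X0.
  - move=> a p q [X FX Xp] [Z FZ Zq].
    have [XZ|ZX] := Ftot X Z FX FZ.
      by exists Z => //; have [_ l _] := FP Z FZ; apply: l => //; exact: XZ.
    by exists X => //; have [_ l _] := FP X FX; apply: l => //; exact: ZX.
  - by move=> p [X FX Xp]; have [_ _ d] := FP X FX; apply: d.
have Gv : G (v, `|v|).
  case: G0 => // E; exfalso.
  apply: (Gmax [set p | exists a : R, p = (a *: v, a * `|v|)]).
    split; first by rewrite E.
    by rewrite E => H; apply: (H (1 *: v, 1 * `|v|)); exists 1.
  split; first by right; exists 1; rewrite scale1r mul1r.
    move=> a _ _ [b ->] [c ->] /=; exists (a * b + c).
    by rewrite scalerA -scalerDl mulrA -mulrDl.
  by move=> _ [a ->] /=; rewrite normrZ ler_wpM2r // ler_norm.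
have G00 : G (0, 0).
  by have := Gl (-1) _ _ Gv Gv; rewrite /= scaleN1r mulN1r !addNr.
have GZ a p : G p -> G (a *: p.1, a * p.2) by move=> Gp; have := Gl a _ _ Gp G00; rewrite /= !addr0.
have total x : exists r, G (x, r).
  apply: contrapT => /forallNP nx.
  (* A value [c] at [x] is admissible if it lies between all [p.2 - |p.1 - x|] and all
     [|p.1 + x| - p.2]; the triangle inequality separates the two families. *)
  pose E := [set p.2 - `|p.1 - x| | p in G].
  have Eub p : G p -> ubound E (`|p.1 + x| - p.2).
    move=> Gp _ [q Gq <-].
    have := Gd _ (Gl 1 _ _ Gp Gq); rewrite /= scale1r mul1r => H.
    have : `|p.1 + q.1| <= `|p.1 + x| + `|q.1 - x|.
      have -> : p.1 + q.1 = (p.1 + x) + (q.1 - x) by rewrite addrACA subrr addr0.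
      exact: ler_normD.
    by lra.
  have Ene : E !=set0 by exists (0 - `|0 - x|); exists (0, 0).
  have Ehub : has_ubound E by exists (`|0 + x| - 0); exact: (Eub (0, 0)).
  pose c := sup E.
  have c1 p : G p -> p.2 - `|p.1 - x| <= c by move=> Gp; apply: ub_le_sup => //; exists p.
  have c2 p : G p -> c <= `|p.1 + x| - p.2 by move=> Gp; apply: ge_sup => //; apply: Eub.
  pose G' : set (V * R) := [set p | exists a q, G q /\ p = (q.1 + a *: x, q.2 + a * c)].
  apply: (Gmax G').
    split.
      by move=> p Gp; exists 0, p; split => //; rewrite scale0r mul0r !addr0; case: p Gp.
    move=> H; apply: (nx c); apply: H; exists 1, (0, 0); split => //=.
    by rewrite scale1r mul1r !add0r.
  split.
  - by right; exists 0, (v, `|v|); split => //=; rewrite scale0r mul0r !addr0.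
  - move=> b _ _ [a1 [q1 [Gq1 ->]]] [a2 [q2 [Gq2 ->]]] /=.
    exists (b * a1 + a2), (b *: q1.1 + q2.1, b * q1.2 + q2.2); split; first exact: Gl.
    by congr pair => /=; [linear_comb R|ring].
  - move=> _ [a [q [Gq ->]]] /=.
    have [a0|a0|->] := ltgtP a 0; last by rewrite scale0r mul0r !addr0; exact: Gd.
      have na0 : 0 < - a by lra.
      have := c1 _ (GZ (- a)^-1 _ Gq) => /=; rewrite -(ler_pM2l na0) mulrBr !mulrA divff ?gt_eqF //.
      rewrite -[X in _ - X * _](gtr0_norm na0) mul1r -normrZ scalerBr scalerA divff ?gt_eqF // scale1r.
      by rewrite scaleNr opprK; lra.
    have := c2 _ (GZ a^-1 _ Gq) => /=; rewrite -(ler_pM2l a0) mulrBr !mulrA divff ?gt_eqF //.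
    rewrite -[X in X * `|_| - _](gtr0_norm a0) mul1r -normrZ scalerDr scalerA divff ?gt_eqF // scale1r.
    by lra.
have [f Hf] := choice total.
have func x r s : G (x, r) -> G (x, s) -> r = s.
  move=> Gr Gs; have H1 := Gd _ (Gl (-1) _ _ Gr Gs); have H2 := Gd _ (Gl (-1) _ _ Gs Gr).
  move: H1 H2; rewrite /= !scaleN1r !mulN1r !addNr normr0; lra.
exists f; split; last by rewrite (func _ _ _ (Hf v) Gv) normr_eq0.
apply: (@bounded_linP _ _ _ _ 1).
  by move=> a x y; apply: func (Hf _) (Gl a _ _ (Hf x) (Hf y)).
move=> x; rewrite mul1r; have H1 := Gd _ (Hf x); have H2 := Gd _ (GZ (-1) _ (Hf x)).
by apply/ler_normlP; split => //; move: H2; rewrite /= scaleN1r mulN1r normrN.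
Qed.
End HahnBanach.

Section FiniteRank.
Variable R : realType.

(** [U] may be infinite-dimensional, but finitely many inputs span the range of [B]. The rows of
    [Bm] span it, [b] lifts coordinates to inputs and [S] computes coordinates, so that feedback
    design becomes a matrix problem. *)
Lemma finite_range (U : normedModType R) n (B : U -> 'rV[R]_n) : bounded_lin B ->
  exists (Bm S : 'M[R]_n) (b : 'rV[R]_n -> U), [/\ bounded_lin b,
    forall v, B (b v) = v *m Bm & forall u, B u *m S *m Bm = B u].
Proof.
move=> bB.
have [D HD] : exists D : 'M[R]_n, forall x, (exists u, B u = x) <-> (x <= D)%MS.
  apply: subspace_mx; first by exists 0; exact: bounded_lin0.
  by move=> a _ _ [u <-] [v <-]; exists (a *: u + v); case: bB => ->.
have Hi i : exists u, B u = row i D by apply/HD; exact: row_sub.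
have [g Hg] := choice Hi.
exists D, (pinvmx D), (fun v => \sum_i v 0 i *: g i); split.
- apply: lin_map_bounded => a x y.
  rewrite scaler_sumr -big_split; apply: eq_bigr => i _ /=.
  by rewrite !mxE scalerDl scalerA.
- move=> v; rewrite mulmx_sum_row.
  elim/big_rec2: _ => [|i y x _ <-]; first exact: bounded_lin0.
  by rewrite (bounded_linD _ _ bB) (bounded_linZ _ _ bB) Hg.
- by move=> u; rewrite mulmxKpV //; apply/HD; exists u.
Qed.

(** The covectors of the form [f \o c] with [f] bounded form a finite-dimensional space; [L]
    collects the [f] of a spanning family. If [L (c x) = 0] they all vanish at [x], while
    Hahn-Banach would give one that does not if [c x != 0]. *)
Lemma separating_functionals (Y : normedModType R) n (c : 'rV[R]_n -> Y) : bounded_lin c ->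
  exists2 L : Y -> 'rV[R]_n, bounded_lin L & forall x, L (c x) = 0 -> c x = 0.
Proof.
move=> bc.
pose P (xi : 'rV[R]_n) := exists f : Y -> R^o, bounded_lin f /\ forall x, f (c x) = (x *m xi^T) 0 0.
have [D HD] : exists D : 'M[R]_n, forall x, P x <-> (x <= D)%MS.
  apply: subspace_mx.
    exists (fun=> 0); split; first exact: bounded_lin_zero.
    by move=> x; rewrite trmx0 mulmx0 mxE.
  move=> a x y [f [bf Hf]] [g [bg Hg]]; exists (fun z => a *: f z + g z); split.
    by apply: bounded_lin_add => //; apply: bounded_lin_scale.
  by move=> z; rewrite Hf Hg linearP /= mulmxDr -scalemxAr [RHS]mxE [X in _ = X + _]mxE.
have Hi i : P (row i D) by apply/HD; exact: row_sub.
have [f Hf] := choice Hi.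
exists (fun y => \row_i f i y).
  have Hb i : exists M, forall y, `|f i y| <= M * `|y|.
    by have [bf _] := Hf i; have [M _ HM] := bounded_lin_bound bf; exists M.
  have [M HM] := choice Hb.
  apply: (@bounded_linP _ _ _ _ (\sum_i `|M i|)).
    move=> a x y; apply/rowP => i; rewrite !mxE.
    by have [bf _] := Hf i; rewrite (bounded_linD _ _ bf) (bounded_linZ _ _ bf).
  move=> y; apply: mx_norm_le; first by rewrite mulr_ge0 // sumr_ge0.
  move=> i j; rewrite mxE; apply: (le_trans (HM _ _)); rewrite ler_wpM2r //.
  apply: (le_trans (ler_norm _)); rewrite (bigD1 j) //= lerDl; exact: sumr_ge0.
move=> x Lx; apply: contrapT => /eqP cx.
have [g [bg]] := functional_exists cx; apply/negP; rewrite negbK.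
have xD : x *m D^T = 0.
  apply/rowP => i; rewrite mxE [RHS]mxE.
  have [_ /(_ x)] := Hf i; have := congr1 (fun z : 'rV[R]_n => z 0 i) Lx; rewrite !mxE => -> H.
  by rewrite [RHS]H; apply: eq_bigr => k _; rewrite !mxE.
pose xi : 'rV[R]_n := \row_i g (c (delta_mx 0 i)).
have gx z : g (c z) = (z *m xi^T) 0 0.
  have := lin_map_sum (proj1 (bounded_lin_comp bc bg)) z => /= ->.
  by rewrite mxE; apply: eq_bigr => i _; rewrite !mxE.
have /HD/submxP[a Ea] : P xi by exists g.
by rewrite gx Ea trmx_mul mulmxA xD mul0mx mxE.
Qed.
End FiniteRank.

(** * Feedback and observer gains for matrices *)

Section Design.
Variable R : realType.

Lemma quad_form_le n (P : 'M[R]_n) (y : 'rV[R]_n) :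
  `|(y *m P *m y^T) 0 0| <= n%:R ^+ 2 * `|P| * `|y| ^+ 2.
Proof.
apply: (le_trans (mx_entry_le _ _ _)); apply: (le_trans (mx_norm_mul _ _)).
have yT : `|y^T| <= `|y| by apply: mx_norm_le => // i j; rewrite mxE mx_entry_le.
apply: (@le_trans _ _ (n%:R * (n%:R * `|y| * `|P|) * `|y|)).
  by apply: ler_pM; rewrite ?mulr_ge0 // ler_wpM2l // mx_norm_mul.
by apply: eq_le || (rewrite le_eqVlt; apply/orP; left; apply/eqP; ring).
Qed.

Lemma sq_norm_ge n (y : 'rV[R]_n) : `|y| ^+ 2 <= (y *m y^T) 0 0.
Proof.
have S0 : 0 <= (y *m y^T) 0 0.
  by rewrite mxE; apply: sumr_ge0 => i _; rewrite mxE -expr2 sqr_ge0.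
have -> : (y *m y^T) 0 0 = Num.sqrt ((y *m y^T) 0 0) ^+ 2 by rewrite sqr_sqrtr.
rewrite ler_sqr ?nnegrE ?sqrtr_ge0 //; apply: mx_norm_le; first exact: sqrtr_ge0.
move=> i j; rewrite -sqrtr_sqr ler_sqrt //; rewrite ord1 mxE (bigD1 j) //= mxE -expr2 lerDl.
by apply: sumr_ge0 => k _; rewrite mxE -expr2 sqr_ge0.
Qed.

(** In the maximum norm the form is at most [n^3 |X0|^2 |y|^2]. With [d] the assumed bound,
    [(n + 1)^2 d = 1/2] and [(n + 1) d <= 1/2], so the coefficient is below [1/2]. *)
Lemma gram_quad_le n (X0 : 'M[R]_n) (y : 'rV[R]_n) : `|X0| <= (2 * n.+1%:R ^+ 2)^-1 ->
  (y *m (X0^T *m X0) *m y^T) 0 0 <= 2^-1 * (y *m y^T) 0 0.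
Proof.
move=> HX.
apply: (le_trans (ler_norm _)); apply: (le_trans (quad_form_le _ _)).
apply: (@le_trans _ _ (2^-1 * `|y| ^+ 2)); last by rewrite ler_wpM2l ?invr_ge0 // sq_norm_ge.
rewrite ler_wpM2r ?sqr_ge0 //.
have XX : `|X0^T *m X0| <= n%:R * `|X0| * `|X0|.
  apply: (le_trans (mx_norm_mul _ _)); rewrite ler_wpM2r // ler_wpM2l //.
  by apply: mx_norm_le => // i j; rewrite mxE mx_entry_le.
set d := (2 * _)^-1 in HX.
have N1 : 1 <= n.+1%:R :> R by rewrite ler1n.
have d0 : 0 < d by rewrite invr_gt0 mulr_gt0 // exprn_gt0 //; lra.
have dE : d * (2 * n.+1%:R ^+ 2) = 1 by rewrite /d mulVf // gt_eqF // mulr_gt0 // exprn_gt0 //; lra.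
have nN : n%:R <= n.+1%:R :> R by rewrite ler_nat leqnSn.
have n0 : 0 <= n%:R :> R by [].
have X0p := normr_ge0 (X0).
apply: (@le_trans _ _ (n.+1%:R ^+ 2 * (n.+1%:R * d * d))).
  apply: ler_pM => //.
    by rewrite ler_sqr // nnegrE; lra.
  by apply: (le_trans XX); apply: ler_pM; rewrite ?mulr_ge0 // ler_pM.
have : n.+1%:R * d <= 2^-1.
  rewrite -(ler_pM2r (x := 2 * n.+1%:R)); last by lra.
  have -> : n.+1%:R * d * (2 * n.+1%:R) = d * (2 * n.+1%:R ^+ 2) by ring.
  by rewrite dE mulrA mulVf // mul1r.
have : n.+1%:R ^+ 2 * d = 2^-1 by have -> : n.+1%:R ^+ 2 * d = d * (2 * n.+1%:R ^+ 2) / 2; [field|rewrite dE mul1r].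
move=> E1 E2; have -> : n.+1%:R ^+ 2 * (n.+1%:R * d * d) = (n.+1%:R * d) * (n.+1%:R ^+ 2 * d) by ring.
by rewrite E1; lra.
Qed.

(** Cauchy-Schwarz for the form of [P], read off its sign at [y + a e_i]. The minimizer
    [a = - x / p] is replaced by [- x / (p + 1)] because [p = P i i] may vanish. *)
Lemma psd_entry_le n (P : 'M[R]_n) (y : 'rV[R]_n) i : P^T = P ->
  (forall y : 'rV[R]_n, 0 <= (y *m P *m y^T) 0 0) ->
  (y *m P) 0 i ^+ 2 <= (P i i + 1) * (y *m P *m y^T) 0 0.
Proof.
move=> PT P_ge0.
have p0 : 0 <= P i i.
  have := P_ge0 (delta_mx 0 i); rewrite -rowE trmx_delta -colE !mxE; exact.
set p := P i i in p0 *; set x := (y *m P) 0 i; set v := (y *m P *m y^T) 0 0.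
pose a := - (x / (p + 1)).
have p1 : 0 < p + 1 by lra.
pose d : 'rV[R]_n := delta_mx 0 i.
have := P_ge0 (y + a *: d).
have -> : ((y + a *: d) *m P *m (y + a *: d)^T) 0 0 = v + 2 * a * x + a ^+ 2 * p.
  have e1 : (y *m P *m (a *: d^T)) 0 0 = a * x.
    by rewrite -scalemxAr [LHS]mxE trmx_delta -colE [X in _ * X]mxE.
  have e2 : (a *: d *m P *m y^T) 0 0 = a * x.
    have -> : a *: d *m P *m y^T = (y *m P *m (a *: d^T))^T.
      by rewrite trmx_mul linearZ /= trmxK trmx_mul PT mulmxA.
    by rewrite mxE e1.
  have e3 : (a *: d *m P *m (a *: d^T)) 0 0 = a ^+ 2 * p.
    by rewrite -!scalemxAl -scalemxAr -rowE trmx_delta -colE !mxE mulrA.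
  rewrite mulmxDl linearD /= linearZ /= mulmxDr !mulmxDl.
  rewrite [LHS]mxE [X in X + _]mxE [X in _ + X]mxE e1 e2 e3 -/v; ring.
have -> : v + 2 * a * x + a ^+ 2 * p = v - x ^+ 2 * ((p + 2) / (p + 1) ^+ 2).
  by rewrite /a; field; rewrite gt_eqF.
have v0 : 0 <= v by exact: P_ge0.
clear PT P_ge0.
rewrite subr_ge0 mulrA ler_pdivrMr ?exprn_gt0 // => H.
have p2 : 0 < p + 2 by lra.
rewrite -(ler_pM2r p2); apply: (le_trans H).
by move: v v0 {H} => w w0; nra.
Qed.

Lemma psd_kernel n (P : 'M[R]_n) (y : 'rV[R]_n) : P^T = P ->
  (forall y : 'rV[R]_n, 0 <= (y *m P *m y^T) 0 0) -> (y *m P *m y^T) 0 0 = 0 -> y *m P = 0.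
Proof.
move=> PT P0 yP; apply/rowP => i; rewrite [RHS]mxE.
have := psd_entry_le y i PT P0; rewrite yP mulr0 => H.
by apply/eqP; rewrite -sqrf_eq0; apply/eqP/le_anti; rewrite H sqr_ge0.
Qed.

(** The Lyapunov function is [x P^-1 x^T], written [y P y^T] with [y = x P^-1]; its derivative along
    the flow is [y M y^T]. Since it is at most [c * y y^T], it decays at the rate
    [g = 1 / (2 c)]. *)
Lemma lyapunov_stable n (AK P M : 'M[R]_n) : P \in unitmx -> P^T = P ->
  (forall y : 'rV[R]_n, 0 <= (y *m P *m y^T) 0 0) -> P *m AK + (P *m AK)^T = M ->
  (forall y : 'rV[R]_n, (y *m M *m y^T) 0 0 <= - (2^-1 * (y *m y^T) 0 0)) -> stable_mx AK.
Proof.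
move=> uP PT P_ge0 lyap M_le.
pose c := n%:R ^+ 2 * `|P| + 1.
have c0 : 0 < c by rewrite ltr_wpDl // mulr_ge0 // exprn_ge0.
pose g := (2 * c)^-1.
have g0 : 0 < g by rewrite invr_gt0 mulr_gt0.
apply: decays_stable => x0.
pose x t := x0 *m expm AK t; pose y t := x t *m invmx P.
have xy t : y t *m P = x t by rewrite /y mulmxKV.
have dx : has_deriv0 x (fun t => x t *m AK) := @expm_row_deriv _ _ AK x0.
have dy : has_deriv0 y (fun t => x t *m AK *m invmx P) := has_deriv0_lin (bounded_lin_mulmxr 1 (invmx P)) dx.
pose v t := (y t *m P *m (y t)^T) 0 0.
have dv : has_deriv0 (v : R -> R^o) (fun t => (y t *m M *m (y t)^T) 0 0).
  have D1 := has_deriv0_mulmx dx (has_deriv0_lin (@bounded_lin_trmx R 1 n) dy).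
  have := has_deriv0_lin (@bounded_lin_entry R 1 1 0 0) D1.
  apply: has_deriv0_ext => t _; first by rewrite /v xy.
  congr (fun_of_matrix _ 0 0); rewrite -lyap mulmxDr mulmxDl; congr (_ + _).
    by rewrite mulmxA xy.
  by rewrite -xy [(P *m AK)^T]trmx_mul PT !trmx_mul PT trmx_inv PT !mulmxA !(mulmxK uP).
have v_le (t : R) : 0 <= t -> v t <= v 0 * expR (- (g * t)).
  move=> t0.
  have D1 := has_deriv0Z (has_deriv0_exp g) dv.
  have := has_deriv0_le D1 (has_deriv0_cst (v 0 : R^o)); rewrite mulr0 expR0 scale1r => H.
  have {}H : expR (g * t) * v t <= v 0.
    apply: H => // s s0.
    rewrite -[_ *: v s]/(g * expR (g * s) * v s) -[_ *: _]/(expR (g * s) * (y s *m M *m (y s)^T) 0 0).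
    have := expR_gt0 (g * s); set E := expR _ => E0.
    have -> : g * E * v s + E * (y s *m M *m (y s)^T) 0 0 = E * (g * v s + (y s *m M *m (y s)^T) 0 0) by ring.
    rewrite pmulr_rle0 //.
    have := M_le (y s); have : v s <= c * (y s *m (y s)^T) 0 0.
      apply: (le_trans (ler_norm _)); apply: (le_trans (quad_form_le _ _)).
      apply: ler_pM; rewrite ?mulr_ge0 ?exprn_ge0 //; first by rewrite /c lerDl.
      exact: sq_norm_ge.
    move=> vs; have : g * v s <= 2^-1 * (y s *m (y s)^T) 0 0.
      rewrite /g invfM -mulrA ler_pM2l ?invr_gt0 // mulrC ler_pdivrMr // mulrC //.
    lra.
  by rewrite expRN ler_pdivlMr ?expR_gt0 // mulrC.
have v0 : 0 <= v 0 by exact: P_ge0.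
have x_le (t : R) i : x t 0 i ^+ 2 <= (P i i + 1) * v t.
  by rewrite -xy; exact: psd_entry_le.
apply/cvgr0Pnorm_le => e e0.
pose k := (\sum_i (P i i + 1)) * v 0.
have p_ge0 i : 0 <= P i i + 1.
  by have := P_ge0 (delta_mx 0 i); rewrite -rowE trmx_delta -colE !mxE; lra.
have [s s0 Hs] := exp_small k g0 (exprn_gt0 2 e0).
near=> t; have ts : s <= t by near: t; exact/nbhs_pinfty_ge/num_real.
apply: mx_norm_le; first exact: ltW.
move=> i j; rewrite ord1 -ler_sqr ?nnegrE ?(ltW e0) // real_normK ?num_real //.
apply: (le_trans (x_le t j)); apply: le_trans (Hs t ts); rewrite /k -mulrA.
apply: ler_pM => //; first exact: P_ge0.
  rewrite (bigD1 j) //= lerDl; apply: sumr_ge0 => l _; exact: p_ge0.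
by apply: v_le; lra.
Unshelve. all: by end_near. Qed.

(* Integrating [(X^T X)' = X^T (X A + V B) + (X A + V B)^T X] over [0, tau] gives the Lyapunov
   inequality for [A + K B] with [K = (int X^T X)^-1 (int X^T V)]: no spectral theory is needed. *)
Lemma stabilizing_gain n m (A : 'M[R]_n) (B : 'M[R]_(m, n)) (tau : R)
    (X : R -> 'M[R]_n) (V : R -> 'M[R]_(n, m)) :
  0 < tau -> has_deriv0 X (fun t => X t *m A + V t *m B) -> C0 V -> X 0 = 1%:M ->
  `|X tau| <= (2 * n.+1%:R ^+ 2)^-1 -> exists K : 'M[R]_(n, m), stable_mx (A + K *m B).
Proof.
move=> tau0 dX cV X0 Xtau.
have cX := has_deriv0_C0 dX.
have cXT : C0 (fun t => (X t)^T) := C0_lin (@bounded_lin_trmx R n n) cX.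
have [G1 G10 dG1] := primitive_exists (C0_mulmx cXT cX).
have [G2 G20 dG2] := primitive_exists (C0_mulmx cXT cV).
have dXT := has_deriv0_lin (@bounded_lin_trmx R n n) dX.
pose P := G1 tau; pose N := G2 tau.
have tau0' := ltW tau0.
have PT : P^T = P.
  apply: (has_deriv0_eq (has_deriv0_lin (@bounded_lin_trmx R n n) dG1) dG1) tau0'.
    by move=> t _; rewrite trmx_mul trmxK.
  by rewrite G10 trmx0.
have lyap : P *m A + N *m B + (P *m A + N *m B)^T = (X tau)^T *m X tau - 1%:M.
  have D1 := has_deriv0D (has_deriv0_lin (@bounded_lin_mulmxr R n n n A) dG1)
                         (has_deriv0_lin (@bounded_lin_mulmxr R n m n B) dG2).
  have D2 := has_deriv0D D1 (has_deriv0_lin (@bounded_lin_trmx R n n) D1).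
  have D3 := has_deriv0B (has_deriv0_mulmx dXT dX) (has_deriv0_cst (1%:M : 'M[R]_n)).
  apply: (has_deriv0_eq D2 D3) tau0'.
    move=> t _ /=; rewrite subr0 addrC -!mulmxA -mulmxDr; congr (_ + _).
    by rewrite trmx_mul trmxK.
  by rewrite G10 G20 X0 !mul0mx addr0 trmx0 addr0 trmx1 mulmx1 subrr.
have q_deriv (y : 'rV[R]_n) : has_deriv0 (fun t => (y *m G1 t *m y^T) 0 0 : R^o)
    (fun t => (y *m (X t)^T *m (y *m (X t)^T)^T) 0 0).
  have := has_deriv0_lin (@bounded_lin_entry R 1 1 0 0)
    (has_deriv0_lin (@bounded_lin_mulmxr R 1 n 1 y^T) (has_deriv0_lin (@bounded_lin_mulmxl R 1 n n y) dG1)).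
  by apply: has_deriv0_ext => // t _; rewrite trmx_mul trmxK !mulmxA.
have q'_ge0 (y : 'rV[R]_n) t : 0 <= (y *m (X t)^T *m (y *m (X t)^T)^T) 0 0.
  by apply: le_trans (sq_norm_ge _); exact: sqr_ge0.
have q_ge0 (y : 'rV[R]_n) (t : R) : 0 <= t -> 0 <= (y *m G1 t *m y^T) 0 0.
  apply: (has_deriv0_le (has_deriv0_cst (0 : R^o)) (q_deriv y)) => //.
  by rewrite G10 mulmx0 mul0mx mxE.
have P_ge0 (y : 'rV[R]_n) : 0 <= (y *m P *m y^T) 0 0 by apply: q_ge0.
(* For [y] in the kernel the nondecreasing function [y G1(t) y^T] vanishes at 0 and at [tau], hence
   between them; its derivative at 0 is [y y^T] because [X 0 = 1]. *)
have uP : P \in unitmx.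
  rewrite -row_free_unit -kermx_eq0; apply/eqP/row_matrixP => i; rewrite row0.
  set y := row i _.
  have yP : y *m P = 0 by apply/sub_kermxP; exact: row_sub.
  have q0 (t : R) : 0 <= t -> t <= tau -> (y *m G1 t *m y^T) 0 0 = 0.
    move=> t0 tt; apply/le_anti; rewrite q_ge0 // andbT.
    have D0 : dvon t tau (fun=> 0 : R^o) (fun=> 0) := has_deriv0_dvon (b := tau) t0 (has_deriv0_cst (0 : R^o)).
    have Hm := mean_value_ineq tt D0 (has_deriv0_dvon (b := tau) t0 (q_deriv y)).
    have q1 : (y *m P *m y^T) 0 0 = 0 by rewrite yP mul0mx mxE.
    have {}Hm : 0 <= (y *m P *m y^T) 0 0 - (y *m G1 t *m y^T) 0 0.
      apply: le_trans (Hm _); first exact: normr_ge0.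
      by move=> s _ _; rewrite normr0; exact: q'_ge0.
    by move: Hm; rewrite q1 sub0r oppr_ge0.
  have y0 : (y *m y^T) 0 0 = 0.
    apply/le_anti/andP; split; last by apply: le_trans (sq_norm_ge _); exact: sqr_ge0.
    apply/ler_addgt0Pr => e e0; rewrite add0r.
    have [d d0 Hd] := (iffLR (has_deriv0P _ _) (q_deriv y)) 0 (lexx 0) e e0.
    pose s := Num.min (d / 2) tau.
    have s0 : 0 < s by rewrite lt_min tau0 andbT; lra.
    have sd : s < d by have : s <= d / 2; [rewrite ge_min lexx|lra].
    have st : s <= tau by rewrite ge_min lexx orbT.
    have := Hd s (ltW s0); rewrite subr0 gtr0_norm // => /(_ sd).
    rewrite q0 ?(ltW s0) // q0 // X0 trmx1 mulmx1 subr0 sub0r normrN.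
    rewrite -[_ *: _]/(s * (y *m y^T) 0 0) normrM gtr0_norm // mulrC ler_pM2r //.
    by apply: le_trans; exact: ler_norm.
  apply/eqP; rewrite -normr_le0 -sqr_le0 || rewrite -normr_eq0.
  by have := sq_norm_ge y; rewrite y0 exprn_even_le0 //= => /eqP ->.
pose K := invmx P *m N; exists K.
pose AK := A + K *m B.
have PAK : P *m AK = P *m A + N *m B by rewrite /AK mulmxDr /K !mulmxA mulmxV // mul1mx.
pose M := (X tau)^T *m X tau - 1%:M.
have M_le (y : 'rV[R]_n) : (y *m M *m y^T) 0 0 <= - (2^-1 * (y *m y^T) 0 0).
  have -> : (y *m M *m y^T) 0 0 = (y *m ((X tau)^T *m X tau) *m y^T) 0 0 - (y *m y^T) 0 0.
    by rewrite /M mulmxBr mulmx1 mulmxBl [LHS]mxE [X in _ + X]mxE.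
  suff : (y *m ((X tau)^T *m X tau) *m y^T) 0 0 <= 2^-1 * (y *m y^T) 0 0 by lra.
  exact: gram_quad_le.
apply: (lyapunov_stable uP PT P_ge0 _ M_le).
by rewrite -/AK PAK lyap.
Qed.

(** By duality the pair [(A^T, C^T)] is to be stabilized. The observability Gramian [W] is
    invertible at some time [tau] and yields an open-loop control that takes the identity to 0 at
    [tau], which is what [stabilizing_gain] asks for. *)
Lemma observer_gain n k (A : 'M[R]_n) (C : 'M[R]_(n, k)) :
  (forall x : 'rV[R]_n, (forall t : R, 0 <= t -> x *m expm A t *m C = 0) -> x = 0) ->
  exists L : 'M[R]_(k, n), stable_mx (A + C *m L).
Proof.
move=> obs.
pose E t := expm A t *m C.
have dE : has_deriv0 E (fun t => A *m E t).
  have := has_deriv0_lin (@bounded_lin_mulmxr R n n k C) (@expm_deriv _ _ A).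
  by apply: has_deriv0_ext => // t _; rewrite /E mulmxA.
have dET := has_deriv0_lin (@bounded_lin_trmx R n k) dE.
have [W W0 dW] := primitive_exists (C0_mulmx (has_deriv0_C0 dE) (has_deriv0_C0 dET)).
have WT (t : R) : 0 <= t -> (W t)^T = W t.
  apply: (has_deriv0_eq (has_deriv0_lin (@bounded_lin_trmx R n n) dW) dW).
    by move=> s _; rewrite trmx_mul trmxK.
  by rewrite W0 trmx0.
have q_deriv (y : 'rV[R]_n) : has_deriv0 (fun t => (y *m W t *m y^T) 0 0 : R^o)
    (fun t => (y *m E t *m (y *m E t)^T) 0 0).
  have := has_deriv0_lin (@bounded_lin_entry R 1 1 0 0)
    (has_deriv0_lin (@bounded_lin_mulmxr R 1 n 1 y^T) (has_deriv0_lin (@bounded_lin_mulmxl R 1 n n y) dW)).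
  by apply: has_deriv0_ext => // t _; rewrite [(y *m E t)^T]trmx_mul !mulmxA.
have q'_ge0 (y : 'rV[R]_n) t : 0 <= (y *m E t *m (y *m E t)^T) 0 0.
  by apply: le_trans (sq_norm_ge _); exact: sqr_ge0.
have q_mono (y : 'rV[R]_n) (s t : R) : 0 <= s -> s <= t -> (y *m W s *m y^T) 0 0 <= (y *m W t *m y^T) 0 0.
  move=> s0 st.
  have D0 : dvon s t (fun=> 0 : R^o) (fun=> 0) := has_deriv0_dvon (b := t) s0 (has_deriv0_cst (0 : R^o)).
  have Hm := mean_value_ineq st D0 (has_deriv0_dvon (b := t) s0 (q_deriv y)).
  rewrite -subr_ge0; apply: le_trans (Hm _); first exact: normr_ge0.
  by move=> r _ _; rewrite normr0; exact: q'_ge0.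
have q_ge0 (t : R) (y : 'rV[R]_n) : 0 <= t -> 0 <= (y *m W t *m y^T) 0 0.
  move=> t0; have := q_mono y 0 t (lexx 0) t0.
  by rewrite W0 mulmx0 mul0mx [X in X <= _]mxE.
have ker_sub (y : 'rV[R]_n) (s t : R) : 0 <= s -> s <= t -> y *m W t = 0 -> y *m W s = 0.
  move=> s0 st yW; apply: psd_kernel; [exact: WT|by move=> z; exact: q_ge0|].
  apply/le_anti; rewrite q_ge0 // andbT; apply: le_trans (q_mono y s t s0 st) _.
  by rewrite yW mul0mx mxE.
(* The kernels of [W t] shrink as [t] grows. At an integer [k0] of maximal rank they have become
   stationary, so a vector of that kernel is unobservable for all times. [tau] is [k0 + 1] in order
   to be positive. *)
pose Q (r : nat) := `[< exists k : nat, \rank (W k%:R) = r >].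
have exQ : exists r, Q r by exists (\rank (W 0%:R)); apply/asboolP; exists 0%N.
have Qle r : Q r -> (r <= n)%N by move=> /asboolP[j <-]; exact: rank_leq_row.
have [r /asboolP[k0 Hk0] rmax] := ex_maxnP exQ Qle.
pose tau : R := k0.+1%:R.
have tau0 : 0 < tau by rewrite ltr0n.
have tau0' := ltW tau0.
have uW : W tau \in unitmx.
  rewrite -row_free_unit -kermx_eq0; apply/eqP/row_matrixP => i; rewrite row0.
  set y := row i _.
  have yW : y *m W tau = 0 by apply/sub_kermxP; exact: row_sub.
  have yW0 : y *m W k0%:R = 0 by apply: ker_sub yW => //; rewrite ler_nat.
  have yWk (j : nat) : (k0 <= j)%N -> y *m W j%:R = 0.
    move=> kj.
    have sub : (kermx (W j%:R) <= kermx (W k0%:R))%MS.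
      apply/row_subP => l; apply/sub_kermxP; apply: (@ker_sub _ _ j%:R) => //; first by rewrite ler_nat.
      by apply/sub_kermxP; exact: row_sub.
    have : (kermx (W k0%:R) <= kermx (W j%:R))%MS.
      rewrite -(mxrank_leqif_sup sub) !mxrank_ker.
      have le1 : (\rank (W j%:R) <= \rank (W k0%:R))%N by rewrite Hk0; apply: rmax; apply/asboolP; exists j.
      by rewrite eqn_leq; have := mxrankS sub; rewrite !mxrank_ker => ->; rewrite leq_sub2l.
    move=> sub'; apply/sub_kermxP; apply: submx_trans sub'.
    by apply/sub_kermxP.
  apply: obs => t t0.
  have q0 (s : R) : 0 <= s -> (y *m W s *m y^T) 0 0 = 0.
    move=> s0; pose j := maxn k0 (Num.truncn s).+1.
    have sj : s <= j%:R.
      by apply: le_trans (ltW (truncnS_gt s)) _; rewrite ler_nat leq_maxr.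
    by rewrite (ker_sub y s j%:R s0 sj (yWk j (leq_maxl _ _))) mul0mx mxE.
  have dq := has_deriv0_ext q0 (fun t _ => erefl) (q_deriv y).
  have := has_deriv0_uniq dq (has_deriv0_cst (0 : R^o)) t0 => H.
  have := sq_norm_ge (y *m E t); rewrite H => {}H.
  rewrite -mulmxA -/(E t); apply/eqP; rewrite -normr_le0.
  by move: H; rewrite exprn_even_le0 //= => /eqP ->.
pose e2 t := expm A (-1 * t + tau).
have de2 : has_deriv0 e2 (fun t => -1 *: (A *m e2 t)) := @expm_affine_deriv _ _ A (-1) tau.
(* Both sides have the same derivative and equal [C C^T] at 0. *)
have lyap (t : R) : 0 <= t -> A *m W t + W t *m A^T + C *m C^T = E t *m (E t)^T.
  apply: (has_deriv0_eq (has_deriv0D (has_deriv0D (has_deriv0_lin (@bounded_lin_mulmxl R n n n A) dW)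
     (has_deriv0_lin (@bounded_lin_mulmxr R n n n A^T) dW)) (has_deriv0_cst (C *m C^T)))
     (has_deriv0_mulmx dE dET)).
    by move=> s _; rewrite addr0 [(A *m E s)^T]trmx_mul !mulmxA.
  by rewrite W0 mulmx0 mul0mx !add0r /E expm0 mul1mx.
have [N EN] : exists N : 'M[R]_n, W tau *m N = expm A tau.
  by exists (invmx (W tau) *m expm A tau); rewrite mulmxA mulmxV // mul1mx.
(* The minimum-energy control: [W(tau) N = e^{tau A}] makes [Y tau = 0], and [lyap] gives
   [Y' = A Y - C C^T (e2 t)^T N], so the transpose of [Y] is controlled through [C^T]. *)
pose Y t := expm A t - W t *m (e2 t)^T *m N.
pose V t := - (C^T *m (e2 t)^T *m N)^T.
have dS := has_deriv0_mulmx dW (has_deriv0_lin (@bounded_lin_trmx R n n) de2).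
have dY := has_deriv0B (@expm_deriv _ _ A) (has_deriv0_lin (@bounded_lin_mulmxr R n n n N) dS).
have dX := has_deriv0_lin (@bounded_lin_trmx R n n) dY.
have [||||K stK] := @stabilizing_gain n k A^T C^T tau (fun t => (Y t)^T) V tau0.
- apply: has_deriv0_ext dX => // t t0.
  rewrite /V mulNmx -trmx_mul -trmx_mul -linearB /=; congr (_^T).
  rewrite /Y mulmxBr -addrA; congr (_ + _); rewrite -opprD; congr (- _).
  rewrite !mulmxA -!mulmxDl; congr (_ *m N).
  have comm : (A *m e2 t)^T = A^T *m (e2 t)^T by rewrite /e2 expm_comm trmx_mul.
  rewrite scaleN1r linearN /= comm mulmxN mulmxA -mulmxBl.
  congr (_ *m _); apply/eqP; rewrite subr_eq -lyap //.
  by rewrite addrAC.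
- apply: C0N; apply: (C0_lin (@bounded_lin_trmx R k n) (f := fun t => C^T *m (e2 t)^T *m N) _) || apply: (@C0_lin _ _ _ _ (fun t => C^T *m (e2 t)^T *m N) (@bounded_lin_trmx R k n)).
  apply: C0_mulmx; last exact: C0_cst.
  apply: C0_mulmx; first exact: C0_cst.
  exact: C0_lin (@bounded_lin_trmx R n n) (has_deriv0_C0 de2).
- by rewrite /Y expm0 W0 !mul0mx subr0 trmx1.
- rewrite /Y /e2 mulN1r addNr expm0 trmx1 mulmx1 EN subrr trmx0 normr0.
  by rewrite invr_ge0 mulr_ge0 // exprn_ge0.
exists K^T; have := stable_tr stK; by rewrite linearD /= trmx_mul !trmxK.
Qed.

End Design.

(** * Trajectories and input-output gains *)

Section Trajectories.
Variable R : realType.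

Lemma C0_local (V : normedModType R) (f : R -> V) :
  (forall T : R, exists2 g : R -> V, C0 g & forall t : R, 0 <= t -> t <= T -> f t = g t) -> C0 f.
Proof.
move=> H; apply/C0P => t t0 e e0; have [g /C0P cg fg] := H (t + 1).
have [d d0 Hd] := cg t t0 e e0.
exists (Num.min d 1); first by rewrite lt_min d0 ltr01.
move=> s s0; rewrite lt_min => /andP[sd /ltr_normlP[s1 s2]].
by rewrite !fg //; [exact: Hd|lra|lra].
Qed.

Lemma has_deriv0_local (V : normedModType R) (f f' : R -> V) :
  (forall T : R, exists g g' : R -> V, has_deriv0 g g' /\
     forall t : R, 0 <= t -> t <= T -> f t = g t /\ f' t = g' t) -> has_deriv0 f f'.
Proof.
move=> H; apply/has_deriv0P => t t0 e e0; have [g [g' [/has_deriv0P dg fg]]] := H (t + 1).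
have [d d0 Hd] := dg t t0 e e0.
have Et : f t = g t /\ f' t = g' t by apply: fg => //; lra.
exists (Num.min d 1); first by rewrite lt_min d0 ltr01.
move=> s s0; rewrite lt_min => /andP[sd /ltr_normlP[s1 s2]].
have Es : f s = g s /\ f' s = g' s by apply: fg => //; lra.
by rewrite Et.1 Et.2 Es.1; exact: Hd.
Qed.

Definition delay (V : normedModType R) (tau : R) (f : R -> V) (t : R) : V :=
  if t <= tau then 0 else f (t - tau).

Lemma C0_delay (V : normedModType R) (tau : R) (f : R -> V) : f 0 = 0 -> C0 f -> C0 (delay tau f).
Proof.
move=> f0 /C0P cf; apply/C0P => t t0 e e0; rewrite /delay.
have [tt|tt] := ltP t tau.
  exists (tau - t); first by rewrite subr_gt0.
  move=> s s0 /ltr_normlP[_ st]; rewrite !ifT ?(ltW tt) ?subrr ?normr0 ?(ltW e0) //; lra.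
have tt0 : 0 <= t - tau by rewrite subr_ge0.
have Et : (if t <= tau then 0 else f (t - tau)) = f (t - tau).
  have [h|//] := leP t tau; have -> : t - tau = 0 by lra.
  by rewrite f0.
rewrite Et; have [d d0 Hd] := cf _ tt0 _ e0; exists d => // s s0 sd.
have [st|st] := leP s tau.
  rewrite -{1}f0; apply: Hd => //; rewrite sub0r normrN ger0_norm //.
  by move/ltr_normlP: sd => [sd _]; lra.
by apply: Hd; [lra|have -> : s - tau - (t - tau) = s - t by ring].
Qed.

Lemma has_deriv0_delay (V : normedModType R) (tau : R) (f f' : R -> V) : f 0 = 0 -> f' 0 = 0 ->
  has_deriv0 f f' -> has_deriv0 (delay tau f) (delay tau f').
Proof.
move=> f0 f'0 /has_deriv0P df; apply/has_deriv0P => t t0 e e0; rewrite /delay.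
have [tt|tt] := ltP t tau.
  exists (tau - t); first by rewrite subr_gt0.
  move=> s s0 /ltr_normlP[_ st]; rewrite !ifT ?(ltW tt) //; last lra.
  by rewrite subrr scaler0 subrr normr0 mulr_ge0 // ltW.
have tt0 : 0 <= t - tau by rewrite subr_ge0.
have [d d0 Hd] := df _ tt0 _ e0.
have [te|tne] := eqVneq t tau.
  rewrite te lexx; exists d => // s s0 sd.
  rewrite scaler0 !subr0; have [st|st] := leP s tau; first by rewrite normr0 mulr_ge0 // ltW.
  have := Hd (s - tau); rewrite te subrr f0 f'0 scaler0 !subr0 => H.
  by apply: H; lra.
have tlt : tau < t by rewrite lt_neqAle eq_sym tne.
have tF : (t <= tau) = false by rewrite leNgt tlt.
rewrite tF.
exists (Num.min d (t - tau)); first by rewrite lt_min d0 subr_gt0.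
move=> s s0; rewrite lt_min => /andP[sd /ltr_normlP[sd1 sd2]].
rewrite ifN; last by rewrite -ltNge; lra.
have := Hd (s - tau); have -> : s - tau - (t - tau) = s - t by ring.
by apply; [lra|].
Qed.
End Trajectories.

(** * Superposition and delay of trajectories; the gain inequality without offset *)

Section SysTheory.
Variables (R : realType) (U Y : normedModType R) (X : completeNormedModType R).
Variables (A : X -> X) (D : set X) (B : U -> X) (C : X -> Y) (T : R -> X -> X).
Hypothesis SG : semigroup_gen A D T.
Hypothesis bB : bounded_lin B.
Hypothesis gC : graph_bounded A D C.

Lemma graph_C0 (x : R -> X) : (forall t : R, 0 <= t -> D (x t)) -> C0 x -> C0 (A \o x) ->
  C0 (fun t => C (x t)).
Proof.
move=> Dx /C0P cx /C0P cAx; have [lC [M HM]] := gC.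
have M0 : 0 < `|M| + 1 by rewrite ltr_wpDl.
apply/C0P => t t0 e e0.
have e'0 : 0 < e / (2 * (`|M| + 1)) by rewrite divr_gt0 // mulr_gt0.
have [d d0 Hd] := cx t t0 _ e'0; have [d' d'0 Hd'] := cAx t t0 _ e'0.
exists (Num.min d d'); first by rewrite lt_min d0.
move=> s s0; rewrite lt_min => /andP[sd sd'].
have [Ds Dt] := (Dx s s0, Dx t t0).
have -> : C (x s) - C (x t) = C (x s - x t).
  by have := lC (-1) _ _ Dt Ds; rewrite !scaleN1r addrC [- C _ + _]addrC => ->.
have [Dst Ast] := DomB SG Ds Dt.
apply: (le_trans (HM _ Dst)); rewrite Ast.
apply: (@le_trans _ _ ((`|M| + 1) * (`|x s - x t| + `|A (x s) - A (x t)|))).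
  by rewrite ler_wpM2r ?addr_ge0 //; have := ler_norm M; lra.
rewrite mulrC -ler_pdivlMr //; have := Hd s s0 sd; have := Hd' s s0 sd' => /= h1 h2.
have -> : e / (`|M| + 1) = e / (2 * (`|M| + 1)) + e / (2 * (`|M| + 1)) by field; lra.
by rewrite lerD.
Qed.

Lemma Sys_intro (u : R -> U) (x x' : R -> X) (y : R -> Y) : C0 u ->
  (forall t : R, 0 <= t -> D (x t)) -> has_deriv0 x x' -> C0 x' ->
  (forall t : R, 0 <= t -> x' t = A (x t) + B (u t)) ->
  (forall t : R, 0 <= t -> y t = C (x t)) -> Sys A D B C u x y.
Proof.
move=> cu Dx dx cx' Ex Ey.
have cx := has_deriv0_C0 dx.
have cA : C0 (A \o x).
  apply: C0_ext (C0B cx' (C0_lin bB cu)) => t t0 /=.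
  by rewrite Ex // addrK.
split => //; split.
  by apply: C0_ext (graph_C0 Dx cx cA) => t t0; rewrite Ey.
do 3 split => //.
by exists x'; split=> // t t0; split; [exact: Ex|exact: Ey].
Qed.

Lemma Sys_elim (u : R -> U) (x : R -> X) (y : R -> Y) : Sys A D B C u x y ->
  [/\ C0 u, C0 y, (forall t : R, 0 <= t -> D (x t)), C0 (A \o x) &
   has_deriv0 x (fun t => A (x t) + B (u t)) /\ forall t : R, 0 <= t -> y t = C (x t)].
Proof.
move=> [cu [cy [Dx [_ [cA [x' [[_ [dx _]] E]]]]]]]; split => //; split; last by move=> t /E[].
by apply: has_deriv0_ext dx => // t /E[].
Qed.

Lemma Sys_lin (a : R) u1 x1 y1 u2 x2 y2 : Sys A D B C u1 x1 y1 -> Sys A D B C u2 x2 y2 ->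
  Sys A D B C (fun t => a *: u1 t + u2 t) (fun t => a *: x1 t + x2 t) (fun t => a *: y1 t + y2 t).
Proof.
move=> /Sys_elim[cu1 _ Dx1 cA1 [dx1 E1]] /Sys_elim[cu2 _ Dx2 cA2 [dx2 E2]].
have cD u x : C0 u -> C0 (A \o x) -> C0 (fun t => A (x t) + B (u t)).
  by move=> cu cA; apply: C0D => //; exact: C0_lin.
apply: (@Sys_intro _ _ (fun t => a *: (A (x1 t) + B (u1 t)) + (A (x2 t) + B (u2 t)))).
- by apply: C0D => //; apply: C0Zc.
- by move=> t t0; case: (Dom_lin SG a (Dx1 t t0) (Dx2 t t0)).
- by apply: has_deriv0D => //; apply: has_deriv0Zc.
- by apply: C0D; [apply: C0Zc|]; apply: cD.
- move=> t t0; have [_ ->] := Dom_lin SG a (Dx1 t t0) (Dx2 t t0).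
  by rewrite (bounded_linD _ _ bB) (bounded_linZ _ _ bB); linear_comb R.
- by move=> t t0; rewrite E1 // E2 //; have [lC _] := gC; rewrite lC //; [exact: Dx1|exact: Dx2].
Qed.

Lemma Sys_orbit (x : X) : D x ->
  Sys A D B C (fun=> 0) (fun t => T t x) (fun t => C (T t x)).
Proof.
move=> Dx; apply: (@Sys_intro _ _ (fun t => T t (A x))) => //.
- exact: C0_cst.
- by move=> t t0; case: (orbit_Dom SG t0 Dx).
- exact: (orbit_deriv SG Dx).
- exact: (@orbit_C0 _ _ _ _ _ SG (A x)).
- by move=> t t0; have [_ ->] := orbit_Dom SG t0 Dx; rewrite (bounded_lin0 bB) addr0.
Qed.

Lemma exp_stable_semigroup : exp_stable (Sys A D B C) -> exists M b : R, [/\ 0 <= M, 0 < b &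
  forall (t : R) x, 0 <= t -> `|T t x| <= M * expR (- (b * t)) * `|x|].
Proof.
move=> [b [M [b0 H]]]; exists (Num.max M 0), b; split => //; first by rewrite le_max lexx orbT.
apply: (exp_bound_dense SG) => t x Dx t0.
by have := H _ _ _ (Sys_orbit Dx) (fun _ _ => erefl) t t0; rewrite (sg0 SG).
Qed.

Lemma Sys_delay (tau : R) u x y : u 0 = 0 -> x 0 = 0 -> Sys A D B C u x y ->
  Sys A D B C (delay tau u) (delay tau x) (delay tau y).
Proof.
move=> u0 x0 /Sys_elim[cu cy Dx cA [dx E]].
have [D0 A0] := Dom0 SG.
have C00 : C 0 = 0 by have [lC _] := gC; have := lC (-1) _ _ D0 D0; rewrite scaler0 addr0 scaleN1r addNr.
pose x' t := A (x t) + B (u t).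
have x'0 : x' 0 = 0 by rewrite /x' x0 u0 A0 (bounded_lin0 bB) addr0.
apply: (@Sys_intro _ _ (delay tau x')).
- exact: C0_delay.
- by move=> t t0; rewrite /delay; case: leP => // h; apply: Dx; lra.
- exact: has_deriv0_delay.
- apply: C0_delay => //; apply: C0D => //; exact: C0_lin.
- move=> t t0; rewrite /delay; case: leP => h //.
  by rewrite A0 (bounded_lin0 bB) addr0.
- move=> t t0; rewrite /delay; case: leP => h //.
  by rewrite E //; lra.
Qed.

(* Gliding hump: if the bound failed for [b = 0], superposing delayed copies of the offending
   trajectory with rapidly growing weights would violate it for every finite [b]. *)
Lemma io_bound_zero_state (be al c t : R) u u' x y : 0 <= be -> 0 <= al ->
  io_bound (Sys A D B C) be al -> Sys A D B C u x y -> C1 u u' ->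
  x 0 = 0 -> u 0 = 0 -> u' 0 = 0 -> 0 <= t ->
  (forall s : R, 0 <= s -> s <= t -> expR (be * s) * `|u s| <= c /\ expR (be * s) * `|u' s| <= c) ->
  expR (be * t) * `|y t| <= al * c.
Proof.
move=> be0 al0 [b [_ Hb]] S [_ [du cu']] x0 u0 u'0 t0 Hc.
rewrite leNgt; apply/negP => Hlt.
have [cu cy Dx cA [dx E]] := Sys_elim S.
have [D0 A0] := Dom0 SG.
have c0 : 0 <= c.
  by have [+ _] := Hc 0 (lexx 0) t0; apply: le_trans; rewrite mulr_ge0 ?expR_ge0.
have C00 : C 0 = 0 by have [lC _] := gC; have := lC (-1) _ _ D0 D0; rewrite scaler0 addr0 scaleN1r addNr.
have y0 : y 0 = 0 by rewrite E // x0.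
have tp : 0 < t.
  rewrite lt_neqAle t0 andbT; apply: contraTneq Hlt => <-; rewrite y0 normr0 mulr0 -leNgt.
  exact: mulr_ge0.
pose dl := expR (be * t) * `|y t| - al * c.
have dl0 : 0 < dl by rewrite subr_gt0.
have cexp : C0 (fun s => expR (be * s) : R^o) := has_deriv0_C0 (has_deriv0_exp be).
have wbound (V : normedModType R) (f : R -> V) (T0 : R) : C0 f ->
    exists M, forall s : R, 0 <= s -> s <= T0 -> expR (be * s) * `|f s| <= M.
  move=> cf; have [M HM] := C0_bounded T0 (C0Z cexp cf); exists M => s s0 sT.
  by have := HM s s0 sT; rewrite normrZ (gtr0_norm (expR_gt0 _)).
(* [m k] bounds everything that earlier copies can contribute up to the time [(k + 1) t] at which
   the [k]-th copy is examined. *)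
have mex (k : nat) : exists m : R, 0 <= m /\ forall s : R, 0 <= s -> s <= k.+1%:R * t ->
    [/\ expR (be * s) * `|u s| <= m, expR (be * s) * `|u' s| <= m & expR (be * s) * `|y s| <= m].
  have [m1 H1] := wbound _ _ (k.+1%:R * t) cu.
  have [m2 H2] := wbound _ _ (k.+1%:R * t) cu'.
  have [m3 H3] := wbound _ _ (k.+1%:R * t) cy.
  exists (Num.max 0 (Num.max m1 (Num.max m2 m3))); split; first by rewrite le_max lexx.
  by move=> s s0 sk; split; rewrite !le_max ?H1 ?H2 ?H3 ?orbT.
have [m Hm] := choice mex.
have m0 k : 0 <= m k by case: (Hm k).
(* Partial sums of the weights [a k]. They are chosen so that the excess [a k * dl] of the [k]-th
   copy outweighs the earlier copies on both sides of the inequality, [(1 + al) * m k * sg k], and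
   leaves [k]. *)
pose sg := fix sg (k : nat) : R := if k is k'.+1 then sg k' + ((1 + al) * m k' * sg k' + k'%:R) / dl else 0.
have sg0 k : 0 <= sg k.
  elim: k => //= k IH; rewrite addr_ge0 // divr_ge0 ?(ltW dl0) // addr_ge0 // !mulr_ge0 //; lra.
pose a k := sg k.+1 - sg k.
have aE k : a k * dl = (1 + al) * m k * sg k + k%:R.
  by rewrite /a /= addrAC subrr add0r divfK // gt_eqF.
have a0 k : 0 <= a k.
  by rewrite /a /= addrAC subrr add0r divr_ge0 ?(ltW dl0) // addr_ge0 // !mulr_ge0 //; lra.
have ssum k : sg k = \sum_(j < k) a j.
  by elim: k => [|k IH]; rewrite ?big_ord0 // big_ord_recr /= -IH /a addrC subrK.
(* The factor offsets the growth of the weight [e^{be s}] caused by the delay [k t]. *)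
pose la k := a k * expR (- (be * (k%:R * t))).
have laE k : la k * expR (be * (k%:R * t)) = a k.
  by rewrite /la -mulrA -expRD addNr expR0 mulr1.
have la0 k : 0 <= la k by rewrite mulr_ge0 // expR_ge0.
pose F (V : normedModType R) (f : R -> V) (k : nat) (r : R) : V :=
  \sum_(j < k) la j *: delay (j%:R * t) f r.
have FS V f k r : F V f k.+1 r = la k *: delay (k%:R * t) f r + F V f k r.
  by rewrite /F big_ord_recr /= addrC.
have Fext V f (k k' : nat) r : r <= k%:R * t -> (k <= k')%N -> F V f k' r = F V f k r.
  move=> rk; elim: k' => [|k' IH]; first by rewrite leqn0 => /eqP ->.
  rewrite leq_eqVlt => /orP[/eqP-> //|]; rewrite ltnS => kk'; rewrite FS IH //.
  by rewrite /delay ifT ?scaler0 ?add0r // (le_trans rk) // ler_pM2r // ler_nat.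
pose N (r : R) := (Num.truncn (r / t)).+1.
have rN r : r <= (N r)%:R * t by rewrite -ler_pdivrMr //; exact/ltW/truncnS_gt.
(* The infinite superposition: the [k]-th copy starts at [k t], so the series is locally finite and
   [G] agrees with a partial sum on each bounded interval. *)
pose G (V : normedModType R) (f : R -> V) (r : R) : V := F V f (N r) r.
have GE V f (k : nat) r : r <= k%:R * t -> G V f r = F V f k r.
  move=> rk; have [h|h] := leqP k (N r); first exact: Fext.
  by apply/esym/Fext; [exact: rN|exact: ltnW].
have SF k : Sys A D B C (F U u k) (F X x k) (F Y y k).
  elim: k => [|k IH].
    have Z V f : F V f 0%N = fun=> 0 by apply/funext => r; rewrite /F big_ord0.
    rewrite !Z; apply: (@Sys_intro _ _ (fun=> 0)) => //; try exact: C0_cst.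
    - exact: has_deriv0_cst.
    - by move=> r _; rewrite A0 (bounded_lin0 bB) addr0.
  have E1 V f : F V f k.+1 = fun r => la k *: delay (k%:R * t) f r + F V f k r.
    by apply/funext => r; rewrite FS.
  by rewrite !E1; apply: Sys_lin => //; apply: Sys_delay.
have dF k : has_deriv0 (F U u k) (F U u' k) /\ C0 (F U u' k).
  elim: k => [|k [IH1 IH2]].
    have Z V f : F V f 0%N = fun=> 0 by apply/funext => r; rewrite /F big_ord0.
    by rewrite !Z; split; [exact: has_deriv0_cst|exact: C0_cst].
  have E1 V f : F V f k.+1 = fun r => la k *: delay (k%:R * t) f r + F V f k r.
    by apply/funext => r; rewrite FS.
  rewrite !E1; split.
    by apply: has_deriv0D => //; apply: has_deriv0Zc; exact: has_deriv0_delay.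
  by apply: C0D => //; apply: C0Zc; exact: C0_delay.
have rT (T0 r : R) : r <= T0 -> r <= (N T0)%:R * t by move=> h; exact: le_trans h (rN T0).
have SGG : Sys A D B C (G U u) (G X x) (G Y y).
  apply: (@Sys_intro _ _ (fun r => A (G X x r) + B (G U u r))).
  - apply: C0_local => T0; exists (F U u (N T0)); first by case: (Sys_elim (SF (N T0))).
    by move=> r r0 rT0; apply: GE; exact: rT.
  - move=> r r0; rewrite (GE _ _ (N r)) //.
    by have [_ _ H _ _] := Sys_elim (SF (N r)); exact: H.
  - apply: has_deriv0_local => T0; have [_ _ _ _ [dd _]] := Sys_elim (SF (N T0)).
    exists (F X x (N T0)), (fun r => A (F X x (N T0) r) + B (F U u (N T0) r)); split => //.
    by move=> r r0 rT0; rewrite !(GE _ _ (N T0)) //; exact: rT.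
  - apply: C0_local => T0; have [c1 _ _ c2 _] := Sys_elim (SF (N T0)).
    exists (fun r => A (F X x (N T0) r) + B (F U u (N T0) r)).
      by apply: C0D => //; exact: C0_lin.
    by move=> r r0 rT0; rewrite !(GE _ _ (N T0)) //; exact: rT.
  - by [].
  - move=> r r0; rewrite !(GE _ _ (N r)) //.
    by have [_ _ _ _ [_ H]] := Sys_elim (SF (N r)); exact: H.
have CGG : C1 (G U u) (G U u').
  apply: C1_of.
    apply: has_deriv0_local => T0; exists (F U u (N T0)), (F U u' (N T0)); split; first by case: (dF (N T0)).
    by move=> r r0 rT0; rewrite !(GE _ _ (N T0)) //; exact: rT.
  apply: C0_local => T0; exists (F U u' (N T0)); first by case: (dF (N T0)).
  by move=> r r0 rT0; apply: GE; exact: rT.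
pose bb := b (G U u) (G X x) (G Y y).
(* The offset [bb] of the superposition is a fixed number, and the copy with [k > bb] contradicts
   it. *)
pose k := (Num.truncn bb).+1.
have kb : bb < k%:R by exact: truncnS_gt.
pose Tk := k.+1%:R * t.
have TkE : Tk = k%:R * t + t by rewrite /Tk -natr1 mulrDl mul1r.
have kt0 : 0 <= k%:R * t by rewrite mulr_ge0.
have Tk0 : 0 <= Tk by rewrite TkE; lra.
have Fb (V : normedModType R) (f : R -> V) (M : R) : 0 <= M ->
    (forall s : R, 0 <= s -> s <= Tk -> expR (be * s) * `|f s| <= M) ->
    forall r : R, 0 <= r -> r <= Tk -> expR (be * r) * `|F V f k r| <= sg k * M.
  move=> M0 HM r r0 rTk.
  apply: (@le_trans _ _ (expR (be * r) * \sum_(j < k) `|la j *: delay (j%:R * t) f r|)).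
    by rewrite ler_wpM2l ?expR_ge0 // ler_norm_sum.
  rewrite mulr_sumr ssum mulr_suml; apply: ler_sum => j _.
  rewrite normrZ (ger0_norm (la0 j)) /delay; case: (leP r (j%:R * t)) => h.
    by rewrite normr0 !mulr0 mulr_ge0.
  have -> : expR (be * r) = expR (be * (j%:R * t)) * expR (be * (r - j%:R * t)).
    by rewrite -expRD -mulrDr [_ + (r - _)]addrC subrK.
  have -> : expR (be * (j%:R * t)) * expR (be * (r - j%:R * t)) * (la j * `|f (r - j%:R * t)|) =
    la j * expR (be * (j%:R * t)) * (expR (be * (r - j%:R * t)) * `|f (r - j%:R * t)|) by ring.
  have jt0 : 0 <= j%:R * t by rewrite mulr_ge0.
  by rewrite laE ler_wpM2l //; apply: HM; lra.
have Gb (V : normedModType R) (f : R -> V) :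
    (forall s : R, 0 <= s -> s <= Tk -> expR (be * s) * `|f s| <= m k) ->
    (forall s : R, 0 <= s -> s <= t -> expR (be * s) * `|f s| <= c) ->
    forall r : R, 0 <= r -> r <= Tk -> expR (be * r) * `|G V f r| <= sg k * m k + a k * c.
  move=> HM Hc' r r0 rTk; rewrite (GE _ _ k.+1) // FS addrC.
  apply: (@le_trans _ _ (expR (be * r) * (`|F V f k r| + `|la k *: delay (k%:R * t) f r|))).
    by rewrite ler_wpM2l ?expR_ge0 // ler_normD.
  rewrite mulrDr; apply: lerD; first exact: Fb.
  rewrite normrZ (ger0_norm (la0 k)) /delay; case: (leP r (k%:R * t)) => h.
    by rewrite normr0 !mulr0 mulr_ge0.
  have -> : expR (be * r) = expR (be * (k%:R * t)) * expR (be * (r - k%:R * t)).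
    by rewrite -expRD -mulrDr [_ + (r - _)]addrC subrK.
  have -> : expR (be * (k%:R * t)) * expR (be * (r - k%:R * t)) * (la k * `|f (r - k%:R * t)|) =
    la k * expR (be * (k%:R * t)) * (expR (be * (r - k%:R * t)) * `|f (r - k%:R * t)|) by ring.
  by rewrite laE ler_wpM2l //; apply: Hc'; rewrite TkE in rTk; lra.
have := Hb _ _ _ _ SGG CGG Tk Tk0; rewrite -/bb => Hfin.
have supb (f : R -> U) :
    (forall r : R, 0 <= r -> r <= Tk -> expR (be * r) * `|f r| <= sg k * m k + a k * c) ->
    sup [set `|expR (be * s) *: f s| | s in `[0, Tk]] <= sg k * m k + a k * c.
  move=> Hf; apply: ge_sup.
    by exists `|expR (be * 0) *: f 0|; exists 0 => //=; rewrite in_itv /= lexx.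
  move=> z [s]; rewrite /= in_itv /= => /andP[s0 sT] <-.
  by rewrite normrZ (gtr0_norm (expR_gt0 _)); exact: Hf.
have sup_le : sup_C1_weighted be (G U u) (G U u') Tk <= sg k * m k + a k * c.
  rewrite /sup_C1_weighted ge_max; apply/andP; split; apply: supb; apply: Gb.
  - by move=> s s0 sT; have [_ /(_ s s0 sT)[]] := Hm k.
  - by move=> s s0 st; case: (Hc s s0 st).
  - by move=> s s0 sT; have [_ /(_ s s0 sT)[]] := Hm k.
  - by move=> s s0 st; case: (Hc s s0 st).
(* At [Tk = (k + 1) t] the [k]-th copy shows the offending value [y t]; later copies have not
   started. *)
have low : a k * (expR (be * t) * `|y t|) - sg k * m k <= `|expR (be * Tk) *: G Y y Tk|.
  rewrite normrZ (gtr0_norm (expR_gt0 _)) (GE _ _ k.+1) // FS.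
  have -> : delay (k%:R * t) y Tk = y t.
    rewrite /delay TkE ifN; last by rewrite -ltNge; lra.
    by rewrite addrAC subrr add0r.
  have Hy : expR (be * Tk) * `|F Y y k Tk| <= sg k * m k.
    by apply: Fb => // s s0 sT; have [_ /(_ s s0 sT)[]] := Hm k.
  have : `|la k *: y t| - `|F Y y k Tk| <= `|la k *: y t + F Y y k Tk|.
    by rewrite -[F Y y k Tk]opprK; rewrite normrN; exact: lerB_dist || exact: lerB_normD.
  rewrite -(ler_pM2l (expR_gt0 (be * Tk))) mulrBr => H; apply: le_trans H.
  rewrite normrZ (ger0_norm (la0 k)).
  have -> : expR (be * Tk) * (la k * `|y t|) = a k * (expR (be * t) * `|y t|).
    have -> : expR (be * Tk) = expR (be * (k%:R * t)) * expR (be * t) by rewrite TkE mulrDr expRD.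
    by rewrite -(laE k); ring.
  lra.
have {Hfin sup_le} Hfin : a k * (expR (be * t) * `|y t|) - sg k * m k <= al * (sg k * m k + a k * c) + bb.
  apply: (le_trans low); apply: (le_trans Hfin); rewrite lerD2r; exact: ler_wpM2l.
have Ey : expR (be * t) * `|y t| = dl + al * c by rewrite /dl subrK.
have := aE k; rewrite Ey in Hfin; move: Hfin kb; clear.
move: (a k) (sg k) (m k) (k%:R) => p q r s; lra.
Qed.
End SysTheory.

Lemma exp_weight_le1 (R : realType) (be b s : R) : be <= b -> 0 <= s ->
  expR (be * s) * expR (- (b * s)) <= 1.
Proof. by move=> bb s0; rewrite -expRD -[leRHS]expR0 ler_expR subr_le0 ler_wpM2r. Qed.

Lemma ler_normD3 (R : realType) (V : normedModType R) (x y z : V) : `|x + y + z| <= `|x| + `|y| + `|z|.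
Proof. by apply: (le_trans (ler_normD _ _)); rewrite lerD2r ler_normD. Qed.

Lemma ler_normB3 (R : realType) (V : normedModType R) (x y z : V) : `|x - y - z| <= `|x| + `|y| + `|z|.
Proof. by apply: (le_trans (ler_normD3 _ _ _)); rewrite !normrN. Qed.

(** * The gain inequality for arbitrary initial data *)

Section Gain.
Variables (R : realType) (U Y : normedModType R) (X : completeNormedModType R).
Variables (A : X -> X) (D : set X) (B : U -> X) (C : X -> Y) (T : R -> X -> X).
Hypothesis SG : semigroup_gen A D T.
Hypothesis bB : bounded_lin B.
Hypothesis gC : graph_bounded A D C.
Variables (M b : R).
Hypothesis M0 : 0 <= M.
Hypothesis HM : forall (t : R) x, 0 <= t -> `|T t x| <= M * expR (- (b * t)) * `|x|.

Lemma graph_bound_pos : exists2 K : R, 0 <= K & forall x, D x -> `|C x| <= K * (`|x| + `|A x|).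
Proof.
have [_ [K HK]] := gC; exists `|K| => // x Dx; apply: (le_trans (HK x Dx)).
by rewrite ler_wpM2r ?addr_ge0 // ler_norm.
Qed.

(* The hypotheses say that [L = - (A + l)^-1]. *)
Lemma Sys_exp_input (l : R) (L : X -> X) (g : U) : (forall x, D (L x)) ->
  (forall x, A (L x) = - (l *: L x) - x) ->
  Sys A D B C (fun t => expR (- l * t) *: g) (fun t => expR (- l * t) *: L (B g))
    (fun t => expR (- l * t) *: C (L (B g))).
Proof.
move=> DL AL.
have cexp : C0 (fun s => expR (- l * s) : R^o) := has_deriv0_C0 (has_deriv0_exp (- l)).
have dexp := has_deriv0_exp (- l).
apply: (Sys_intro SG bB gC (x' := fun t => (- l * expR (- l * t)) *: L (B g))).
- by apply: C0Z => //; exact: C0_cst.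
- by move=> t t0; case: (DomZ SG (expR (- l * t)) (DL (B g))).
- have := has_deriv0Z dexp (has_deriv0_cst (L (B g))).
  by apply: has_deriv0_ext => // t _; rewrite scaler0 addr0.
- apply: C0Z; last exact: C0_cst.
  have := C0Zc (- l) cexp; exact.
- move=> t t0; have [_ ->] := DomZ SG (expR (- l * t)) (DL (B g)).
  by rewrite AL (bounded_linZ _ _ bB); linear_comb R.
- move=> t t0; have [lC _] := gC; have [D0 _] := Dom0 SG.
  have C00 : C 0 = 0 by have := lC (-1) _ _ D0 D0; rewrite scaler0 addr0 scaleN1r addNr.
  by have := lC (expR (- l * t)) _ _ (DL (B g)) D0; rewrite !addr0 C00 addr0 => ->.
Qed.

(** Subtracting two exponential solutions and a free orbit leaves a trajectory with zero state,
    input and input derivative at time 0, to which [io_bound_zero_state] applies. What was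
    subtracted is bounded by the initial data in the graph norm, so the constant [al] in front of
    [c] is kept. *)
Lemma graph_gain (be al : R) : 0 < be -> 2 * be < b -> 0 <= al ->
  io_bound (Sys A D B C) be al ->
  exists2 K : R, 0 <= K & forall u u' q d (t c : R), Sys A D B C u q d -> C1 u u' -> 0 <= t ->
    (forall s : R, 0 <= s -> s <= t -> expR (be * s) * `|u s| <= c /\ expR (be * s) * `|u' s| <= c) ->
    expR (be * t) * `|d t| <= al * c + K * (`|q 0| + `|A (q 0)| + `|u 0| + `|u' 0|).
Proof.
move=> be0 be2 al0 Hio.
have bb1 : be < b by lra.
have be12 : 0 <= 1 + 2 * be by lra.
have be20 : 0 <= 2 * be by lra.
have be2be : be <= 2 * be by lra.
have sum_u (x y z c g1 g2 : R) : 0 <= g1 -> 0 <= g2 -> x <= c -> y = g1 -> z <= g2 ->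
    x + y + z <= c + (1 + 2 * be) * (g1 + g2).
  move=> g10 g20; have : 0 <= be * (g1 + g2) by rewrite mulr_ge0 ?addr_ge0 // ltW.
  by rewrite mulrDl mul1r -mulrA; lra.
have sum_u' (x y z c g1 g2 : R) : 0 <= g1 -> 0 <= g2 -> x <= c -> y = g1 -> z <= g2 ->
    x + be * y + 2 * be * z <= c + (1 + 2 * be) * (g1 + g2).
  move=> g10 g20 xc -> zg; have : 0 <= be * g1 by rewrite mulr_ge0 // ltW.
  have : 2 * be * z <= 2 * be * g2 by rewrite ler_wpM2l.
  by lra.
have sum_r (k l x y q0 a0 v v' l1 l2 a1 a2 g1 g2 : R) : x <= q0 + l1 + l2 -> y <= a0 + a1 + a2 ->
    l1 <= k * g1 -> l2 <= k * g2 -> a1 <= l * g1 -> a2 <= l * g2 -> 0 <= v -> 0 <= v' ->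
    x + y <= q0 + a0 + v + v' + (k + l) * (g1 + g2).
  by move=> *; rewrite mulrDl !mulrDr; lra.
have sum_g (k N g1 g2 : R) : g1 <= k * N -> g2 <= k * N -> g1 + g2 <= 2 * k * N by move=> *; lra.
have sum_d (a a' p1 w1 p2 z1 z2 z2' f f' h : R) : a <= a' -> a' <= p1 + h -> w1 <= f' -> z1 <= f -> z2 <= z2' ->
    z2' <= f -> a + (w1 + z1 + z2) <= p1 + (h + 2 * f + f') by move=> *; lra.
(* Two exponents, [be] and [2 be], since both [u 0] and [u' 0] have to be matched. Both are below
   the decay rate [b], and [e^{- be t}] and [e^{- 2 be t}] stay bounded under the weight
   [e^{be t}]. *)
have [L1 [bL1 DL1 AL1 _]] := resolvent_exists SG M0 HM bb1.
have [L2 [bL2 DL2 AL2 _]] := resolvent_exists SG M0 HM be2.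
have [Kb Kb0 HKb] := bounded_lin_bound bB.
have [r1 r10 Hr1] := bounded_lin_bound bL1.
have [r2 r20 Hr2] := bounded_lin_bound bL2.
have [Kc Kc0 HKc] := graph_bound_pos.
pose kg := 2 + be^-1.
have kg0 : 0 < kg by rewrite addr_gt0 // invr_gt0.
pose kL := (r1 + r2) * Kb.
have kL0 : 0 <= kL by rewrite mulr_ge0 ?addr_ge0 // ltW.
pose kA := 2 * be * kL + Kb.
have kA0 : 0 <= kA by rewrite addr_ge0 ?(ltW Kb0) // mulr_ge0 //; lra.
pose K := al * ((1 + 2 * be) * (2 * kg)) + 2 * (Kc * (kL + kA) * kg) + Kc * M * (1 + (kL + kA) * (2 * kg)).
have kS0 : 0 <= kL + kA by exact: addr_ge0.
have kg20 : 0 <= 2 * kg by lra.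
exists K.
  have k1 : 0 <= al * ((1 + 2 * be) * (2 * kg)) by exact: mulr_ge0 al0 (mulr_ge0 be12 kg20).
  have k2 : 0 <= Kc * (kL + kA) * kg by exact: mulr_ge0 (mulr_ge0 Kc0 kS0) (ltW kg0).
  have k3 : 0 <= Kc * M * (1 + (kL + kA) * (2 * kg)).
    by apply: mulr_ge0 (mulr_ge0 Kc0 M0) _; apply: addr_ge0 => //; exact: mulr_ge0.
  exact: addr_ge0 (addr_ge0 k1 (mulr_ge0 (ler0n _ 2) k2)) k3.
move=> u u' q d t c S C1u t0 Hc.
set N0 := `|q 0| + `|A (q 0)| + `|u 0| + `|u' 0|.
have [cu cy Dq cA [dq E]] := Sys_elim S.
(* The solution of [g1 + g2 = u 0] and [be g1 + 2 be g2 = - u' 0], so that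
   [u - e^{- be t} g1 - e^{- 2 be t} g2] vanishes to first order at 0. *)
pose g2 := - (u 0 + be^-1 *: u' 0); pose g1 := u 0 - g2.
have q0 := normr_ge0 (q 0); have Aq0 := normr_ge0 (A (q 0)).
have nu0 := normr_ge0 (u 0); have nu'0 := normr_ge0 (u' 0).
have ibe : 0 < be^-1 by rewrite invr_gt0.
have N00 : 0 <= N0 by rewrite /N0; lra.
have Hg2 : `|g2| <= kg * N0.
  rewrite /g2 normrN; apply: (le_trans (ler_normD _ _)); rewrite normrZ (gtr0_norm ibe).
  by rewrite /kg /N0; nra.
have Hg1 : `|g1| <= kg * N0.
  have -> : g1 = 2 *: u 0 + be^-1 *: u' 0 by rewrite /g1 /g2; linear_comb R.
  apply: (le_trans (ler_normD _ _)); rewrite !normrZ (gtr0_norm ibe) (gtr0_norm (ltr0Sn _ 1)).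
  by rewrite /kg /N0; nra.
have HL (L : X -> X) (r l : R) (g : U) : (forall x, `|L x| <= r * `|x|) -> 0 <= r -> r <= r1 + r2 -> 0 <= l ->
    l <= 2 * be -> (forall x, A (L x) = - (l *: L x) - x) ->
    `|L (B g)| <= kL * `|g| /\ `|A (L (B g))| <= kA * `|g|.
  move=> Hr rp rr l0 lb AL.
  have h1 : `|L (B g)| <= kL * `|g|.
    apply: (le_trans (Hr _)); rewrite /kL -mulrA; apply: ler_pM => //; exact: HKb.
  split => //; rewrite AL; apply: (le_trans (ler_normB _ _)); rewrite normrN normrZ (ger0_norm l0).
  rewrite /kA mulrDl; apply: lerD; last exact: HKb.
  by rewrite -mulrA; apply: ler_pM.
have r1s : r1 <= r1 + r2 by rewrite lerDl ltW.
have r2s : r2 <= r1 + r2 by rewrite lerDr ltW.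
have [l1a l1b] := HL L1 r1 be g1 Hr1 (ltW r10) r1s (ltW be0) be2be AL1.
have [l2a l2b] := HL L2 r2 (2 * be) g2 Hr2 (ltW r20) r2s be20 (lexx _) AL2.
pose r := q 0 - L1 (B g1) - L2 (B g2).
have [Dr1 Ar1] := DomB SG (Dq 0 (lexx 0)) (DL1 (B g1)).
have [Dr Ar] := DomB SG Dr1 (DL2 (B g2)).
have S1 := Sys_exp_input g1 DL1 AL1.
have S2 := Sys_exp_input g2 DL2 AL2.
have S3 := Sys_orbit SG bB gC Dr.
have Sh := Sys_lin SG bB gC (-1) S3 (Sys_lin SG bB gC (-1) S2 (Sys_lin SG bB gC (-1) S1 S)).
pose uh' t := u' t + (be * expR (- be * t)) *: g1 + (2 * be * expR (- (2 * be) * t)) *: g2.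
have [_ [du cu']] := C1u.
have cexp (l : R) : C0 (fun s => l * expR (- l * s) : R^o).
  have := C0Zc l (has_deriv0_C0 (has_deriv0_exp (- l))); exact.
have Ch : C1 (fun t => -1 *: (0 : U) + (-1 *: (expR (- (2 * be) * t) *: g2) + (-1 *: (expR (- be * t) *: g1) + u t))) uh'.
  apply: C1_of.
    have D1 := has_deriv0Z (has_deriv0_exp (- be)) (has_deriv0_cst g1).
    have D2 := has_deriv0Z (has_deriv0_exp (- (2 * be))) (has_deriv0_cst g2).
    have := has_deriv0D (has_deriv0Zc (-1) (has_deriv0_cst (0 : U))) (has_deriv0D (has_deriv0Zc (-1) D2) (has_deriv0D (has_deriv0Zc (-1) D1) du)).
    apply: has_deriv0_ext => // s _; rewrite /uh'; linear_comb R.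
  by apply: C0D; [apply: C0D|] => //; apply: C0Z => //; exact: C0_cst.
have e0 (l : R) : expR (- l * 0) = 1 by rewrite mulr0 expR0.
pose ch := c + (1 + 2 * be) * (`|g1| + `|g2|).
have ng1 := normr_ge0 g1; have ng2 := normr_ge0 g2.
have Hz := io_bound_zero_state (t := t) (c := ch) SG bB gC (ltW be0) al0 Hio Sh Ch.
have {}Hz : expR (be * t) * `|-1 *: C (T t r) + (-1 *: (expR (- (2 * be) * t) *: C (L2 (B g2))) + (-1 *: (expR (- be * t) *: C (L1 (B g1))) + d t))| <= al * ch.
  apply: Hz => //.
  - by rewrite (sg0 SG) !e0 /r; linear_comb R.
  - by rewrite !e0 /g1; linear_comb R.
  - have be_n0 : be != 0 by rewrite gt_eqF.
    rewrite /uh' !e0 /g1 /g2 !mulr1.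
    have -> : u' 0 + be *: (u 0 - - (u 0 + be^-1 *: u' 0)) + (2 * be) *: - (u 0 + be^-1 *: u' 0) =
       (1 - be / be) *: u' 0 by linear_comb R.
    by rewrite divff // subrr scale0r.
  - move=> s s0 st; have [h1 h2] := Hc s s0 st.
    have Es : 0 < expR (be * s) := expR_gt0 _.
    have E1 : expR (be * s) * expR (- be * s) = 1 by rewrite -expRD mulNr subrr expR0.
    have E2 : expR (be * s) * expR (- (2 * be) * s) <= 1.
      by rewrite mulNr exp_weight_le1.
    have E3 := expR_ge0 (- (2 * be) * s); have E4 := expR_ge0 (- be * s).
    have w1 : expR (be * s) * `|expR (- be * s) *: g1| = `|g1|.
      by rewrite normrZ (ger0_norm E4) mulrA E1 mul1r.
    have w2 : expR (be * s) * `|expR (- (2 * be) * s) *: g2| <= `|g2|.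
      by rewrite normrZ (ger0_norm E3) mulrA ler_piMl.
    split.
      have -> : -1 *: 0 + (-1 *: (expR (- (2 * be) * s) *: g2) + (-1 *: (expR (- be * s) *: g1) + u s)) =
        u s - expR (- be * s) *: g1 - expR (- (2 * be) * s) *: g2 by linear_comb R.
      have := ler_normB3 (u s) (expR (- be * s) *: g1) (expR (- (2 * be) * s) *: g2).
      rewrite -(ler_pM2l Es) !mulrDr => n3; apply: (le_trans n3); exact: sum_u.
    rewrite /uh' -[(be * _) *: g1]scalerA -[(2 * be * _) *: g2]scalerA.
    have := ler_normD3 (u' s) (be *: (expR (- be * s) *: g1)) ((2 * be) *: (expR (- (2 * be) * s) *: g2)).
    rewrite (normrZ be) (gtr0_norm be0) (normrZ (2 * be)) (ger0_norm be20).
    rewrite -(ler_pM2l Es) !mulrDr [expR (be * s) * (be * _)]mulrCA [expR (be * s) * (2 * be * _)]mulrCA => n3.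
    apply: (le_trans n3); exact: sum_u'.
set w1 := C (L1 (B g1)) in Hz *; set w2 := C (L2 (B g2)) in Hz *.
have W1 : `|w1| <= Kc * (kL + kA) * `|g1|.
  apply: (le_trans (HKc _ (DL1 _))); rewrite -mulrA ler_wpM2l // mulrDl; exact: lerD.
have W2 : `|w2| <= Kc * (kL + kA) * `|g2|.
  apply: (le_trans (HKc _ (DL2 _))); rewrite -mulrA ler_wpM2l // mulrDl; exact: lerD.
have Et : 0 < expR (be * t) := expR_gt0 _.
have E1 : expR (be * t) * expR (- be * t) = 1 by rewrite -expRD mulNr subrr expR0.
have E2 : expR (be * t) * expR (- (2 * be) * t) <= 1 by rewrite mulNr exp_weight_le1.
have E5 : expR (be * t) * expR (- (b * t)) <= 1 by rewrite exp_weight_le1 // ltW.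
have E3 := expR_ge0 (- (2 * be) * t); have E4 := expR_ge0 (- be * t).
have WT : expR (be * t) * `|C (T t r)| <= Kc * M * (`|r| + `|A r|).
  have [DTr ATr] := orbit_Dom SG t0 Dr.
  apply: (@le_trans _ _ (expR (be * t) * (Kc * (M * expR (- (b * t)) * (`|r| + `|A r|))))).
    rewrite ler_wpM2l ?(ltW Et) //; apply: (le_trans (HKc _ DTr)); rewrite ler_wpM2l //.
    by rewrite mulrDr ATr; apply: lerD; exact: HM.
  have -> : expR (be * t) * (Kc * (M * expR (- (b * t)) * (`|r| + `|A r|))) =
    (expR (be * t) * expR (- (b * t))) * (Kc * M * (`|r| + `|A r|)) by ring.
  by rewrite ler_piMl // mulr_ge0 ?mulr_ge0 // addr_ge0.
have Hr : `|r| + `|A r| <= N0 + (kL + kA) * (`|g1| + `|g2|).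
  rewrite Ar Ar1 /r.
  exact: sum_r (ler_normB3 _ _ _) (ler_normB3 _ _ _) l1a l2a l1b l2b nu0 nu'0.
have Ed : d t = (-1 *: C (T t r) + (-1 *: (expR (- (2 * be) * t) *: w2) + (-1 *: (expR (- be * t) *: w1) + d t)))
   + (C (T t r) + expR (- be * t) *: w1 + expR (- (2 * be) * t) *: w2) by linear_comb R.
have final : `|d t| <= `|-1 *: C (T t r) + (-1 *: (expR (- (2 * be) * t) *: w2) + (-1 *: (expR (- be * t) *: w1) + d t))|
   + (`|C (T t r)| + `|expR (- be * t) *: w1| + `|expR (- (2 * be) * t) *: w2|).
  rewrite {1}Ed; apply: (le_trans (ler_normD _ _)); rewrite lerD2l.
  exact: ler_normD3.
rewrite -(ler_pM2l Et) !mulrDr in final; apply: (le_trans final).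
have v1 : expR (be * t) * `|expR (- be * t) *: w1| = `|w1|.
  by rewrite normrZ (ger0_norm E4) mulrA E1 mul1r.
have v2 : expR (be * t) * `|expR (- (2 * be) * t) *: w2| <= `|w2|.
  by rewrite normrZ (ger0_norm E3) mulrA ler_piMl.
rewrite v1.
have G12 : `|g1| + `|g2| <= 2 * kg * N0 by exact: sum_g.
have F1 : al * ch <= al * c + al * ((1 + 2 * be) * (2 * kg)) * N0.
  by rewrite /ch mulrDr lerD2l -mulrA ler_wpM2l // -mulrA ler_wpM2l.
have Kp : 0 <= Kc * (kL + kA) by rewrite mulr_ge0 // addr_ge0.
have F2 : `|w1| <= Kc * (kL + kA) * kg * N0 by apply: (le_trans W1); rewrite -[leRHS]mulrA ler_wpM2l.
have F3 : `|w2| <= Kc * (kL + kA) * kg * N0 by apply: (le_trans W2); rewrite -[leRHS]mulrA ler_wpM2l.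
have F4 : Kc * M * (`|r| + `|A r|) <= Kc * M * (1 + (kL + kA) * (2 * kg)) * N0.
  rewrite -[leRHS]mulrA ler_wpM2l ?mulr_ge0 //; apply: (le_trans Hr); rewrite [leRHS]mulrDl mul1r lerD2l.
  by rewrite -[leRHS]mulrA ler_wpM2l // addr_ge0.
have -> : K * N0 = al * ((1 + 2 * be) * (2 * kg)) * N0 + 2 * (Kc * (kL + kA) * kg * N0) + Kc * M * (1 + (kL + kA) * (2 * kg)) * N0.
  by rewrite /K; ring.
set f1 := al * _ * N0 in F1 *; set f := Kc * _ * kg * N0 in F2 F3 *; set f4 := Kc * M * _ * N0 in F4 *.
have := sum_d _ _ (al * c) _ 0 _ _ _ f f4 f1 Hz F1 (le_trans WT F4) F2 v2 F3.
exact.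
Qed.

(* On [0, t] the ratio [e^{(be - be') s}] of the two weights is largest at the end point. *)
Lemma io_bound_slower (be be' al : R) : 0 < be' -> be' <= be -> 0 <= al ->
  io_bound (Sys A D B C) be al -> io_bound (Sys A D B C) be' al.
Proof.
move=> be'0 bb al0 [f [f0 Hf]]; exists f; split => // u x y u' S C1u t t0.
have [cu [_ cu']] := C1u.
have := Hf u x y u' S C1u t t0.
have Et := expR_gt0 ((be - be') * t).
have wE (w : R -> R) r : expR (be * r) = expR ((be - be') * r) * expR (be' * r).
  by rewrite -expRD -mulrDl subrK.
rewrite !normrZ !(gtr0_norm (expR_gt0 _)) (wE id) -mulrA => H.
have ge1 : 1 <= expR ((be - be') * t) by rewrite -[leLHS]expR0 ler_expR mulr_ge0 // subr_ge0.
have sup_cmp (v : R -> U) : C0 v ->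
    sup [set `|expR (be * s) *: v s| | s in `[0, t]] <=
    expR ((be - be') * t) * sup [set `|expR (be' * s) *: v s| | s in `[0, t]].
  move=> cv; apply: ge_sup.
    by exists `|expR (be * 0) *: v 0|; exists 0 => //=; rewrite in_itv /= lexx.
  move=> z [s]; rewrite /= in_itv /= => /andP[s0 st] <-.
  apply: (@le_trans _ _ (expR ((be - be') * t) * `|expR (be' * s) *: v s|)).
    rewrite !normrZ !(gtr0_norm (expR_gt0 _)) (wE id) -mulrA ler_wpM2r ?mulr_ge0 ?expR_ge0 //.
    by rewrite ler_expR ler_wpM2l // subr_ge0.
  rewrite ler_pM2l //; apply: ub_le_sup; last by exists s => //=; rewrite in_itv /= s0.
  have cexp : C0 (fun s => expR (be' * s) : R^o) := has_deriv0_C0 (has_deriv0_exp be').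
  have [K HK] := C0_bounded t (C0Z cexp cv); exists K => z' [r].
  by rewrite /= in_itv /= => /andP[r0 rt] <-; exact: HK.
have mx : sup_C1_weighted be u u' t <= expR ((be - be') * t) * sup_C1_weighted be' u u' t.
  rewrite /sup_C1_weighted ge_max; apply/andP; split.
    by apply: (le_trans (sup_cmp u cu)); rewrite ler_pM2l // le_max lexx.
  by apply: (le_trans (sup_cmp u' cu')); rewrite ler_pM2l // le_max lexx orbT.
rewrite -(ler_pM2l Et); apply: (le_trans H); rewrite mulrDr; apply: lerD.
  by rewrite mulrCA ler_wpM2l.
by rewrite ler_peMl // f0.
Qed.
End Gain.

(** * Small-gain estimate for the closed loop *)

Lemma forced_weighted (R : realType) (V : completeNormedModType R) (A : V -> V) (D : set V)
    (T : R -> V -> V) (M b be c t : R) (x f : R -> V) : semigroup_gen A D T ->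
  (forall (t : R) x, 0 <= t -> `|T t x| <= M * expR (- (b * t)) * `|x|) -> 0 <= M ->
  be < b -> 0 <= t -> has_deriv0 x (fun s => A (x s) + f s) -> (forall s : R, 0 <= s -> D (x s)) ->
  (forall s : R, 0 <= s -> s <= t -> expR (be * s) * `|f s| <= c) ->
  expR (be * t) * `|x t| <= M * `|x 0| + c * (M / (b - be)).
Proof.
move=> SG HM M0 beb t0 dx Dx Hf.
have E (s : R) : expR (be * s) * expR (- (be * s)) = 1 by rewrite -expRD subrr expR0.
have Hf' (s : R) : 0 <= s -> s <= t -> `|f s| <= c * expR (- (be * s)).
  move=> s0 st; rewrite -(ler_pM2l (expR_gt0 (be * s))) mulrCA E mulr1; exact: Hf.
have := forced_estimate SG HM M0 beb t0 dx Dx (fun _ _ => erefl) Hf'.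
rewrite -(ler_pM2l (expR_gt0 (be * t))) => H; apply: (le_trans H).
rewrite mulrDr [X in _ + X]mulrCA E mulr1 lerD2r.
have -> : expR (be * t) * (M * expR (- (b * t)) * `|x 0|) = (expR (be * t) * expR (- (b * t))) * (M * `|x 0|) by ring.
by rewrite ler_piMl ?mulr_ge0 // exp_weight_le1 // ltW.
Qed.

Section ObserverLoop.
Variables (R : realType) (U Y : normedModType R) (n0 : nat) (AK AL : 'M[R]_n0).
Variables (BK : 'rV[R]_n0 -> 'rV[R]_n0) (K : 'rV[R]_n0 -> U) (L : Y -> 'rV[R]_n0).
Hypotheses (bBK : bounded_lin BK) (bK : bounded_lin K) (bL : bounded_lin L).

(** [x] is the unstable state and [e] the observer error, so the input is [K (x + e)]; [v] is the
    part of the measured error that [e] does not account for. *)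
Definition observer_loop (x e : R -> 'rV[R]_n0) (v : R -> Y) : Prop :=
  has_deriv0 x (fun t => x t *m AK + BK (e t)) /\ has_deriv0 e (fun t => e t *m AL + L (v t)).

(** The last two bounds concern the input [u = K (x + e)] and its derivative along the loop, the
    quantities that enter the IO-gain. *)
Definition loop_gain (k be : R) : Prop := forall (c t : R) x e v, observer_loop x e v ->
  (forall s : R, 0 <= s -> s <= t -> expR (be * s) * `|v s| <= c) ->
  forall s : R, 0 <= s -> s <= t ->
  [/\ expR (be * s) * `|x s| <= k * (c + (`|x 0| + `|e 0|)),
      expR (be * s) * `|e s| <= k * (c + (`|x 0| + `|e 0|)),
      expR (be * s) * `|K (x s + e s)| <= k * (c + (`|x 0| + `|e 0|)) &
      expR (be * s) * `|K (x s *m AK + BK (e s) + (e s *m AL + L (v s)))| <= k * (c + (`|x 0| + `|e 0|))].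

(** A cascade of two stable equations: [v] drives [e], and [e] drives [x]. One [k] has to serve all
    weights [be <= b], since [be] comes from a decomposition that is chosen only after [k]. *)
Lemma observer_loop_gain : stable_mx AK -> stable_mx AL -> exists k b : R, [/\ 0 <= k, 0 < b &
  forall be : R, 0 <= be -> be <= b -> loop_gain k be].
Proof.
move=> [MK [rK [MK0 rK0 HK]]] [ML [rL [ML0 rL0 HL]]].
have [nB nB0 HB] := bounded_lin_bound bBK.
have [nK nK0 HnK] := bounded_lin_bound bK.
have [nL nL0 HnL] := bounded_lin_bound bL.
have [aK aK0 HaK] := bounded_lin_bound (bounded_lin_mulmxr 1 AK).
have [aL aL0 HaL] := bounded_lin_bound (bounded_lin_mulmxr 1 AL).
(* Half the smaller decay rate: then [M / (r - be) <= M / (r / 2)] independently of [be]. *)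
pose b := Num.min rK rL / 2.
have b0 : 0 < b by rewrite divr_gt0 // lt_min rK0.
have bK2 : b <= rK / 2 by rewrite ler_pM2r ?invr_gt0 // ge_min lexx.
have bL2 : b <= rL / 2 by rewrite ler_pM2r ?invr_gt0 // ge_min lexx orbT.
have [k1 [k10 k1M k1g]] : exists k1, [/\ 0 <= k1, ML <= k1 & ML + nL * (ML / (rL / 2)) <= k1].
  exists (ML + nL * (ML / (rL / 2))); split=> //.
    by rewrite addr_ge0 // mulr_ge0 ?(ltW nL0) // divr_ge0 //; lra.
  by rewrite lerDl mulr_ge0 ?(ltW nL0) // divr_ge0 //; lra.
have [k2 [k20 k2g]] : exists k2, 0 <= k2 /\ MK + nB * k1 * (MK / (rK / 2)) <= k2.
  exists (MK + nB * k1 * (MK / (rK / 2))); split=> //.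
  apply: addr_ge0 => //; apply: mulr_ge0; first by rewrite mulr_ge0 // ltW.
  by rewrite divr_ge0 //; lra.
have [k3 [k30 k3g]] : exists k3, 0 <= k3 /\ nK * (k1 + k2) <= k3.
  by exists (nK * (k1 + k2)); split => //; rewrite mulr_ge0 ?addr_ge0 ?(ltW nK0).
have [k4 [k40 k4g]] : exists k4, 0 <= k4 /\ nK * (aK * k2 + nB * k1 + (aL * k1 + nL)) <= k4.
  exists (nK * (aK * k2 + nB * k1 + (aL * k1 + nL))); split => //.
  have := mulr_ge0 (ltW aK0) k20; have := mulr_ge0 (ltW nB0) k10; have := mulr_ge0 (ltW aL0) k10.
  by move=> *; rewrite mulr_ge0 ?(ltW nK0) //; lra.
exists (k1 + k2 + k3 + k4), b; split => //; first lra.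
move=> be be0 beb c t x e v [dx de] Hv s s0 st.
set N := `|x 0| + `|e 0|.
have nx := normr_ge0 (x 0); have ne := normr_ge0 (e 0).
have c0 : 0 <= c by apply: le_trans (Hv s s0 st); rewrite mulr_ge0 ?expR_ge0.
have cN : 0 <= c + N by rewrite /N; lra.
have gle (M r : R) : 0 <= M -> 0 < r -> be <= r / 2 -> M / (r - be) <= M / (r / 2).
  move=> M0 r0 br; rewrite ler_wpM2l // lef_pV2 ?posrE; lra.
have He (r : R) : 0 <= r -> r <= t -> expR (be * r) * `|e r| <= k1 * (c + N).
  move=> r0 rt.
  have Hf (w : R) : 0 <= w -> w <= r -> expR (be * w) * `|L (v w)| <= nL * c.
    move=> w0 wr; apply: (@le_trans _ _ (nL * (expR (be * w) * `|v w|))).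
      by rewrite mulrCA ler_wpM2l ?expR_ge0.
    by rewrite ler_pM2l // Hv // (le_trans wr).
  have := forced_weighted (f := fun w => L (v w)) (expm_semigroup AL) HL ML0 (_ : be < rL) r0 de (fun _ _ => I) Hf.
  have beL : be < rL by lra.
  move=> /(_ beL) H; apply: (le_trans H).
  have : nL * c * (ML / (rL - be)) <= nL * (ML / (rL / 2)) * c.
    rewrite mulrAC ler_wpM2r // ler_wpM2l ?(ltW nL0) // gle //; lra.
  have : (ML + nL * (ML / (rL / 2))) * c <= k1 * c by rewrite ler_wpM2r.
  have : ML * `|e 0| <= k1 * N.
    apply: ler_pM => //; rewrite /N; lra.
  have := mulr_ge0 ML0 c0.
  rewrite mulrDl [k1 * (c + N)]mulrDr; set g := ML / (rL / 2); set g' := ML / (rL - be).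
  by move: g g' => g g'; lra.
have Hx (r : R) : 0 <= r -> r <= t -> expR (be * r) * `|x r| <= k2 * (c + N).
  move=> r0 rt.
  have Hf (w : R) : 0 <= w -> w <= r -> expR (be * w) * `|BK (e w)| <= nB * (k1 * (c + N)).
    move=> w0 wr; apply: (@le_trans _ _ (nB * (expR (be * w) * `|e w|))).
      by rewrite mulrCA ler_wpM2l ?expR_ge0.
    by rewrite ler_pM2l // He // (le_trans wr).
  have := forced_weighted (f := fun w => BK (e w)) (expm_semigroup AK) HK MK0 (_ : be < rK) r0 dx (fun _ _ => I) Hf.
  have beL : be < rK by lra.
  move=> /(_ beL) H; apply: (le_trans H).
  have : nB * (k1 * (c + N)) * (MK / (rK - be)) <= nB * k1 * (MK / (rK / 2)) * (c + N).
    rewrite mulrA [leLHS]mulrAC ler_wpM2r // ler_wpM2l ?mulr_ge0 ?(ltW nB0) // gle //; lra.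
  have : (MK + nB * k1 * (MK / (rK / 2))) * (c + N) <= k2 * (c + N) by rewrite ler_wpM2r.
  have : MK * `|x 0| <= MK * (c + N) by rewrite ler_wpM2l // /N; lra.
  rewrite mulrDl; set g := MK / (rK / 2); set g' := MK / (rK - be).
  by move: g g' => g g'; lra.
have Es := expR_gt0 (be * s).
have kle (k : R) : 0 <= k -> k <= k1 + k2 + k3 + k4 -> k * (c + N) <= (k1 + k2 + k3 + k4) * (c + N).
  by move=> _ h; rewrite ler_wpM2r.
have {}He := He s s0 st; have {}Hx := Hx s s0 st; have {}Hv := Hv s s0 st.
have lin (W Z : normedModType R) (F : W -> Z) (a m : R) (z : W) : 0 <= a -> (forall z, `|F z| <= a * `|z|) ->
    expR (be * s) * `|z| <= m * (c + N) -> expR (be * s) * `|F z| <= a * m * (c + N).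
  move=> a0 Ha hz; apply: (@le_trans _ _ (a * (expR (be * s) * `|z|))).
    by rewrite mulrCA ler_wpM2l ?(ltW Es).
  by rewrite -mulrA ler_wpM2l.
have add (W : normedModType R) (z z' : W) (m m' : R) : expR (be * s) * `|z| <= m * (c + N) ->
    expR (be * s) * `|z'| <= m' * (c + N) -> expR (be * s) * `|z + z'| <= (m + m') * (c + N).
  move=> h h'; apply: (@le_trans _ _ (expR (be * s) * (`|z| + `|z'|))).
    by rewrite ler_wpM2l ?(ltW Es) // ler_normD.
  by rewrite mulrDr mulrDl lerD.
split.
- apply: (le_trans Hx); apply: kle => //; lra.
- apply: (le_trans He); apply: kle => //; lra.
- apply: (@le_trans _ _ (k3 * (c + N))); last by apply: kle => //; lra.
  apply: (@le_trans _ _ (nK * (k1 + k2) * (c + N))); last by rewrite ler_wpM2r.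
  by apply: (lin _ _ _ _ _ _ (ltW nK0) HnK); rewrite [k1 + k2]addrC; exact: add.
- apply: (@le_trans _ _ (k4 * (c + N))); last by apply: kle => //; lra.
  apply: (@le_trans _ _ (nK * (aK * k2 + nB * k1 + (aL * k1 + nL)) * (c + N))); last by rewrite ler_wpM2r.
  have Hv1 : expR (be * s) * `|v s| <= 1 * (c + N) by rewrite mul1r; rewrite /N; lra.
  have p1 := lin _ _ _ _ _ _ (ltW aK0) HaK Hx; have p2 := lin _ _ _ _ _ _ (ltW nB0) HB He.
  have p3 := lin _ _ _ _ _ _ (ltW aL0) HaL He; have p4 := lin _ _ _ _ _ _ (ltW nL0) HnL Hv1.
  rewrite mulr1 in p4.
  by apply: (lin _ _ _ _ _ _ (ltW nK0) HnK); exact: add _ _ _ _ _ (add _ _ _ _ _ p1 p2) (add _ _ _ _ _ p3 p4).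
Qed.
End ObserverLoop.

Section ClosedLoop.
Variables (R : realType) (U Y : normedModType R) (n0 n1 : nat) (AK AL : 'M[R]_n0) (A1 : 'M[R]_n1).
Variables (BK : 'rV[R]_n0 -> 'rV[R]_n0) (K : 'rV[R]_n0 -> U) (L : Y -> 'rV[R]_n0) (C1' : 'rV[R]_n1 -> Y).
Hypotheses (bBK : bounded_lin BK) (bK : bounded_lin K) (bL : bounded_lin L) (bC1 : bounded_lin C1').
Variables (X : completeNormedModType R) (A : X -> X) (D : set X) (B : U -> X) (C : X -> Y) (T : R -> X -> X).
Hypothesis SG : semigroup_gen A D T.
Hypothesis bB : bounded_lin B.
Hypothesis gC : graph_bounded A D C.
Variables (M b M1 b1 be al k : R).
Hypotheses (M0 : 0 <= M) (M10 : 0 <= M1) (be0 : 0 < be) (al0 : 0 <= al) (k0 : 0 <= k).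
Hypothesis HM : forall (t : R) x, 0 <= t -> `|T t x| <= M * expR (- (b * t)) * `|x|.
Hypothesis HM1 : forall (t : R) (x : 'rV[R]_n1), 0 <= t -> `|x *m expm A1 t| <= M1 * expR (- (b1 * t)) * `|x|.
Hypotheses (beb : 2 * be < b) (beb1 : be < b1) (alk : al * k <= 2^-1).
Hypothesis io : io_bound (Sys A D B C) be al.
Hypothesis HG : loop_gain AK AL BK K L k be.

(** The closed loop in error coordinates. [e1] is the error in the simulation of the stable
    finite-dimensional part, whose state does not act back on these equations. *)
Definition loop (x e : R -> 'rV[R]_n0) (e1 : R -> 'rV[R]_n1) (q : R -> X) (d : R -> Y) : Prop :=
  [/\ observer_loop AK AL BK L x e (fun t => C1' (e1 t) - d t),
      has_deriv0 e1 (fun t => e1 t *m A1) & Sys A D B C (fun t => K (x t + e t)) q d].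

Lemma loop_graph_decay : exists2 Kf : R, 0 <= Kf & forall x e e1 q d, loop x e e1 q d ->
  forall t : R, 0 <= t ->
  [/\ expR (be * t) * `|x t| <= Kf * (`|x 0| + `|e 0| + `|e1 0| + (`|q 0| + `|A (q 0)|)),
      expR (be * t) * `|e t| <= Kf * (`|x 0| + `|e 0| + `|e1 0| + (`|q 0| + `|A (q 0)|)) &
      expR (be * t) * `|d t| <= Kf * (`|x 0| + `|e 0| + `|e1 0| + (`|q 0| + `|A (q 0)|))].
Proof.
have [Kg Kg0 HKg] := graph_gain SG bB gC M0 HM be0 beb al0 io.
have [Kc Kc0 HKc] := graph_bound_pos gC.
have [nC nC0 HnC] := bounded_lin_bound bC1.
have [k1 [k10 Hk1]] : exists k1, 0 <= k1 /\ nC * M1 = k1.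
  by exists (nC * M1); split => //; rewrite mulr_ge0 // ltW.
(* [C2] collects the terms free of the supremum [c] below: [c <= c / 2 + C2 N]. The factor 2 before
   [k] stands for the two values [u 0] and [u' 0]. *)
have [C2 [C20 HC2]] : exists C2, 0 <= C2 /\ C2 = (k1 + 1) + Kg * (1 + 2 * (k * (Kc + k1 + 1))).
  exists ((k1 + 1) + Kg * (1 + 2 * (k * (Kc + k1 + 1)))); split => //.
  have h : 0 <= k * (Kc + k1 + 1) by rewrite mulr_ge0 //; lra.
  have : 0 <= Kg * (1 + 2 * (k * (Kc + k1 + 1))) by rewrite mulr_ge0 //; lra.
  lra.
exists (2 * C2 + k * (2 * C2 + k1 + 1)).
  have : 0 <= k * (2 * C2 + k1 + 1) by rewrite mulr_ge0 //; lra.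
  lra.
move=> x e e1 q d [ol de1 Sq] t t0.
have [dx de] := ol.
have [cu cd Dq cAq [dq Ed]] := Sys_elim Sq.
set N := `|x 0| + `|e 0| + `|e1 0| + (`|q 0| + `|A (q 0)|).
have nx := normr_ge0 (x 0); have ne := normr_ge0 (e 0); have ne1 := normr_ge0 (e1 0).
have nq := normr_ge0 (q 0); have nAq := normr_ge0 (A (q 0)).
have N0 : 0 <= N by rewrite /N; lra.
have Hd0 : `|d 0| <= Kc * N.
  rewrite Ed //; apply: (le_trans (HKc _ (Dq 0 (lexx 0)))); rewrite ler_wpM2l // /N; lra.
have Ee1 (s : R) : 0 <= s -> expR (be * s) * `|C1' (e1 s)| <= k1 * N.
  move=> s0; rewrite (expm_uniq de1 s0).
  apply: (@le_trans _ _ (expR (be * s) * (nC * (M1 * expR (- (b1 * s)) * `|e1 0|)))).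
    rewrite ler_wpM2l ?expR_ge0 //; apply: (le_trans (HnC _)); rewrite ler_pM2l //; exact: HM1.
  have -> : expR (be * s) * (nC * (M1 * expR (- (b1 * s)) * `|e1 0|)) =
     expR (be * s) * expR (- (b1 * s)) * (k1 * `|e1 0|) by rewrite -Hk1; ring.
  apply: (@le_trans _ _ (k1 * `|e1 0|)).
    by rewrite ler_piMl ?mulr_ge0 // exp_weight_le1 // ltW.
  rewrite ler_wpM2l // /N; lra.
have vb (s c : R) : 0 <= s -> expR (be * s) * `|d s| <= c -> expR (be * s) * `|C1' (e1 s) - d s| <= c + k1 * N.
  move=> s0 Hs; have := ler_normB (C1' (e1 s)) (d s); rewrite -(ler_pM2l (expR_gt0 (be * s))) mulrDr.
  have := Ee1 s s0; lra.
have xe : `|x 0| + `|e 0| <= N by rewrite /N; lra.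
pose u' t := K (x t *m AK + BK (e t) + (e t *m AL + L (C1' (e1 t) - d t))).
have C1u : C1 (fun t => K (x t + e t)) u'.
  apply: C1_of; first exact: has_deriv0_lin bK (has_deriv0D dx de).
  have [cx ce] := (has_deriv0_C0 dx, has_deriv0_C0 de).
  apply: C0_lin => //; apply: C0D; apply: C0D.
  - exact: (C0_lin (bounded_lin_mulmxr 1 AK)).
  - exact: (C0_lin bBK).
  - exact: (C0_lin (bounded_lin_mulmxr 1 AL)).
  - apply: (C0_lin bL); apply: C0B => //; apply: (C0_lin bC1); exact: has_deriv0_C0 de1.
(* The loop gain on the degenerate interval [[0, 0]], where [d 0 = C (q 0)] is bounded by the graph
   norm. *)
have [u0 u'0] : `|K (x 0 + e 0)| <= k * (Kc + k1 + 1) * N /\ `|u' 0| <= k * (Kc + k1 + 1) * N.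
  have v0 (s : R) : 0 <= s -> s <= 0 -> expR (be * s) * `|C1' (e1 s) - d s| <= Kc * N + k1 * N.
    move=> s0 s1; have -> : s = 0 by lra.
    by apply: vb => //; rewrite mulr0 expR0 mul1r.
  have [_ _] := HG ol v0 (lexx 0) (lexx 0); rewrite mulr0 expR0 !mul1r => h1 h2.
  have kk : k * (Kc * N + k1 * N + (`|x 0| + `|e 0|)) <= k * (Kc + k1 + 1) * N.
    rewrite -mulrA ler_wpM2l //; lra.
  by split; [exact: le_trans h1 kk|exact: le_trans h2 kk].
(* On a compact interval the supremum is finite, so half of it may be moved to the left-hand side;
   the resulting bound does not depend on [t]. *)
pose S := [set expR (be * s) * `|d s| | s in `[0, t]].
have S0 : S !=set0 by exists (expR (be * 0) * `|d 0|), 0 => //=; rewrite in_itv /= lexx.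
have Sub : has_ubound S.
  have cexp : C0 (fun s => expR (be * s) : R^o) := has_deriv0_C0 (has_deriv0_exp be).
  have [m Hm] := C0_bounded t (C0Z cexp cd); exists m => z [s].
  by rewrite /= in_itv /= => /andP[s0 st] <-; have := Hm s s0 st; rewrite normrZ (gtr0_norm (expR_gt0 _)).
pose c := sup S.
have Hc (s : R) : 0 <= s -> s <= t -> expR (be * s) * `|d s| <= c.
  by move=> s0 st; apply: ub_le_sup => //; exists s => //=; rewrite in_itv /= s0.
have c0 : 0 <= c by apply: le_trans (Hc 0 (lexx 0) t0); rewrite mulr_ge0 ?expR_ge0.
have Hv (s : R) : 0 <= s -> s <= t -> expR (be * s) * `|C1' (e1 s) - d s| <= c + k1 * N.
  by move=> s0 st; apply: vb => //; exact: Hc.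
have kle : k * (c + k1 * N + (`|x 0| + `|e 0|)) <= k * (c + (k1 + 1) * N).
  rewrite ler_wpM2l //; lra.
have Hu (s : R) : 0 <= s -> s <= t -> expR (be * s) * `|K (x s + e s)| <= k * (c + (k1 + 1) * N) /\
   expR (be * s) * `|u' s| <= k * (c + (k1 + 1) * N).
  by move=> s0 st; have [_ _ h1 h2] := HG ol Hv s0 st; split; apply: le_trans kle.
have cle : c <= 2 * C2 * N.
  have : c <= al * (k * (c + (k1 + 1) * N)) + Kg * (1 + 2 * (k * (Kc + k1 + 1))) * N.
    apply: ge_sup => // z [s]; rewrite /= in_itv /= => /andP[s0 st] <-.
    have := HKg _ _ _ _ s (k * (c + (k1 + 1) * N)) Sq C1u s0.
    have Hu' (r : R) (r0 : 0 <= r) (rs : r <= s) := Hu r r0 (le_trans rs st).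
    move=> /(_ Hu') h; apply: (le_trans h); rewrite lerD2l -mulrA ler_wpM2l //.
    have : `|q 0| + `|A (q 0)| <= N by rewrite /N; lra.
    move: u0 u'0; rewrite mulrDl mul1r -mulrA; lra.
  rewrite mulrA => H.
  have : al * k * (c + (k1 + 1) * N) <= 2^-1 * (c + (k1 + 1) * N).
    by rewrite ler_wpM2r // addr_ge0 // mulr_ge0 //; lra.
  have : C2 * N = (k1 + 1) * N + Kg * (1 + 2 * (k * (Kc + k1 + 1))) * N by rewrite HC2 mulrDl.
  have : 0 <= (k1 + 1) * N by rewrite mulr_ge0 //; lra.
  move: H; rewrite -[2 * C2 * N]mulrA [2^-1 * _]mulrDr.
  set w1 := Kg * _ * N; set w2 := al * k * _; set w3 := C2 * N; set w4 := (k1 + 1) * N.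
  by move: w1 w2 w3 w4 => w1 w2 w3 w4; lra.
have kC : k * (c + (k1 + 1) * N) <= k * (2 * C2 + k1 + 1) * N.
  rewrite -mulrA ler_wpM2l //; lra.
have C2N : 0 <= C2 * N by rewrite mulr_ge0.
have kN : 0 <= k * (2 * C2 + k1 + 1) * N by rewrite mulr_ge0 // mulr_ge0 //; lra.
have [h1 h2 _ _] := HG ol Hv t0 (lexx t).
have h3 := Hc t t0 (lexx t).
rewrite mulrDl; split; lra.
Qed.
End ClosedLoop.

Section LinearTools.
Variable R : realType.

Lemma stable_unitmx n (A : 'M[R]_n) : stable_mx A -> A \in unitmx.
Proof.
move=> st; rewrite -row_free_unit -kermx_eq0; apply/eqP/row_matrixP => i; rewrite row0.
have kA : row i (kermx A) *m A = 0 by rewrite -row_mul mulmx_ker row0.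
have := stable_decays (row i (kermx A)) st; rewrite /decays => H.
apply: (cvg_pinfty_uniq _ H).
apply: cvg_near_cst; near=> t.
have t0 : 0 <= t by near: t; exact/nbhs_pinfty_ge/num_real.
rewrite -(@expm_uniq _ _ A (fun=> row i (kermx A))) //.
by apply: has_deriv0_ext (has_deriv0_cst (row i (kermx A))) => // s _; rewrite kA.
Unshelve. all: by end_near.
Qed.

(** Applied to equilibria: a constant trajectory that decays is zero. *)
Lemma exp_bound_eq0 (V : normedModType R) (v : V) (be c : R) : 0 < be ->
  (forall t : R, 0 <= t -> expR (be * t) * `|v| <= c) -> v = 0.
Proof.
move=> be0 H; apply/eqP; rewrite -normr_le0 leNgt; apply/negP => v0.
have c0 : 0 <= c by apply: le_trans (H 0 (lexx 0)); rewrite mulr_ge0 ?expR_ge0.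
have t0 : 0 <= c / (be * `|v|) by rewrite divr_ge0 // mulr_ge0 // ltW.
have := H _ t0; apply/negP; rewrite -ltNge.
apply: (@lt_le_trans _ _ ((1 + be * (c / (be * `|v|))) * `|v|)); last first.
  by rewrite ler_wpM2r // expR_ge1Dx.
have -> : (1 + be * (c / (be * `|v|))) * `|v| = `|v| + c by field; rewrite !gt_eqF.
by rewrite ltrDr.
Qed.

Lemma block_inverse n (a b c d : 'rV[R]_n -> 'rV[R]_n) :
  bounded_lin a -> bounded_lin b -> bounded_lin c -> bounded_lin d ->
  (forall x e, a x + b e = 0 -> c x + d e = 0 -> x = 0 /\ e = 0) ->
  exists a' b' c' d' : 'rV[R]_n -> 'rV[R]_n,
  [/\ [/\ bounded_lin a', bounded_lin b', bounded_lin c' & bounded_lin d'],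
      forall x e, a (a' x + b' e) + b (c' x + d' e) = x /\ c (a' x + b' e) + d (c' x + d' e) = e &
      forall x e, a' (a x + b e) + b' (c x + d e) = x /\ c' (a x + b e) + d' (c x + d e) = e].
Proof.
move=> ba bb bc bd inj.
pose f (z : 'rV[R]_(n + n)) : 'rV[R]_(n + n) :=
  row_mx (a (lsubmx z) + b (rsubmx z)) (c (lsubmx z) + d (rsubmx z)).
have fE x e : f (row_mx x e) = row_mx (a x + b e) (c x + d e) by rewrite /f row_mxKl row_mxKr.
have fl : lin_map f.
  move=> k z z'; rewrite /f !linearP /=.
  rewrite ba.1 bb.1 bc.1 bd.1 scale_row_mx add_row_mx; congr row_mx; linear_comb R.
have f0 z : f z = 0 -> z = 0.
  rewrite -[z]hsubmxK fE -row_mx0 => /eq_row_mx[h1 h2].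
  by have [-> ->] := inj _ _ h1 h2; rewrite row_mx0.
have [g gE] := choice (lin_map_inj_surj fl f0).
have fB z z' : f z = f z' -> z = z'.
  move=> E; apply/eqP; rewrite -subr_eq0; apply/eqP/f0.
  by have := fl (-1) z' z; rewrite !scaleN1r E addNr addrC.
have gl : lin_map g by move=> k z z'; apply: fB; rewrite fl !gE.
have gf z : g (f z) = z by apply: fB; rewrite gE.
have gD z z' : g (z + z') = g z + g z' by have := gl 1 z z'; rewrite !scale1r.
have l1 (k : R) (x y : 'rV[R]_n) : row_mx (k *: x + y) 0 = k *: row_mx x 0 + row_mx y (0 : 'rV[R]_n).
  by rewrite scale_row_mx add_row_mx scaler0 addr0.
have l2 (k : R) (x y : 'rV[R]_n) : row_mx 0 (k *: x + y) = k *: row_mx (0 : 'rV[R]_n) x + row_mx (0 : 'rV[R]_n) y.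
  by rewrite scale_row_mx add_row_mx scaler0 addr0.
pose a' (x : 'rV[R]_n) : 'rV[R]_n := lsubmx (g (row_mx x 0)).
pose b' (x : 'rV[R]_n) : 'rV[R]_n := lsubmx (g (row_mx 0 x)).
pose c' (x : 'rV[R]_n) : 'rV[R]_n := rsubmx (g (row_mx x 0)).
pose d' (x : 'rV[R]_n) : 'rV[R]_n := rsubmx (g (row_mx 0 x)).
have rowE x e : row_mx x e = row_mx x 0 + row_mx 0 e :> 'rV[R]_(n + n) by rewrite add_row_mx addr0 add0r.
have E1 x e : a' x + b' e = lsubmx (g (row_mx x e)) by rewrite [row_mx x e]rowE gD linearD.
have E2 x e : c' x + d' e = rsubmx (g (row_mx x e)) by rewrite [row_mx x e]rowE gD linearD.
exists a', b', c', d'; split.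
- by split; apply: lin_map_bounded => k x y; rewrite /a' /b' /c' /d' ?l1 ?l2 gl linearP.
- by move=> x e; rewrite E1 E2; have := gE (row_mx x e); rewrite /f => /eq_row_mx.
- move=> x e; rewrite E1 E2 -fE gf; by rewrite row_mxKl row_mxKr.
Qed.

Lemma wnorm_lin (W Z : normedModType R) (F : W -> Z) (w a m : R) (z : W) : 0 <= w -> 0 <= a ->
  (forall z, `|F z| <= a * `|z|) -> w * `|z| <= m -> w * `|F z| <= a * m.
Proof.
move=> w0 a0 Ha hz; apply: (@le_trans _ _ (a * (w * `|z|))); last by rewrite ler_wpM2l.
by rewrite mulrCA ler_wpM2l.
Qed.

Lemma wnorm_add (W : normedModType R) (w m m' : R) (z z' : W) : 0 <= w ->
  w * `|z| <= m -> w * `|z'| <= m' -> w * `|z + z'| <= m + m'.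
Proof.
move=> w0 h h'; apply: (@le_trans _ _ (w * (`|z| + `|z'|))).
  by rewrite ler_wpM2l // ler_normD.
by rewrite mulrDr lerD.
Qed.

Lemma wnorm_sub (W : normedModType R) (w m m' : R) (z z' : W) : 0 <= w ->
  w * `|z| <= m -> w * `|z'| <= m' -> w * `|z - z'| <= m + m'.
Proof. by move=> w0 h h'; apply: wnorm_add; rewrite ?normrN. Qed.
End LinearTools.

Section LoopDecay.
Variables (R : realType) (U Y : normedModType R) (n0 n1 : nat) (AK AL : 'M[R]_n0) (A1 : 'M[R]_n1).
Variables (BK : 'rV[R]_n0 -> 'rV[R]_n0) (K : 'rV[R]_n0 -> U) (L : Y -> 'rV[R]_n0) (C1' : 'rV[R]_n1 -> Y).
Variable B1 : U -> 'rV[R]_n1.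
Hypotheses (bBK : bounded_lin BK) (bK : bounded_lin K) (bL : bounded_lin L) (bC1 : bounded_lin C1').
Hypothesis bB1 : bounded_lin B1.
Variables (X : completeNormedModType R) (A : X -> X) (D : set X) (B : U -> X) (C : X -> Y) (T : R -> X -> X).
Hypothesis SG : semigroup_gen A D T.
Hypothesis bB : bounded_lin B.
Hypothesis gC : graph_bounded A D C.
Variables (M b M1 b1 be Kf : R).
Hypotheses (M0 : 0 <= M) (M10 : 0 <= M1) (be0 : 0 < be) (beb : be < b) (beb1 : be < b1).
Hypothesis HM : forall (t : R) x, 0 <= t -> `|T t x| <= M * expR (- (b * t)) * `|x|.
Hypothesis HM1 : forall (t : R) (x : 'rV[R]_n1), 0 <= t -> `|x *m expm A1 t| <= M1 * expR (- (b1 * t)) * `|x|.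
Hypothesis Kf0 : 0 <= Kf.
Let is_loop := loop AK AL A1 BK K L C1' A D B C.
Hypothesis Hgraph : forall x e e1 q d, is_loop x e e1 q d -> forall t : R, 0 <= t ->
  [/\ expR (be * t) * `|x t| <= Kf * (`|x 0| + `|e 0| + `|e1 0| + (`|q 0| + `|A (q 0)|)),
      expR (be * t) * `|e t| <= Kf * (`|x 0| + `|e 0| + `|e1 0| + (`|q 0| + `|A (q 0)|)) &
      expR (be * t) * `|d t| <= Kf * (`|x 0| + `|e 0| + `|e1 0| + (`|q 0| + `|A (q 0)|))].

(* Every trajectory is the derivative of another one, obtained by inverting the closed-loop
   generator: on its values the generator turns the graph norm into the norm of [X]. *)
Lemma loop_primitive : exists2 k : R, 0 <= k & forall x e e1 q d, is_loop x e e1 q d ->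
  exists X0 E0 E1 Q D0, [/\ is_loop X0 E0 E1 Q D0,
    forall t : R, 0 <= t -> x t = X0 t *m AK + BK (E0 t) /\ e t = E0 t *m AL + L (C1' (E1 t) - D0 t) &
    `|X0 0| + `|E0 0| + `|E1 0| + (`|Q 0| + `|A (Q 0)|) <= k * (`|x 0| + `|e 0| + `|e1 0| + `|q 0|)
    /\ forall t : R, 0 <= t -> `|E1 t| <= k * `|e1 t|].
Proof.
have b0 : 0 < b := lt_trans be0 beb.
(* The case [l = 0]: [R0 = - A^-1]. *)
have [R0 [bR0 DR0 AR0' RA0']] := resolvent_exists SG M0 HM b0.
have AR0 x : A (R0 x) = - x by rewrite AR0' scale0r oppr0 add0r.
have RA0 x : D x -> R0 (A x) = - x by move=> Dx; rewrite RA0' // scale0r oppr0 add0r.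
have [lC _] := gC; have [Dom00 _] := Dom0 SG.
have C00 : C 0 = 0 by have := lC (-1) _ _ Dom00 Dom00; rewrite scaler0 addr0 scaleN1r addNr.
have CB x y : D x -> D y -> C (x - y) = C x - C y.
  by move=> Dx Dy; have := lC (-1) _ _ Dy Dx; rewrite !scaleN1r addrC [- C _ + _]addrC.
have CN x : D x -> C (- x) = - C x by move=> Dx; have := CB _ _ Dom00 Dx; rewrite !sub0r C00 sub0r.
pose G x := C (R0 x).
have bG : bounded_lin G.
  have [Kc Kc0 HKc] := graph_bound_pos gC; have [r r0 Hr] := bounded_lin_bound bR0.
  apply: (@bounded_linP _ _ _ _ (Kc * (r + 1))) => [k x y|x].
    by rewrite /G bR0.1 lC.
  apply: (le_trans (HKc _ (DR0 x))); rewrite AR0 normrN -mulrA ler_wpM2l //.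
  by rewrite mulrDl mul1r lerD2r.
have uA1 : A1 \in unitmx by apply: stable_unitmx; exists M1, b1; split => //; exact: lt_trans beb1.
pose J1 := invmx A1.
have bLC : bounded_lin (fun v : 'rV[R]_n1 => L (C1' (v *m J1))).
  exact: bounded_lin_comp (bounded_lin_mulmxr 1 J1) (bounded_lin_comp bC1 bL).
have bLG : bounded_lin (fun x => L (G x)) by exact: bounded_lin_comp bG bL.
have bRB : bounded_lin (fun v => R0 (B (K v))) by exact: bounded_lin_comp bK (bounded_lin_comp bB bR0).
have bBKu : bounded_lin (fun v => B (K v)) by exact: bounded_lin_comp bK bB.
pose H v := L (G (B (K v))).
have bH : bounded_lin H by exact: bounded_lin_comp bBKu bLG.
(* The equations for [(X0, E0)] after [E1] and [Q] are eliminated by [A1^-1] and [A^-1]; the term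
   [- H] is the static response of the stable part to the input. *)
have [||||x e|a' [b' [c' [d' [[ba' bb' bc' bd'] rinv linv]]]]] :=
  @block_inverse R n0 (fun x => x *m AK) BK (fun x => -1 *: H x) (fun e => e *m AL + -1 *: H e).
- exact: bounded_lin_mulmxr.
- exact: bBK.
- exact: bounded_lin_scale.
- by apply: bounded_lin_add; [exact: bounded_lin_mulmxr|exact: bounded_lin_scale].
- move=> h1 h2; pose V := B (K (x + e)).
  (* A solution of the homogeneous block system is an equilibrium of the loop. By [Hgraph] it
     decays, hence it vanishes; in finite dimension this gives invertibility. *)
  have lp : is_loop (fun=> x) (fun=> e) (fun=> 0) (fun=> R0 V) (fun=> G V).
    split.
    + split.
        by apply: has_deriv0_ext (has_deriv0_cst x) => // t _; rewrite h1.
      apply: has_deriv0_ext (has_deriv0_cst e) => // t _; rewrite -h2 (bounded_lin0 bC1) sub0r (bounded_linN _ bL).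
      have -> : L (G V) = H x + H e by rewrite -(bounded_linD _ _ bH).
      by linear_comb R.
    + by apply: has_deriv0_ext (has_deriv0_cst (0 : 'rV[R]_n1)) => // t _; rewrite mul0mx.
    + apply: (Sys_intro SG bB gC (x' := fun=> 0)) => //.
      * exact: C0_cst.
      * exact: has_deriv0_cst.
      * exact: C0_cst.
      * by move=> t _; rewrite AR0 addNr.
  split.
  + by apply: (exp_bound_eq0 be0) => t t0; have [h _ _] := Hgraph lp t0; exact: h.
  + by apply: (exp_bound_eq0 be0) => t t0; have [_ h _] := Hgraph lp t0; exact: h.
have [ka ka0 Hka] := bounded_lin_bound ba'; have [kb kb0 Hkb] := bounded_lin_bound bb'.
have [kc kc0 Hkc] := bounded_lin_bound bc'; have [kd kd0 Hkd] := bounded_lin_bound bd'.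
have [m1 m10 Hm1] := bounded_lin_bound bLC; have [m2 m20 Hm2] := bounded_lin_bound bLG.
have [j j0 Hj] := bounded_lin_bound (bounded_lin_mulmxr 1 J1).
have [r0 r00 Hr0] := bounded_lin_bound bR0; have [r1 r10 Hr1] := bounded_lin_bound bRB.
have [r2 r20 Hr2] := bounded_lin_bound bBKu.
have [kz [kz0 Ekz]] : exists kz, 0 <= kz /\ kz = 1 + m1 + m2 by exists (1 + m1 + m2); split => //; lra.
have [kX [kX0 EkX]] : exists k, 0 <= k /\ k = ka + kb * kz.
  by exists (ka + kb * kz); split => //; rewrite addr_ge0 ?mulr_ge0 // ltW.
have [kE [kE0 EkE]] : exists k, 0 <= k /\ k = kc + kd * kz.
  by exists (kc + kd * kz); split => //; rewrite addr_ge0 ?mulr_ge0 // ltW.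
have [kQ [kQ0 EkQ]] : exists k, 0 <= k /\ k = r1 * (kX + kE) + r0.
  by exists (r1 * (kX + kE) + r0); split => //; rewrite addr_ge0 ?mulr_ge0 ?addr_ge0 // ltW.
have [kR [kR0 EkR]] : exists k, 0 <= k /\ k = 1 + r2 * (kX + kE).
  by exists (1 + r2 * (kX + kE)); split => //; rewrite addr_ge0 ?mulr_ge0 ?addr_ge0 // ltW.
exists (kX + kE + j + (kQ + kR)); first by lra.
move=> x e e1 q d [[dx de] de1 Sq].
have [cu cd Dq cAq [dq Ed]] := Sys_elim Sq.
(* The right-hand side of the second block equation: what remains of [e] once the known
   contributions of [E1] and [Q] are moved over. *)
pose z t := e t - L (C1' (e1 t *m J1)) - L (G (q t)).
pose X0 t := a' (x t) + b' (z t); pose E0 t := c' (x t) + d' (z t).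
pose E1 t := e1 t *m J1.
pose Q t := R0 (B (K (X0 t + E0 t))) - R0 (q t).
pose D0 t := G (B (K (X0 t + E0 t))) - G (q t).
have DQ t : D (Q t) /\ A (Q t) = q t - B (K (X0 t + E0 t)).
  by have [h1 h2] := DomB SG (DR0 (B (K (X0 t + E0 t)))) (DR0 (q t)); split => //; rewrite h2 !AR0 opprK addrC.
have D0E t : D0 t = C (Q t) by rewrite /D0 /Q CB.
have eX t : x t = X0 t *m AK + BK (E0 t) by have [h _] := rinv (x t) (z t); rewrite -[LHS]h.
have eE t : e t = E0 t *m AL + L (C1' (E1 t) - D0 t).
  have [_ h] := rinv (x t) (z t); rewrite -/(X0 t) -/(E0 t) in h.
  rewrite /D0 !(bounded_linB _ _ bL) -/(H _) (bounded_linD _ _ bH) /E1.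
  have : z t = e t - L (C1' (e1 t *m J1)) - L (G (q t)) by [].
  rewrite -[z t in LHS]h => h'.
  have -> : e t = (-1 *: H (X0 t) + (E0 t *m AL + -1 *: H (E0 t))) + L (C1' (e1 t *m J1)) + L (G (q t)).
    by rewrite h'; linear_comb R.
  by linear_comb R.
have eE1 t : e1 t = E1 t *m A1 by rewrite /E1 mulmxKV.
(* [(x', z')] is the block system evaluated at [(x, e)]; its inverse therefore gives [X0' = x] and
   [E0' = e]. *)
have dz : has_deriv0 z (fun t => -1 *: H (x t) + (e t *m AL + -1 *: H (e t))).
  have := has_deriv0B (has_deriv0B de (has_deriv0_lin bLC de1)) (has_deriv0_lin bLG dq).
  apply: has_deriv0_ext => // t t0.
  have -> : L (G (A (q t) + B (K (x t + e t)))) = - L (d t) + (H (x t) + H (e t)).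
    rewrite (bounded_linD _ _ bG) (bounded_linD _ _ bL) -(bounded_linD _ _ bH); congr (_ + _).
    by rewrite /G RA0 ?CN ?(bounded_linN _ bL) -?Ed //; exact: Dq.
  rewrite mulmxK // (bounded_linB _ _ bL).
  by linear_comb R.
have dX0 : has_deriv0 X0 x.
  have := has_deriv0D (has_deriv0_lin ba' dx) (has_deriv0_lin bb' dz).
  by apply: has_deriv0_ext => // t t0; case: (linv (x t) (e t)).
have dE0 : has_deriv0 E0 e.
  have := has_deriv0D (has_deriv0_lin bc' dx) (has_deriv0_lin bd' dz).
  by apply: has_deriv0_ext => // t t0; case: (linv (x t) (e t)).
have dE1 : has_deriv0 E1 e1.
  have := has_deriv0_lin (bounded_lin_mulmxr 1 J1) de1.
  by apply: has_deriv0_ext => // t t0; rewrite mulmxK.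
have dQ : has_deriv0 Q q.
  have := has_deriv0B (has_deriv0_lin bRB (has_deriv0D dX0 dE0)) (has_deriv0_lin bR0 dq).
  apply: has_deriv0_ext => // t t0; rewrite (bounded_linD _ _ bR0) RA0; last exact: Dq.
  by rewrite opprD opprK addrCA subrr addr0.
exists X0, E0, E1, Q, D0; split.
- split.
  + split; first by apply: has_deriv0_ext dX0 => // t _; exact: eX.
    by apply: has_deriv0_ext dE0 => // t _; exact: eE.
  + by apply: has_deriv0_ext dE1 => // t _; exact: eE1.
  + apply: (Sys_intro SG bB gC (x' := q)) => //.
    * by apply: C0_lin => //; apply: C0D; [exact: has_deriv0_C0 dX0|exact: has_deriv0_C0 dE0].
    * by move=> t _; case: (DQ t).
    * exact: has_deriv0_C0 dq.
    * by move=> t _; case: (DQ t) => _ ->; rewrite subrK.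
- by move=> t _; split; [exact: eX|exact: eE].
have hE1 t : `|E1 t| <= j * `|e1 t| by exact: Hj.
split; last first.
  by move=> t _; apply: (le_trans (hE1 t)); rewrite ler_wpM2r //; lra.
have nx := normr_ge0 (x 0); have ne := normr_ge0 (e 0).
have ne1 := normr_ge0 (e1 0); have nq := normr_ge0 (q 0).
set S := `|x 0| + `|e 0| + `|e1 0| + `|q 0|.
have Sx : `|x 0| <= S by rewrite /S; lra.
have Se : `|e 0| <= S by rewrite /S; lra.
have Se1 : `|e1 0| <= S by rewrite /S; lra.
have Sq' : `|q 0| <= S by rewrite /S; lra.
have w (W Z : normedModType R) (F : W -> Z) (k m : R) (v : W) : 0 < k -> (forall v, `|F v| <= k * `|v|) ->
    `|v| <= m -> `|F v| <= k * m.
  by move=> k0 HF hv; apply: (le_trans (HF v)); rewrite ler_pM2l.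
have hz : `|z 0| <= kz * S.
  rewrite Ekz /z; have := ler_normB (e 0 - L (C1' (e1 0 *m J1))) (L (G (q 0))).
  have := ler_normB (e 0) (L (C1' (e1 0 *m J1))).
  have := w _ _ _ _ _ _ m10 Hm1 Se1; have := w _ _ _ _ _ _ m20 Hm2 Sq'.
  rewrite !mulrDl mul1r; lra.
have hX : `|X0 0| <= kX * S.
  rewrite EkX mulrDl -mulrA; apply: (le_trans (ler_normD _ _)); apply: lerD.
    exact: w Hka Sx.
  exact: w Hkb hz.
have hE : `|E0 0| <= kE * S.
  rewrite EkE mulrDl -mulrA; apply: (le_trans (ler_normD _ _)); apply: lerD.
    exact: w Hkc Sx.
  exact: w Hkd hz.
have hXE : `|X0 0 + E0 0| <= (kX + kE) * S.
  by rewrite mulrDl; apply: (le_trans (ler_normD _ _)); exact: lerD.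
have hQ : `|Q 0| <= kQ * S.
  rewrite EkQ mulrDl -mulrA; apply: (le_trans (ler_normB _ _)); apply: lerD.
    exact: w Hr1 hXE.
  exact: w Hr0 Sq'.
have hA : `|A (Q 0)| <= kR * S.
  have [_ ->] := DQ 0.
  rewrite EkR mulrDl mul1r -mulrA; apply: (le_trans (ler_normB _ _)); apply: lerD => //.
  exact: w Hr2 hXE.
have hE1' : `|E1 0| <= j * S by exact: w Hj Se1.
rewrite !mulrDl; lra.
Qed.

(** The graph bound is applied to the primitive trajectory, from which [x] and [e] are recovered by
    bounded maps; the graph norm of its initial state is controlled by the plain norm of the given
    one. Then [p] and [q] follow as stable equations forced by the decaying input. *)
Lemma loop_decay : exists2 Kx : R, 0 <= Kx & forall x e e1 p q d, is_loop x e e1 q d ->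
  has_deriv0 p (fun t => p t *m A1 + B1 (K (x t + e t))) -> forall t : R, 0 <= t ->
  expR (be * t) * (`|x t| + `|e t| + `|e1 t| + `|p t| + `|q t|) <=
  Kx * (`|x 0| + `|e 0| + `|e1 0| + `|p 0| + `|q 0|).
Proof.
have [kp kp0 Hp] := loop_primitive.
have [nB nB0 HB] := bounded_lin_bound bBK.
have [nL nL0 HnL] := bounded_lin_bound bL.
have [nC nC0 HnC] := bounded_lin_bound bC1.
have [aK aK0 HaK] := bounded_lin_bound (bounded_lin_mulmxr 1 AK).
have [aL aL0 HaL] := bounded_lin_bound (bounded_lin_mulmxr 1 AL).
have [nq nq0 Hnq] := bounded_lin_bound (bounded_lin_comp bK bB).
have [np np0 Hnp] := bounded_lin_bound (bounded_lin_comp bK bB1).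
have [h [h0 Eh]] : exists h, 0 <= h /\ h = Kf * kp by exists (Kf * kp); split => //; rewrite mulr_ge0.
have [kx [kx0 Ekx]] : exists k, 0 <= k /\ k = aK * h + nB * h.
  by exists (aK * h + nB * h); split => //; rewrite addr_ge0 ?mulr_ge0 // ltW.
have [ke [ke0 Eke]] : exists k, 0 <= k /\ k = aL * h + nL * (nC * (kp * M1) + h).
  exists (aL * h + nL * (nC * (kp * M1) + h)); split => //.
  by rewrite addr_ge0 ?mulr_ge0 ?addr_ge0 ?mulr_ge0 // ltW.
have kxe : 0 <= kx + ke by rewrite addr_ge0.
have [kq [kq0 Ekq]] : exists k, 0 <= k /\ k = M + nq * (kx + ke) * (M / (b - be)).
  exists (M + nq * (kx + ke) * (M / (b - be))); split => //; apply: addr_ge0 => //.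
  by apply: mulr_ge0; [rewrite mulr_ge0 // ltW|rewrite divr_ge0 // subr_ge0 ltW].
have [kpp [kpp0 Ekp]] : exists k, 0 <= k /\ k = M1 + np * (kx + ke) * (M1 / (b1 - be)).
  exists (M1 + np * (kx + ke) * (M1 / (b1 - be))); split => //; apply: addr_ge0 => //.
  by apply: mulr_ge0; [rewrite mulr_ge0 // ltW|rewrite divr_ge0 // subr_ge0 ltW].
exists (kx + ke + M1 + kpp + kq); first by rewrite !addr_ge0.
move=> x e e1 p q d lp dp t t0.
set N := `|x 0| + `|e 0| + `|e1 0| + `|p 0| + `|q 0|.
have nx := normr_ge0 (x 0); have ne := normr_ge0 (e 0); have npp := normr_ge0 (p 0).
have ne1 := normr_ge0 (e1 0); have nqq := normr_ge0 (q 0).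
have N0 : 0 <= N by rewrite /N; lra.
have [X0 [E0 [E1 [Q [D0 [lP eq [b0 bE1]]]]]]] := Hp _ _ _ _ _ lp.
have [_ de1 Sq] := lp; have [_ _ Dq _ [dq _]] := Sys_elim Sq.
have NX : Kf * (`|X0 0| + `|E0 0| + `|E1 0| + (`|Q 0| + `|A (Q 0)|)) <= h * N.
  rewrite Eh -mulrA ler_wpM2l //; apply: (le_trans b0); rewrite ler_wpM2l //.
  rewrite /N; lra.
have be1 (s : R) : 0 <= s -> expR (be * s) * `|e1 s| <= M1 * N.
  move=> s0; rewrite (expm_uniq de1 s0).
  apply: (@le_trans _ _ (expR (be * s) * (M1 * expR (- (b1 * s)) * `|e1 0|))).
    by rewrite ler_wpM2l ?expR_ge0 //; exact: HM1.
  have -> : expR (be * s) * (M1 * expR (- (b1 * s)) * `|e1 0|) =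
     expR (be * s) * expR (- (b1 * s)) * (M1 * `|e1 0|) by ring.
  apply: (@le_trans _ _ (M1 * `|e1 0|)).
    by rewrite ler_piMl ?mulr_ge0 // exp_weight_le1 // ltW.
  by rewrite ler_wpM2l // /N; lra.
have bX (s : R) : 0 <= s -> expR (be * s) * `|x s| <= kx * N /\ expR (be * s) * `|e s| <= ke * N.
  move=> s0; have [h1 h2 h3] := Hgraph lP s0.
  have {}h1 := le_trans h1 NX; have {}h2 := le_trans h2 NX; have {}h3 := le_trans h3 NX.
  have w0 := expR_ge0 (be * s).
  have [-> ->] := eq s s0; split.
    rewrite Ekx mulrDl -!mulrA; apply: wnorm_add => //.
      exact: (wnorm_lin w0 (ltW aK0) HaK h1).
    exact: (wnorm_lin w0 (ltW nB0) HB h2).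
  rewrite Eke mulrDl -!mulrA; apply: wnorm_add => //.
    exact: (wnorm_lin w0 (ltW aL0) HaL h2).
  apply: (wnorm_lin w0 (ltW nL0) HnL); rewrite mulrDl -!mulrA; apply: wnorm_sub => //.
  apply: (wnorm_lin w0 (ltW nC0) HnC).
  apply: (@le_trans _ _ (kp * (expR (be * s) * `|e1 s|))).
    by rewrite mulrCA ler_wpM2l // bE1.
  by rewrite ler_wpM2l // be1.
have bu (Z : normedModType R) (F : 'rV[R]_n0 -> Z) (m s : R) : 0 < m -> (forall v, `|F v| <= m * `|v|) ->
    0 <= s -> expR (be * s) * `|F (x s + e s)| <= m * (kx + ke) * N.
  move=> m0 HF s0; have [h1 h2] := bX s s0.
  rewrite -mulrA; apply: (wnorm_lin (expR_ge0 _) (ltW m0) HF); rewrite mulrDl.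
  by apply: wnorm_add => //; exact: expR_ge0.
have bq : expR (be * t) * `|q t| <= kq * N.
  have Hf (s : R) : 0 <= s -> s <= t -> expR (be * s) * `|B (K (x s + e s))| <= nq * (kx + ke) * N.
    by move=> s0 _; exact: bu nq0 Hnq s0.
  have := forced_weighted SG HM M0 beb t0 dq Dq Hf.
  move=> H; apply: (le_trans H); rewrite Ekq mulrDl; apply: lerD.
    rewrite ler_wpM2l // /N; lra.
  by rewrite mulrAC.
have bp : expR (be * t) * `|p t| <= kpp * N.
  have Hf (s : R) : 0 <= s -> s <= t -> expR (be * s) * `|B1 (K (x s + e s))| <= np * (kx + ke) * N.
    by move=> s0 _; exact: bu np0 Hnp s0.
  have := forced_weighted (expm_semigroup A1) HM1 M10 beb1 t0 dp (fun _ _ => I) Hf.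
  move=> H; apply: (le_trans H); rewrite Ekp mulrDl; apply: lerD.
    rewrite ler_wpM2l // /N; lra.
  by rewrite mulrAC.
have [h1 h2] := bX t t0; have h3 := be1 t t0.
rewrite 4!mulrDr 4![in leRHS]mulrDl; apply: lerD => //; apply: lerD => //; apply: lerD => //; exact: lerD.
Qed.
End LoopDecay.

(** * Decompositions of a quasi-finite system *)

(** A retract of a complete space is complete. It is used for the stable part of a decomposition,
    embedded in the state space by the isomorphism. *)
Lemma complete_transfer (R : realType) (V : completeNormedModType R) (W : normedModType R)
    (i : W -> V) (p : V -> W) : bounded_lin i -> bounded_lin p -> (forall w, p (i w) = w) ->
  forall F : set_system W, ProperFilter F -> cauchy F -> cvg F.
Proof.
move=> bi bp pi F FF /cauchyP cF.
have [M M0 HM] := bounded_lin_bound bi.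
have cG : cauchy (i @ F).
  apply/cauchyP => e e0.
  have [x Hx] := cF _ (divr_gt0 e0 M0); exists (i x).
  rewrite /nbhs /=; apply: filterS Hx => y; rewrite /= -!ball_normE /= => h.
  rewrite -(bounded_linB _ _ bi); apply: (le_lt_trans (HM _)).
  by rewrite mulrC -ltr_pdivlMr.
have /cvg_ex[l Hl] : cvg (i @ F) by exact: cauchy_cvg.
apply/cvg_ex; exists (p l).
have H : p (i x) @[x --> F] --> p l by exact: bounded_lin_cvg bp Hl.
have pi' : (fun x => p (i x)) = id by exact/funext.
by rewrite pi' in H.
Qed.

Lemma Sys_zero (R : realType) (U Y : normedModType R) (X : completeNormedModType R) (A : X -> X) (D : set X)
    (B : U -> X) (C : X -> Y) (T : R -> X -> X) :
  semigroup_gen A D T -> bounded_lin B -> graph_bounded A D C -> C 0 = 0 /\ Sys A D B C (fun=> 0) (fun=> 0) (fun=> 0).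
Proof.
move=> SG bB gC; have [D0 A0] := Dom0 SG.
have C00 : C 0 = 0 by have [lC _] := gC; have := lC (-1) _ _ D0 D0; rewrite scaler0 addr0 scaleN1r addNr.
split => //; apply: (Sys_intro SG bB gC (x' := fun=> 0)) => //; try exact: C0_cst.
- exact: has_deriv0_cst.
- by move=> t _; rewrite A0 (bounded_lin0 bB) addr0.
Qed.

(** The domain of a generator is a dense subspace, which in finite dimension is the whole space. *)
Lemma finite_generator (R : realType) n (A : 'rV[R]_n -> 'rV[R]_n) (D : set 'rV[R]_n) :
  generator A D -> (forall x, D x) /\ exists M : 'M[R]_n, forall x, A x = x *m M.
Proof.
move=> /generatorP[T SG].
have [P HP] : exists P : 'M[R]_n, forall x, D x <-> (x <= P)%MS.
  apply: subspace_mx; first by case: (Dom0 SG).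
  by move=> a x y Dx Dy; case: (Dom_lin SG a Dx Dy).
have Dall x : D x.
  apply/HP; apply: dense_full => {}x e e0; have [y Dy xy] := Dom_dense SG x e0.
  by exists y => //; apply/HP.
split=> //; exists (\matrix_i A (delta_mx 0 i)) => x; rewrite mx_ofE //.
by move=> a y z; case: (Dom_lin SG a (Dall y) (Dall z)).
Qed.

Section Decomposition.
Variables (R : realType) (U X Y : normedModType R) (S : relation R U X Y).

(** The isomorphism [S ~ S_u + S_s] in coordinates [x = ju p + js q], with the generator of the
    finite-dimensional part written as the matrix [Mu] and the output of the stable part as
    [y - Cu p]. *)
Record decomposition n (Xs : completeNormedModType R) (pu : X -> 'rV[R]_n) (ps : X -> Xs)
    (ju : 'rV[R]_n -> X) (js : Xs -> X) (Mu : 'M[R]_n) (Bu : U -> 'rV[R]_n) (Cu : 'rV[R]_n -> Y)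
    (As : Xs -> Xs) (Ds : set Xs) (Bs : U -> Xs) (Cs : Xs -> Y) (Ts : R -> Xs -> Xs) : Prop := Decomp {
  dec_pu : bounded_lin pu; dec_ps : bounded_lin ps; dec_ju : bounded_lin ju; dec_js : bounded_lin js;
  dec_uu : forall p, pu (ju p) = p;
  dec_ss : forall q, ps (js q) = q;
  dec_us : forall q, pu (js q) = 0;
  dec_su : forall p, ps (ju p) = 0;
  dec_sum : forall x, ju (pu x) + js (ps x) = x;
  dec_Bu : bounded_lin Bu; dec_Cu : bounded_lin Cu;
  dec_SG : semigroup_gen As Ds Ts; dec_Bs : bounded_lin Bs; dec_Cs : graph_bounded As Ds Cs;
  dec_fwd : forall u x y, S u x y ->
    has_deriv0 (fun t => pu (x t)) (fun t => pu (x t) *m Mu + Bu (u t)) /\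
    Sys As Ds Bs Cs u (fun t => ps (x t)) (fun t => y t - Cu (pu (x t)));
  dec_bwd : forall u p q d, has_deriv0 p (fun t => p t *m Mu + Bu (u t)) -> Sys As Ds Bs Cs u q d ->
    S u (fun t => ju (p t) + js (q t)) (fun t => Cu (p t) + d t) }.

Definition decays_exponentially (V : normedModType R) (T : R -> V -> V) : Prop :=
  exists M b : R, [/\ 0 <= M, 0 < b &
    forall (t : R) x, 0 <= t -> `|T t x| <= M * expR (- (b * t)) * `|x|].
End Decomposition.

(** Unfolding the two infima of the IO-gain gives one rate [be > 0] and one constant [al < eps] that
    satisfy the inequality. *)
Lemma quasi_finite_decomposition (R : realType) (U Y : normedModType R) (X : completeNormedModType R)
    (S : relation R U X Y) (eps : R) : quasi_finite S -> 0 < eps ->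
  exists n (Xs : completeNormedModType R) pu ps ju js Mu Bu Cu As Ds Bs Cs Ts,
  [/\ @decomposition R U X Y S n Xs pu ps ju js Mu Bu Cu As Ds Bs Cs Ts, decays_exponentially Ts &
   exists be al : R, [/\ 0 < be, 0 <= al, al < eps & io_bound (Sys As Ds Bs Cs) be al]].
Proof.
move=> qf eps0.
have [n [Xs [Au [DomAu [Bu [Cu [As [DomAs [Bs [Cs [du [ds [iso [es gain]]]]]]]]]]]]]] := qf eps eps0.
have [phi [psi [phil [phic [psic [K1 [K2 iff]]]]]]] := iso.
have psil : lin_map psi.
  by move=> a x y; apply: (can_inj K1); rewrite phil !K2.
have bphi : bounded_lin phi by [].
have bpsi : bounded_lin psi by [].
have bfst : bounded_lin (fst : 'rV[R]_n * Xs -> 'rV[R]_n).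
  by apply: (@bounded_linP _ _ _ _ 1) => [//|x]; rewrite mul1r prod_normE le_max lexx.
have bsnd : bounded_lin (snd : 'rV[R]_n * Xs -> Xs).
  by apply: (@bounded_linP _ _ _ _ 1) => [//|x]; rewrite mul1r prod_normE le_max lexx orbT.
have binl : bounded_lin (fun p : 'rV[R]_n => (p, 0 : Xs)).
  apply: (@bounded_linP _ _ _ _ 1) => [a x y|x]; last by rewrite mul1r prod_normE /= normr0 ge_max lexx /=.
  by congr (_, _); rewrite /= scaler0 addr0.
have binr : bounded_lin (fun q : Xs => (0 : 'rV[R]_n, q)).
  apply: (@bounded_linP _ _ _ _ 1) => [a x y|x]; last by rewrite mul1r prod_normE /= normr0 ge_max lexx andbT.
  by congr (_, _); rewrite /= scaler0 addr0.
have [Xc Ec] : exists Xc : completeNormedModType R, (Xc : normedModType R) = Xs.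
  have h := complete_transfer (bounded_lin_comp binr bpsi) (bounded_lin_comp bphi bsnd) _.
  unshelve eexists (complete_pack (h _)); last exact: complete_packE.
  by move=> w /=; rewrite K2.
subst Xs.
have [/finite_generator[DAu [Mu AuE]] [bBu gCu]] := du.
have [Tu SGu] := (generatorP _ _).1 du.1.
have [/generatorP[Ts SGs] [bBs gCs]] := ds.
have lCu : lin_map Cu by move=> a x y; apply: gCu.1.
have bCu := lin_map_bounded lCu.
pose pu x := (phi x).1; pose ps x := (phi x).2.
pose ju p := psi (p, 0 : Xc); pose js q := psi (0 : 'rV[R]_n, q).
have ipE p q : ju p + js q = psi (p, q).
  by rewrite -(bounded_linD _ _ bpsi); congr psi; congr (_, _); rewrite /= ?addr0 ?add0r.
exists n, Xc, pu, ps, ju, js, Mu, Bu, Cu, As, DomAs, Bs, Cs, Ts; split; first split.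
- exact: bounded_lin_comp bphi bfst.
- exact: bounded_lin_comp bphi bsnd.
- exact: bounded_lin_comp binl bpsi.
- exact: bounded_lin_comp binr bpsi.
- by move=> p; rewrite /pu /ju K2.
- by move=> p; rewrite /ps /js K2.
- by move=> p; rewrite /pu /js K2.
- by move=> p; rewrite /ps /ju K2.
- by move=> x; rewrite ipE /pu /ps -surjective_pairing K1.
- by [].
- by [].
- exact: SGs.
- by [].
- by [].
- move=> u x y /iff[y1 [y2 [S1 [S2 yE]]]].
  have [cu _ _ _ [dp E1]] := Sys_elim S1; have [_ _ Dq cA [dq E2]] := Sys_elim S2.
  split; first by apply: has_deriv0_ext dp => // t t0; rewrite AuE.
  apply: (Sys_intro SGs bBs gCs) dq _ _ _ => //.
    by apply: C0D => //; exact: C0_lin.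
  by move=> t t0; rewrite yE // E1 // addrAC subrr add0r E2.
- move=> u p q d dp Sq; apply/iff.
  have [cu cd Dq cA [dq E2]] := Sys_elim Sq.
  exists (fun t => Cu (p t)), d.
  have -> : fst \o (phi \o (fun t : R => ju (p t) + js (q t))) = p.
    by apply/funext => t /=; rewrite ipE K2.
  have -> : snd \o (phi \o (fun t : R => ju (p t) + js (q t))) = q.
    by apply/funext => t /=; rewrite ipE K2.
  split; last by split.
  have cp := has_deriv0_C0 dp.
  apply: (Sys_intro SGu bBu gCu) dp _ _ _ => //.
    apply: C0D; last exact: C0_lin.
    exact: C0_lin (bounded_lin_mulmxr 1 Mu) cp.
  by move=> t t0; rewrite AuE.
- exact: exp_stable_semigroup SGs bBs gCs es.
- have [_ [be be0 <-] h1] := ereal_inf_lt gain.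
  have [_ [al [al0 io] <-] h2] := ereal_inf_lt h1.
  by exists be, al; split => //; rewrite lte_fin in h2.
Qed.

Section UnstablePart.
Variables (R : realType) (U X Y : normedModType R) (S : relation R U X Y).

(** The unstable dynamics described through the trajectories of [S] alone, without reference to the
    decomposition they came from, so that they can be confronted with a different decomposition. *)
Record unstable_part n0 (pi0 : X -> 'rV[R]_n0) (iota0 : 'rV[R]_n0 -> X) (A0 : 'M[R]_n0)
    (B0 : U -> 'rV[R]_n0) (C0' : 'rV[R]_n0 -> Y) : Prop := UnstablePart {
  up_pi : bounded_lin pi0; up_iota : bounded_lin iota0; up_B : bounded_lin B0; up_C : bounded_lin C0';
  up_nd : nodecay A0;
  up_id : forall v, pi0 (iota0 v) = v;
  up_der : forall u x y, S u x y ->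
    has_deriv0 (fun t => pi0 (x t)) (fun t => pi0 (x t) *m A0 + B0 (u t));
  up_traj : forall v, S (fun=> 0) (fun t => iota0 (v *m expm A0 t)) (fun t => C0' (v *m expm A0 t));
  up_rest : forall u x y, S u x y -> (forall t : R, 0 <= t -> u t = 0) -> pi0 (x 0) = 0 ->
    x t @[t --> +oo] --> (0 : X) }.

Lemma unstable_part_exists n Xs pu ps ju js Mu Bu Cu As Ds Bs Cs Ts :
  @decomposition R U X Y S n Xs pu ps ju js Mu Bu Cu As Ds Bs Cs Ts -> decays_exponentially Ts ->
  exists n0 pi0 iota0 A0 B0 C0', @unstable_part n0 pi0 iota0 A0 B0 C0'.
Proof.
move=> dec [M [b [M0 b0 HM]]].
have [n0 [iota [pi [A0 [ip iA Ap nd dcy]]]]] := split_unstable Mu.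
have SGs := dec_SG dec; have bBs := dec_Bs dec.
exists n0, (fun x => pu x *m pi), (fun v => ju (v *m iota)), A0, (fun u => Bu u *m pi), (fun v => Cu (v *m iota)).
split.
- exact: bounded_lin_comp (dec_pu dec) (bounded_lin_mulmxr 1 pi).
- exact: bounded_lin_comp (bounded_lin_mulmxr 1 iota) (dec_ju dec).
- exact: bounded_lin_comp (dec_Bu dec) (bounded_lin_mulmxr 1 pi).
- exact: bounded_lin_comp (bounded_lin_mulmxr 1 iota) (dec_Cu dec).
- exact: nd.
- by move=> v; rewrite (dec_uu dec) -mulmxA ip mulmx1.
- move=> u x y /(dec_fwd dec)[dp _].
  have := has_deriv0_lin (bounded_lin_mulmxr 1 pi) dp.
  by apply: has_deriv0_ext => // t _; rewrite mulmxDl -!mulmxA Ap.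
- move=> v.
  have dp : has_deriv0 (fun t => v *m expm A0 t *m iota) (fun t => v *m expm A0 t *m iota *m Mu + Bu 0).
    have := has_deriv0_lin (bounded_lin_mulmxr 1 iota) (@expm_row_deriv _ _ A0 v).
    by apply: has_deriv0_ext => // t _; rewrite (bounded_lin0 (dec_Bu dec)) addr0 -!mulmxA iA.
  have [_ S0] := Sys_zero SGs bBs (dec_Cs dec).
  have := dec_bwd dec dp S0.
  have -> : (fun t => ju (v *m expm A0 t *m iota) + js 0) = (fun t => ju (v *m expm A0 t *m iota)).
    by apply/funext => t; rewrite (bounded_lin0 (dec_js dec)) addr0.
  have -> // : (fun t => Cu (v *m expm A0 t *m iota) + 0) = (fun t => Cu (v *m expm A0 t *m iota)).
  by apply/funext => t; rewrite addr0.
move=> u x y /(dec_fwd dec)[dp Sq] u0 x0.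
have [_ _ Dq _ [dq _]] := Sys_elim Sq.
have cp : pu (x t) @[t --> +oo] --> (0 : 'rV[R]_n).
  have dp' : has_deriv0 (fun t => pu (x t)) (fun t => pu (x t) *m Mu).
    by apply: has_deriv0_ext dp => // t t0; rewrite u0 // (bounded_lin0 (dec_Bu dec)) addr0.
  have := dcy _ x0; rewrite /decays; apply: cvg_trans; apply: near_eq_cvg; near=> t.
  have t0 : 0 <= t by near: t; exact/nbhs_pinfty_ge/num_real.
  by rewrite -(expm_uniq dp').
have cq : ps (x t) @[t --> +oo] --> (0 : Xs).
  apply: (exp_decay_cvg (K := M * `|ps (x 0)|) b0) => t t0.
  rewrite (semigroup_uniq SGs dq Dq) //; last first.
    by move=> s s0; rewrite u0 // (bounded_lin0 bBs) addr0.
  by rewrite mulrAC; exact: HM.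
have H : ju (pu (x t)) + js (ps (x t)) @[t --> +oo] --> ju 0 + js 0.
  by apply: cvgD; [exact: bounded_lin_cvg_pinfty (dec_ju dec) cp|exact: bounded_lin_cvg_pinfty (dec_js dec) cq].
rewrite (bounded_lin0 (dec_ju dec)) (bounded_lin0 (dec_js dec)) addr0 in H.
apply: cvg_trans H; apply: near_eq_cvg; near=> t; exact: (dec_sum dec).
Unshelve. all: by end_near.
Qed.

Variables (n0 : nat) (pi0 : X -> 'rV[R]_n0) (iota0 : 'rV[R]_n0 -> X) (A0 : 'M[R]_n0).
Variables (B0 : U -> 'rV[R]_n0) (C0' : 'rV[R]_n0 -> Y).
Hypothesis up : unstable_part pi0 iota0 A0 B0 C0'.
Hypothesis input_C0 : forall u x y, S u x y -> C0 u.

(** The states that some input steers asymptotically to 0 form a subspace. It contains the image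
    under [pi0] of a dense set, so it is dense and therefore everything. *)
Lemma null_controllable : stabilizable S -> forall v : 'rV[R]_n0, exists xi u,
  [/\ C0 u, has_deriv0 xi (fun t => xi t *m A0 + B0 (u t)), xi 0 = v & xi t @[t --> +oo] --> (0 : 'rV[R]_n0)].
Proof.
move=> st.
pose P (v : 'rV[R]_n0) := exists (xi : R -> 'rV[R]_n0) (u : R -> U),
  [/\ C0 u, has_deriv0 xi (fun t => xi t *m A0 + B0 (u t)), xi 0 = v & xi t @[t --> +oo] --> (0 : 'rV[R]_n0)].
have bB := up_B up.
have [D HD] : exists D : 'M[R]_n0, forall v, P v <-> (v <= D)%MS.
  apply: subspace_mx.
    exists (fun=> 0), (fun=> 0); split => //; [exact: C0_cst| |exact: cvg_cst].
    by apply: has_deriv0_ext (has_deriv0_cst (0 : 'rV[R]_n0)) => // t _; rewrite mul0mx (bounded_lin0 bB) addr0.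
  move=> a v w [xi [u [cu dxi xi0 cxi]]] [xj [u' [cu' dxj xj0 cxj]]].
  exists (fun t => a *: xi t + xj t), (fun t => a *: u t + u' t); split.
  - by apply: C0D => //; exact: C0Zc.
  - have := has_deriv0D (has_deriv0Zc a dxi) dxj.
    apply: has_deriv0_ext => // t _; rewrite mulmxDl -scalemxAl (bounded_linD _ _ bB) (bounded_linZ _ _ bB).
    by linear_comb R.
  - by rewrite xi0 xj0.
  - have -> : (0 : 'rV[R]_n0) = a *: 0 + 0 by rewrite scaler0 addr0.
    by apply: cvgD => //; exact: cvgZr.
move=> v; apply/HD; apply: dense_full => {}v e e0.
have [M M0 HM] := bounded_lin_bound (up_pi up).
have eM := divr_gt0 e0 M0.
have ob : open (ball (iota0 v) (e / M)) by exact: ball_open.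
have [|x0 [h [x [u [y [Sx cx]]] xE]]] := st (ball (iota0 v) (e / M)) _ ob.
  by exists (iota0 v); exact: ballxx.
rewrite -xE in h.
exists (pi0 (x 0)).
  apply/HD; exists (fun t => pi0 (x t)), u; split => //.
  - exact: input_C0 Sx.
  - exact: up_der up _ _ _ Sx.
  - by have := bounded_lin_cvg_pinfty (up_pi up) cx; rewrite (bounded_lin0 (up_pi up)).
rewrite -{1}[v](up_id up) -(bounded_linB _ _ (up_pi up)).
apply: (le_trans (HM _)); rewrite mulrC -ler_pdivlMr //.
by move: h; rewrite -ball_normE /= => /ltW.
Qed.

Lemma state_feedback : stabilizable S -> exists (K : 'rV[R]_n0 -> U) (AK : 'M[R]_n0),
  [/\ bounded_lin K, stable_mx AK & forall x, x *m AK = x *m A0 + B0 (K x)].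
Proof.
move=> st.
have [xi Hxi] := choice (fun i : 'I_n0 => null_controllable st (delta_mx 0 i)).
have [u Hu] := choice Hxi.
have [Bm [Sm [b [bb bE SE]]]] := finite_range (up_B up).
(* Row [i] of [Z] steers the [i]-th basis vector to 0, so [Z 0 = 1] and [Z tau] is small for large
   [tau]; [V *m Bm] has the rows [B0 (u i t)]. *)
pose Z t : 'M[R]_n0 := \matrix_i xi i t; pose V t : 'M[R]_n0 := \matrix_i (B0 (u i t) *m Sm).
have dZ : has_deriv0 Z (fun t => Z t *m A0 + V t *m Bm).
  apply: has_deriv0_mx => i j; have [_ dxi _ _] := Hu i.
  have := has_deriv0_lin (@bounded_lin_entry R 1 n0 0 j) dxi.
  apply: has_deriv0_ext => t _; first by rewrite [RHS]mxE.
  transitivity (row i (Z t *m A0 + V t *m Bm) 0 j); last by rewrite [LHS]mxE.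
  by rewrite linearD /= !row_mul !rowK SE.
have cV : C0 V.
  have cu i : C0 (fun t => (delta_mx i 0 : 'cV[R]_n0) *m (B0 (u i t) *m Sm)).
    apply: (C0_lin (bounded_lin_mulmxl _ _)); apply: (C0_lin (bounded_lin_mulmxr 1 Sm)).
    by apply: (C0_lin (up_B up)); case: (Hu i).
  have csum (r : seq 'I_n0) : C0 (fun t => \sum_(i <- r) (delta_mx i 0 : 'cV[R]_n0) *m (B0 (u i t) *m Sm)).
    elim: r => [|i r IH].
      by apply: C0_ext (C0_cst (0 : 'M[R]_n0)) => t _; rewrite big_nil.
    by apply: C0_ext (C0D (cu i) IH) => t _; rewrite big_cons.
  apply: C0_ext (csum (index_enum _)) => t _.
  rewrite [RHS](_ : V t = \sum_i (delta_mx i 0 : 'cV[R]_n0) *m row i (V t)); last first.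
    apply/row_matrixP => k; rewrite linear_sum (bigD1 k) //= big1 => [|i ik].
      by rewrite addr0 row_mul rowE mul_delta_mx mulmx_sum_row big_ord1 !mxE eqxx scale1r row_id.
    rewrite row_mul rowE mul_delta_mx_cond.
    by rewrite eq_sym (negbTE ik) mulr0n mul0mx.
  by apply: eq_bigr => i _; rewrite rowK.
have Z0 : Z 0 = 1%:M.
  by apply/row_matrixP => i; rewrite rowK row1; have [_ _ -> _] := Hu i.
pose c : R := (2 * n0.+1%:R ^+ 2)^-1.
have c0 : 0 < c by rewrite invr_gt0 mulr_gt0 // exprn_gt0 // ltr0n.
have [tau tau0 Htau] : exists2 tau : R, 0 < tau & `|Z tau| <= c.
  have H : \forall t \near +oo, forall i : 'I_n0, `|xi i t| <= c.
    apply: filter_forall => i; have [_ _ _ cx] := Hu i.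
    have /cvgrPdist_le/(_ c c0) := cx.
    by apply: filterS => t; rewrite sub0r normrN.
  near (pinfty_nbhs R) => tau; exists tau; first by near: tau; exact/nbhs_pinfty_gt/num_real.
  have h : forall i : 'I_n0, `|xi i tau| <= c by near: tau.
  apply: mx_norm_le (ltW c0) _ => i j; rewrite mxE.
  by apply: le_trans (h i); exact: mx_entry_le.
have [K' HK'] := stabilizing_gain tau0 dZ cV Z0 Htau.
exists (fun x => b (x *m K')), (A0 + K' *m Bm); split => //.
- exact: bounded_lin_comp (bounded_lin_mulmxr 1 K') bb.
- by move=> x; rewrite bE mulmxDr mulmxA.
Unshelve. all: by end_near.
Qed.

(** An unobservable vector of [A0] gives a trajectory of [S] with zero input and output. By
    detectability it decays, and [nodecay] makes it 0. Separating functionals reduce the output to a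
    matrix without enlarging the kernel of [C0']. *)
Lemma output_injection : detectable S -> exists (L : Y -> 'rV[R]_n0) (AL : 'M[R]_n0),
  [/\ bounded_lin L, stable_mx AL & forall x, x *m AL = x *m A0 + L (C0' x)].
Proof.
move=> dt.
have [L1 bL1 HL1] := separating_functionals (up_C up).
have bLC := bounded_lin_comp (up_C up) bL1.
have [Cm HCm] : exists Cm : 'M[R]_n0, forall x, x *m Cm = L1 (C0' x).
  by exists (\matrix_i L1 (C0' (delta_mx 0 i))) => x; exact: (mx_ofE bLC.1).
have [|L' HL'] := @observer_gain _ _ _ A0 Cm.
  move=> x Hx; apply: (up_nd up); rewrite /decays.
  have yz (t : R) : 0 <= t -> (0 : U) = 0 /\ C0' (x *m expm A0 t) = 0.
    by move=> t0; split => //; apply: HL1; rewrite -HCm Hx.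
  have := bounded_lin_cvg_pinfty (up_pi up) (dt _ _ _ (up_traj up x) yz).
  rewrite (bounded_lin0 (up_pi up)).
  by under eq_fun do rewrite (up_id up).
exists (fun y => L1 y *m L'), (A0 + Cm *m L'); split => //.
- exact: bounded_lin_comp bL1 (bounded_lin_mulmxr 1 L').
- by move=> x; rewrite mulmxDr mulmxA HCm.
Qed.
End UnstablePart.

Lemma expm_decay_entries (R : realType) n (A : 'M[R]_n) (c : 'cV[R]_n) (K b : R) : 0 <= K -> 0 < b ->
  (forall (t : R) i, 0 <= t -> `|((delta_mx 0 i : 'rV[R]_n) *m expm A t *m c) 0 0| <= K * expR (- (b * t))) ->
  decays A^T c^T.
Proof.
move=> K0 b0 H; apply: (exp_decay_cvg (K := K) b0) => t t0.
apply: mx_norm_le; first by rewrite mulr_ge0 ?expR_ge0.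
move=> i j; rewrite expm_tr // -trmx_mul mxE.
apply: le_trans (H t j t0); rewrite -rowE -row_mul [in leRHS]mxE ord1 //.
Qed.

Section ReducedForm.
Variables (R : realType) (U X Y : normedModType R) (S : relation R U X Y).
Variables (n0 : nat) (pi0 : X -> 'rV[R]_n0) (iota0 : 'rV[R]_n0 -> X) (A0 : 'M[R]_n0).
Variables (B0 : U -> 'rV[R]_n0) (C0' : 'rV[R]_n0 -> Y).
Hypothesis up : unstable_part S pi0 iota0 A0 B0 C0'.
Variables (n : nat) (Xs : completeNormedModType R) (pu : X -> 'rV[R]_n) (ps : X -> Xs).
Variables (ju : 'rV[R]_n -> X) (js : Xs -> X) (Mu : 'M[R]_n) (Bu : U -> 'rV[R]_n) (Cu : 'rV[R]_n -> Y).
Variables (As : Xs -> Xs) (Ds : set Xs) (Bs : U -> Xs) (Cs : Xs -> Y) (Ts : R -> Xs -> Xs).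
Hypothesis dec : decomposition S pu ps ju js Mu Bu Cu As Ds Bs Cs Ts.
Hypothesis dTs : decays_exponentially Ts.

(** [ps \o iota0] intertwines the flow of [A0] with [Ts]. Composed with a bounded functional it
    becomes a column [c] such that [e^{t A0} c] decays; then [c^T] decays under [A0^T] and vanishes
    by [nodecay_tr]. *)
Lemma stable_part_unstable0 (v : 'rV[R]_n0) : ps (iota0 v) = 0.
Proof.
have [M [b [M0 b0 HM]]] := dTs.
apply/eqP/negPn/negP => /functional_exists[f [bf]]; apply/negP; rewrite negbK; apply/eqP.
have bpi := bounded_lin_comp (up_iota up) (dec_ps dec).
have bg := bounded_lin_comp bpi bf.
have [k k0 Hk] := bounded_lin_bound bf; have [k' k'0 Hk'] := bounded_lin_bound bpi.
pose c : 'cV[R]_n0 := \col_i f (ps (iota0 (delta_mx 0 i))).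
have cE (w : 'rV[R]_n0) : (w *m c) 0 0 = f (ps (iota0 w)).
  rewrite [RHS](lin_map_sum bg.1) mxE; apply: eq_bigr => i _; by rewrite mxE.
have : c^T = 0.
  apply: (nodecay_tr (up_nd up)); apply: (@expm_decay_entries _ _ _ _ (k * M * k') b) => //.
    by rewrite !mulr_ge0 // ltW.
  move=> t i t0; rewrite cE; apply: (le_trans (Hk _)).
  have [_ Sq] := dec_fwd dec (up_traj up (delta_mx 0 i)).
  have [_ _ Dq _ [dq _]] := Sys_elim Sq.
  rewrite (semigroup_uniq (dec_SG dec) dq Dq) //; last by move=> s _; rewrite (bounded_lin0 (dec_Bs dec)) addr0.
  rewrite expm0 mulmx1 -!mulrA ler_pM2l //; apply: (le_trans (HM t _ t0)).
  rewrite -mulrA ler_wpM2l // mulrC ler_wpM2r ?expR_ge0 //.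
  apply: (le_trans (Hk' _)); rewrite -[leRHS]mulr1 ler_pM2l //.
  by apply: mx_norm_le => // a d; rewrite mxE; case: (_ && _); rewrite ?normr1 ?normr0.
by move=> cT; rewrite -cE -[c]trmxK cT trmx0 mulmx0 mxE.
Qed.

(** The image of the orbit of [q] under [pi0 \o js] is an orbit of [A0], and it decays with [Ts]. *)
Lemma unstable_stable_part0 (q : Xs) : Ds q -> pi0 (js q) = 0.
Proof.
move=> Dq; have [M [b [M0 b0 HM]]] := dTs.
have SG := dec_SG dec.
have So := Sys_orbit SG (dec_Bs dec) (dec_Cs dec) Dq.
have dp0 : has_deriv0 (fun=> 0 : 'rV[R]_n) (fun t : R => 0 *m Mu + Bu 0).
  by apply: has_deriv0_ext (has_deriv0_cst (0 : 'rV[R]_n)) => // t _; rewrite mul0mx (bounded_lin0 (dec_Bu dec)) addr0.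
have dz := up_der up (dec_bwd dec dp0 So).
have ju0 := bounded_lin0 (dec_ju dec).
have {}dz : has_deriv0 (fun t => pi0 (js (Ts t q))) (fun t => pi0 (js (Ts t q)) *m A0).
  by apply: has_deriv0_ext dz => t _; rewrite ?ju0 ?add0r ?(bounded_lin0 (up_B up)) ?addr0.
have bpj := bounded_lin_comp (dec_js dec) (up_pi up).
have [k k0 Hk] := bounded_lin_bound bpj.
apply: (up_nd up); apply: (exp_decay_cvg (K := k * M * `|q|) b0) => t t0.
rewrite -{1}[q](sg0 SG) -(expm_uniq dz) //; apply: (le_trans (Hk _)).
by rewrite -!mulrA ler_pM2l // [`|q| * _]mulrC mulrA; exact: HM.
Qed.

(** By the two vanishing lemmas the unstable part sits inside the finite-dimensional part of the
    second decomposition: [J] embeds it, [Q] is a left inverse on row vectors, both intertwine [A0]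
    with [Mu], and [pr = 1 - Q J] projects onto the rest. *)
Lemma reduced_form : exists A1 pr : 'M[R]_n, [/\ stable_mx A1,
  forall v, Cu (pu (iota0 v)) = C0' v /\ ju (pu (iota0 v)) = iota0 v &
  forall u x y, S u x y ->
    has_deriv0 (fun t => pu (x t) *m pr) (fun t => pu (x t) *m pr *m A1 + Bu (u t) *m pr) /\
    forall t : R, 0 <= t -> pu (x t) = pu (iota0 (pi0 (x t))) + pu (x t) *m pr].
Proof.
have bJ := bounded_lin_comp (up_iota up) (dec_pu dec).
have bQ := bounded_lin_comp (dec_ju dec) (up_pi up).
have [J HJ] : exists J : 'M[R]_(n0, n), forall v, v *m J = pu (iota0 v).
  by exists (\matrix_i pu (iota0 (delta_mx 0 i))) => v; exact: (mx_ofE bJ.1).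
have [Q HQ] : exists Q : 'M[R]_(n, n0), forall v, v *m Q = pi0 (ju v).
  by exists (\matrix_i pi0 (ju (delta_mx 0 i))) => v; exact: (mx_ofE bQ.1).
have mx_ext a c (M1 M2 : 'M[R]_(a, c)) : (forall v : 'rV[R]_a, v *m M1 = v *m M2) -> M1 = M2.
  by move=> H; apply/row_matrixP => i; rewrite !rowE H.
have jpi v : ju (pu (iota0 v)) = iota0 v.
  by rewrite -[RHS](dec_sum dec) stable_part_unstable0 (bounded_lin0 (dec_js dec)) addr0.
have [C00 S0] := Sys_zero (dec_SG dec) (dec_Bs dec) (dec_Cs dec).
have JQ : J *m Q = 1%:M.
  by apply: mx_ext => v; rewrite mulmxA HJ HQ jpi (up_id up) mulmx1.
have JM : A0 *m J = J *m Mu.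
  apply: mx_ext => v; have [d1 _] := dec_fwd dec (up_traj up v).
  have d2 := has_deriv0_lin bJ (@expm_row_deriv _ _ A0 v).
  have := has_deriv0_uniq d2 d1 (lexx 0).
  by rewrite /= expm0 mulmx1 (bounded_lin0 (dec_Bu dec)) addr0 -!HJ !mulmxA.
have traj p : S (fun=> 0) (fun t => ju (p *m expm Mu t)) (fun t => Cu (p *m expm Mu t)).
  have dp : has_deriv0 (fun t => p *m expm Mu t) (fun t => p *m expm Mu t *m Mu + Bu 0).
    apply: has_deriv0_ext (@expm_row_deriv _ _ Mu p) => // t _.
    by rewrite (bounded_lin0 (dec_Bu dec)) addr0.
  have := dec_bwd dec dp S0.
  have -> : (fun t => ju (p *m expm Mu t) + js 0) = (fun t => ju (p *m expm Mu t)).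
    by apply/funext => t; rewrite (bounded_lin0 (dec_js dec)) addr0.
  have -> // : (fun t => Cu (p *m expm Mu t) + 0) = (fun t => Cu (p *m expm Mu t)).
  by apply/funext => t; rewrite addr0.
have MQ : Mu *m Q = Q *m A0.
  apply: mx_ext => p; have d1 := up_der up (traj p).
  have d2 := has_deriv0_lin bQ (@expm_row_deriv _ _ Mu p).
  have := has_deriv0_uniq d2 d1 (lexx 0).
  by rewrite /= expm0 mulmx1 (bounded_lin0 (up_B up)) addr0 -!HQ !mulmxA.
have [pr prE] : exists pr : 'M[R]_n, pr = 1%:M - Q *m J by eexists.
have prQ : pr *m Q = 0 by rewrite prE mulmxBl mul1mx -mulmxA JQ mulmx1 subrr.
have Jpr : J *m pr = 0 by rewrite prE mulmxBr mulmx1 mulmxA JQ mul1mx subrr.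
have prM : pr *m Mu = Mu *m pr.
  by rewrite prE mulmxBl mulmxBr mul1mx mulmx1 -mulmxA -JM mulmxA [Mu *m (Q *m J)]mulmxA MQ.
have prpr : pr *m pr = pr by rewrite {2}prE mulmxBr mulmx1 mulmxA prQ mul0mx subr0.
(* [A1] acts as [Mu] on the range of [pr] and as [- 1] on that of [Q J], so the rest is described by
   a stable matrix of full size [n] instead of a restriction to a subspace. *)
have [A1 A1E] : exists A1 : 'M[R]_n, A1 = pr *m Mu - Q *m J by eexists.
have Mp : Mu *m pr = pr *m A1.
  by rewrite A1E mulmxBr !mulmxA prpr prQ mul0mx subr0 prM.
exists A1, pr; split.
- apply: decays_stable => r.
  have -> : r = 1 *: (r *m (Q *m J)) + r *m pr by rewrite scale1r prE mulmxBr mulmx1 addrC subrK.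
  apply: decaysD.
    have dx : has_deriv0 (fun t => expR (- 1 * t) *: (r *m (Q *m J))) (fun t => (expR (- 1 * t) *: (r *m (Q *m J))) *m A1).
      have := has_deriv0Z (has_deriv0_exp (- 1)) (has_deriv0_cst (r *m (Q *m J))).
      apply: has_deriv0_ext => // t _; rewrite scaler0 addr0 -scalemxAl A1E mulmxBr.
      have -> : r *m (Q *m J) *m (pr *m Mu) = 0 by rewrite -!mulmxA (mulmxA J pr) Jpr mul0mx !mulmx0.
      have -> : r *m (Q *m J) *m (Q *m J) = r *m (Q *m J) by rewrite -!mulmxA (mulmxA J Q) JQ mul1mx.
      by linear_comb R.
    apply: (exp_decay_cvg (K := `|r *m (Q *m J)|) ltr01) => t t0.
    have := expm_uniq dx t0; rewrite mulr0 expR0 scale1r => <-.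
    by rewrite normrZ (gtr0_norm (expR_gt0 _)) mulN1r mul1r mulrC.
  (* [pr Q = 0], so this free trajectory has no unstable component. *)
  have H := up_rest up (traj (r *m pr)) (fun _ _ => erefl).
  have {}H : ju (r *m pr *m expm Mu t) @[t --> +oo] --> (0 : X).
    by apply: H; rewrite expm0 mulmx1 -HQ -mulmxA prQ mulmx0.
  have := bounded_lin_cvg_pinfty (dec_pu dec) H; rewrite (bounded_lin0 (dec_pu dec)).
  rewrite /decays; apply: cvg_trans; apply: near_eq_cvg; near=> t.
  have t0 : 0 <= t by near: t; exact/nbhs_pinfty_ge/num_real.
  by rewrite (dec_uu dec) -!mulmxA -(expm_intertwine Mp t0) (expm_intertwine (esym prM) t0).
- move=> v; split => //.
  have [_ Sq] := dec_fwd dec (up_traj up v).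
  have [_ _ _ _ [_ E]] := Sys_elim Sq.
  have := E 0 (lexx 0); rewrite expm0 mulmx1 stable_part_unstable0 C00 => /eqP.
  by rewrite subr_eq0 => /eqP.
- move=> u x y Sx; have [dp Sq] := dec_fwd dec Sx; split.
    have := has_deriv0_lin (bounded_lin_mulmxr 1 pr) dp.
    by apply: has_deriv0_ext => // t _; rewrite mulmxDl -!mulmxA Mp.
  move=> t t0; have [_ _ Dq _ _] := Sys_elim Sq.
  have -> : pi0 (x t) = pu (x t) *m Q.
    rewrite HQ -{1}[x t](dec_sum dec) (bounded_linD _ _ (up_pi up)).
    by rewrite (unstable_stable_part0 (Dq t t0)) addr0.
  by rewrite -HJ -mulmxA prE mulmxBr mulmx1 addrC subrK.
Unshelve. all: by end_near.
Qed.
End ReducedForm.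

(** * The controller *)

Lemma Sys_ext_input (R : realType) (U X Y : normedModType R) (A : X -> X) (D : set X) (B : U -> X) (C : X -> Y)
    u u' x y : (forall t : R, 0 <= t -> u t = u' t) -> Sys A D B C u x y -> Sys A D B C u' x y.
Proof.
move=> uu' [cu [cy [Dx [cx [cA [x' [dx E]]]]]]]; split; first exact: C0_ext cu.
do 4 split => //; exists x'; split => // t t0.
by rewrite -uu' //; exact: E.
Qed.

Lemma finite_sys_data (R : realType) (U Y : normedModType R) m (E : 'M[R]_m) (F : Y -> 'rV[R]_m)
    (G : 'rV[R]_m -> U) : bounded_lin F -> bounded_lin G -> sys_data (fun h => h *m E) setT F G.
Proof.
move=> bF bG; split; first by apply/generatorP; exists (fun t x => x *m expm E t); exact: expm_semigroup.
split => //; split; first by move=> a x y _ _; exact: bG.1.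
have [M M0 HM] := bounded_lin_bound bG; exists M => x _; apply: (le_trans (HM x)).
by rewrite ler_pM2l // lerDl.
Qed.

Section SubmxNorm.
Variables (R : realType) (m n : nat).

Lemma lsubmx_norm (h : 'rV[R]_(m + n)) : `|lsubmx h| <= `|h|.
Proof. by apply: mx_norm_le => // i j; rewrite mxE; exact: mx_entry_le. Qed.

Lemma rsubmx_norm (h : 'rV[R]_(m + n)) : `|rsubmx h| <= `|h|.
Proof. by apply: mx_norm_le => // i j; rewrite mxE; exact: mx_entry_le. Qed.

Lemma hsubmx_norm (h : 'rV[R]_(m + n)) : `|h| <= `|lsubmx h| + `|rsubmx h|.
Proof.
apply: mx_norm_le; first exact: addr_ge0.
move=> i j; rewrite -{1}[h]hsubmxK mxE; case: splitP => k _.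
  by apply: le_trans (mx_entry_le (lsubmx h) i k) _; rewrite lerDl.
by apply: le_trans (mx_entry_le (rsubmx h) i k) _; rewrite lerDr.
Qed.

Lemma bounded_lin_lsubmx : bounded_lin (fun h : 'rV[R]_(m + n) => lsubmx h).
Proof. by apply: lin_map_bounded => a x y; rewrite linearP. Qed.

Lemma bounded_lin_rsubmx : bounded_lin (fun h : 'rV[R]_(m + n) => rsubmx h).
Proof. by apply: lin_map_bounded => a x y; rewrite linearP. Qed.
End SubmxNorm.

Lemma controller_exists (R : realType) (U Y : normedModType R) n0 n (A0 : 'M[R]_n0) (A1 : 'M[R]_n)
    (B0 : U -> 'rV[R]_n0) (B1 : U -> 'rV[R]_n) (C0' : 'rV[R]_n0 -> Y) (C1' : 'rV[R]_n -> Y)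
    (K : 'rV[R]_n0 -> U) (L : Y -> 'rV[R]_n0) :
  bounded_lin B0 -> bounded_lin B1 -> bounded_lin C0' -> bounded_lin C1' -> bounded_lin K -> bounded_lin L ->
  exists (E : 'M[R]_(n0 + n)) (F : Y -> 'rV[R]_(n0 + n)), bounded_lin F /\ forall h y,
    lsubmx (h *m E + F y) = lsubmx h *m A0 + B0 (K (lsubmx h)) + L (C0' (lsubmx h) + C1' (rsubmx h) - y) /\
    rsubmx (h *m E + F y) = rsubmx h *m A1 + B1 (K (lsubmx h)).
Proof.
move=> bB0 bB1 bC0 bC1 bK bL.
pose f (h : 'rV[R]_(n0 + n)) : 'rV[R]_(n0 + n) :=
  row_mx (lsubmx h *m A0 + B0 (K (lsubmx h)) + L (C0' (lsubmx h) + C1' (rsubmx h)))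
         (rsubmx h *m A1 + B1 (K (lsubmx h))).
have lf : lin_map f.
  move=> a x y; rewrite /f !linearP /= !mulmxDl -!scalemxAl !bK.1 bB0.1 bB1.1 bC0.1 bC1.1.
  rewrite scale_row_mx add_row_mx; congr row_mx; last by linear_comb R.
  have -> : a *: C0' (lsubmx x) + C0' (lsubmx y) + (a *: C1' (rsubmx x) + C1' (rsubmx y)) =
    a *: (C0' (lsubmx x) + C1' (rsubmx x)) + (C0' (lsubmx y) + C1' (rsubmx y)) by linear_comb R.
  have lc (x1 x2 x3 y1 y2 y3 : 'rV[R]_n0) :
    a *: x1 + y1 + (a *: x2 + y2) + (a *: x3 + y3) = a *: (x1 + x2 + x3) + (y1 + y2 + y3) by linear_comb R.
  by rewrite bL.1; exact: lc.
exists (\matrix_i f (delta_mx 0 i)), (fun y => row_mx (- L y) (0 : 'rV[R]_n)); split.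
  have [M M0 HM] := bounded_lin_bound bL.
  apply: (@bounded_linP _ _ _ _ M) => [a x y|y].
    by rewrite scale_row_mx add_row_mx bL.1; congr row_mx; linear_comb R.
  apply: (le_trans (hsubmx_norm _)); rewrite row_mxKl row_mxKr normr0 addr0 normrN; exact: HM.
move=> h y; rewrite (mx_ofE lf) !linearD /= !row_mxKl !row_mxKr addr0; split => //.
by rewrite (bounded_linD _ (- y) bL) (bounded_linN y bL) addrA.
Qed.

Section ClosedLoopStability.
Variables (R : realType) (U Y : normedModType R) (X : normedModType R).
Variable S : relation R U X Y.
Variables (n0 : nat) (pi0 : X -> 'rV[R]_n0) (iota0 : 'rV[R]_n0 -> X) (A0 : 'M[R]_n0).
Variables (B0 : U -> 'rV[R]_n0) (C0' : 'rV[R]_n0 -> Y).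
Hypothesis up : unstable_part S pi0 iota0 A0 B0 C0'.
Variables (n : nat) (Xs : completeNormedModType R) (pu : X -> 'rV[R]_n) (ps : X -> Xs).
Variables (ju : 'rV[R]_n -> X) (js : Xs -> X) (Mu : 'M[R]_n) (Bu : U -> 'rV[R]_n) (Cu : 'rV[R]_n -> Y).
Variables (As : Xs -> Xs) (Ds : set Xs) (Bs : U -> Xs) (Cs : Xs -> Y) (Ts : R -> Xs -> Xs).
Hypothesis dec : decomposition S pu ps ju js Mu Bu Cu As Ds Bs Cs Ts.
Variables A1 pr : 'M[R]_n.
Hypothesis inj0 : forall v, Cu (pu (iota0 v)) = C0' v /\ ju (pu (iota0 v)) = iota0 v.
Hypothesis red : forall u x y, S u x y ->
    has_deriv0 (fun t => pu (x t) *m pr) (fun t => pu (x t) *m pr *m A1 + Bu (u t) *m pr) /\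
    forall t : R, 0 <= t -> pu (x t) = pu (iota0 (pi0 (x t))) + pu (x t) *m pr.
Variables (K : 'rV[R]_n0 -> U) (AK : 'M[R]_n0) (L : Y -> 'rV[R]_n0) (AL : 'M[R]_n0).
Hypotheses (bK : bounded_lin K) (bL : bounded_lin L).
Hypothesis AKE : forall x, x *m AK = x *m A0 + B0 (K x).
Hypothesis ALE : forall x, x *m AL = x *m A0 + L (C0' x).
Variables (E : 'M[R]_(n0 + n)) (F : Y -> 'rV[R]_(n0 + n)).
Hypothesis ctrl : forall h y,
    lsubmx (h *m E + F y) = lsubmx h *m A0 + B0 (K (lsubmx h)) + L (C0' (lsubmx h) + Cu (rsubmx h) - y) /\
    rsubmx (h *m E + F y) = rsubmx h *m A1 + Bu (K (lsubmx h)) *m pr.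

(** With [d = y - Cu (pu x)] the correction term satisfies [C0' h0 + Cu h1 - y = C0' e + Cu e1 - d];
    the inputs cancel in the equations for [e] and [e1] because plant and controller receive the
    same one. *)
Lemma closed_loop_coordinates v (x : R -> X * 'rV[R]_(n0 + n)) :
  rcomp (Sys (fun h => h *m E) setT F (fun h => K (lsubmx h))) S v x v ->
  let xi t := pi0 (x t).1 in let p t := pu (x t).1 *m pr in
  let e t := lsubmx (x t).2 - xi t in let e1 t := rsubmx (x t).2 - p t in
  [/\ (exists d, loop AK AL A1 (fun z => B0 (K z)) K L Cu As Ds Bs Cs xi e e1 (fun t => ps (x t).1) d),
      has_deriv0 p (fun t => p t *m A1 + Bu (K (xi t + e t)) *m pr) &
      forall t : R, 0 <= t -> (x t).1 = iota0 (xi t) + ju (p t) + js (ps (x t).1)].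
Proof.
move=> [y [Sx Sh]] xi p e e1.
have [_ _ _ _ [dh vE]] := Sys_elim Sh.
have [dp Sq] := dec_fwd dec Sx; have [dp1 puE] := red Sx.
have dxi := up_der up Sx.
have xe t : xi t + e t = lsubmx (x t).2 by rewrite /e addrC subrK.
have vE' (t : R) : 0 <= t -> v t = K (xi t + e t) by move=> t0; rewrite vE //= xe.
have dl := has_deriv0_lin (bounded_lin_lsubmx R n0 n) dh.
have dr := has_deriv0_lin (bounded_lin_rsubmx R n0 n) dh.
have bB0 := up_B up; have bC0 := up_C up; have bCu := dec_Cu dec.
split.
- exists (fun t => y t - Cu (pu (x t).1)); split; first split.
  + apply: has_deriv0_ext dxi => // t t0 /=.
    by rewrite vE' // AKE (bounded_linD _ _ bK) (bounded_linD _ _ bB0) addrA.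
  + apply: has_deriv0_ext (has_deriv0B dl dxi) => // t t0 /=.
    rewrite (ctrl _ _).1 ALE vE' // xe.
    have -> : Cu (pu (x t).1) = C0' (xi t) + Cu (p t).
      by rewrite {1}(puE t t0) (bounded_linD _ _ bCu) (inj0 _).1.
    have lc (z1 z2 z3 z4 z5 : 'rV[R]_n0) : z1 + z2 + (z3 + z4) - (z5 + z2) = z1 - z5 + z3 + z4 by linear_comb R.
    have -> : e t *m A0 = lsubmx (x t).2 *m A0 - xi t *m A0 by rewrite mulmxBl.
    have -> : L (C0' (lsubmx (x t).2) + Cu (rsubmx (x t).2) - y t) =
        L (C0' (e t)) + L (Cu (e1 t) - (y t - (C0' (xi t) + Cu (p t)))).
      rewrite -(bounded_linD _ _ bL) /e1 /e; congr L.
      by rewrite (bounded_linB _ _ bC0) (bounded_linB _ _ bCu); linear_comb R.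
    exact: lc.
  + apply: has_deriv0_ext (has_deriv0B dr dp1) => // t t0 /=.
    by rewrite (ctrl _ _).2 vE' // xe mulmxBl opprD addrACA subrr addr0.
  + exact: Sys_ext_input vE' Sq.
- by apply: has_deriv0_ext dp1 => // t t0; rewrite /= vE'.
- move=> t t0; rewrite -{1}[(x t).1](dec_sum dec) {1}(puE t t0) (bounded_linD _ _ (dec_ju dec)).
  by rewrite (inj0 _).2.
Qed.

Variables (be Kx : R).
Hypothesis be0 : 0 < be.
Hypothesis Kx0 : 0 <= Kx.
Hypothesis decay : forall x e e1 p q d,
  loop AK AL A1 (fun z => B0 (K z)) K L Cu As Ds Bs Cs x e e1 q d ->
  has_deriv0 p (fun t => p t *m A1 + Bu (K (x t + e t)) *m pr) -> forall t : R, 0 <= t ->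
  expR (be * t) * (`|x t| + `|e t| + `|e1 t| + `|p t| + `|q t|) <=
  Kx * (`|x 0| + `|e 0| + `|e1 0| + `|p 0| + `|q 0|).

(** The error coordinates depend boundedly on the plant and controller states, and conversely; [c2]
    and [c1] are the two constants, and the rate [be] is unchanged. *)
Lemma closed_loop_stable :
  exp_stable (Close (rcomp (Sys (fun h => h *m E) setT F (fun h => K (lsubmx h))) S)).
Proof.
have [k1 k10 H1] := bounded_lin_bound (up_iota up).
have [k2 k20 H2] := bounded_lin_bound (dec_ju dec).
have [k3 k30 H3] := bounded_lin_bound (dec_js dec).
have [l1 l10 G1] := bounded_lin_bound (up_pi up).
have [l2 l20 G2] := bounded_lin_bound (bounded_lin_comp (dec_pu dec) (bounded_lin_mulmxr 1 pr)).
have [l3 l30 G3] := bounded_lin_bound (dec_ps dec).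
have [c1 [c10 Ec1]] : exists c, 0 <= c /\ c = k1 + k2 + k3 + 2 by exists (k1 + k2 + k3 + 2); split => //; lra.
have [c2 [c20 Ec2]] : exists c, 0 <= c /\ c = 2 * l1 + 2 * l2 + l3 + 2.
  by exists (2 * l1 + 2 * l2 + l3 + 2); split => //; lra.
exists be, (c1 * (Kx * c2)); split => // u x y [_ [v Sv]] _ t t0.
have [[d lp] dp xE] := closed_loop_coordinates Sv.
pose N (s : R) := `|pi0 (x s).1| + `|lsubmx (x s).2 - pi0 (x s).1| + `|rsubmx (x s).2 - pu (x s).1 *m pr|
  + `|pu (x s).1 *m pr| + `|ps (x s).1|.
have HN : expR (be * t) * N t <= Kx * N 0 := decay lp dp t0.
have Nt : `|x t| <= c1 * N t.
  have xle : `|x t| <= `|(x t).1| + `|(x t).2| by rewrite prod_normE ge_max lerDl lerDr !normr_ge0.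
  have x1le : `|(x t).1| <= k1 * `|pi0 (x t).1| + k2 * `|pu (x t).1 *m pr| + k3 * `|ps (x t).1|.
    rewrite {1}(xE t t0); apply: (le_trans (ler_normD _ _)); apply: lerD; last exact: H3.
    by apply: (le_trans (ler_normD _ _)); apply: lerD.
  have hle := hsubmx_norm (x t).2.
  have := ler_normD (lsubmx (x t).2 - pi0 (x t).1) (pi0 (x t).1).
  have := ler_normD (rsubmx (x t).2 - pu (x t).1 *m pr) (pu (x t).1 *m pr).
  rewrite !subrK => h1 h2.
  have := normr_ge0 (lsubmx (x t).2 - pi0 (x t).1); have := normr_ge0 (rsubmx (x t).2 - pu (x t).1 *m pr).
  have := normr_ge0 (pi0 (x t).1); have := normr_ge0 (pu (x t).1 *m pr); have := normr_ge0 (ps (x t).1).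
  move: xle x1le hle h1 h2; rewrite Ec1 /N.
  set a1 := `|pi0 _|; set a2 := `|lsubmx _ - _|; set a3 := `|rsubmx _ - _|; set a4 := `|pu _ *m _|.
  set a5 := `|ps _|; set b1 := `|_.1|; set b2 := `|_.2|; set b3 := `|lsubmx _|; set b4 := `|rsubmx _|.
  move=> xle x1le hle h1 h2 p5 p4 p1 p3 p2.
  have q1 : k1 * a1 <= k1 * (a1 + a2 + a3 + a4 + a5) by rewrite ler_pM2l //; lra.
  have q2 : k2 * a4 <= k2 * (a1 + a2 + a3 + a4 + a5) by rewrite ler_pM2l //; lra.
  have q3 : k3 * a5 <= k3 * (a1 + a2 + a3 + a4 + a5) by rewrite ler_pM2l //; lra.
  rewrite ![(_ + _) * (a1 + a2 + a3 + a4 + a5)]mulrDl; lra.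
have N0 : N 0 <= c2 * `|x 0|.
  have x1 : `|(x 0).1| <= `|x 0| by rewrite prod_normE le_max lexx.
  have x2 : `|(x 0).2| <= `|x 0| by rewrite prod_normE le_max lexx orbT.
  have w (W : normedModType R) (f : X -> W) (l : R) : 0 < l -> (forall z, `|f z| <= l * `|z|) ->
      `|f (x 0).1| <= l * `|x 0|.
    by move=> l0 Hf; apply: (le_trans (Hf _)); rewrite ler_pM2l.
  have w1 := w _ _ _ l10 G1; have w2 := w _ _ _ l20 G2; have w3 := w _ _ _ l30 G3.
  have := lsubmx_norm (x 0).2; have := rsubmx_norm (x 0).2.
  have := ler_normB (lsubmx (x 0).2) (pi0 (x 0).1).
  have := ler_normB (rsubmx (x 0).2) (pu (x 0).1 *m pr).
  move: w1 w2 w3; rewrite /= Ec2 /N ![(_ + _) * `|x 0|]mulrDl -!mulrA; lra.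
have E1 : expR (- (be * t)) * expR (be * t) = 1 by rewrite -expRD addNr expR0.
apply: (le_trans Nt); rewrite -2!mulrA ler_wpM2l // mulrCA.
rewrite -[N t]mul1r -E1 -mulrA ler_wpM2l ?expR_ge0 //.
by apply: (le_trans HN); rewrite -[leRHS]mulrA ler_wpM2l.
Qed.
End ClosedLoopStability.

Theorem theorem4p13 (R : realType) (U X Y : completeNormedModType R)
    (A : X -> X) (DomA : set X) (B : U -> X) (C : X -> Y) :
  sys_data A DomA B C ->
  stabilizable (Sys A DomA B C) ->
  detectable (Sys A DomA B C) ->
  quasi_finite (Sys A DomA B C) ->
  exists (m : nat) (E : 'rV[R]_m -> 'rV[R]_m) (DomE : set 'rV[R]_m)
         (F : Y -> 'rV[R]_m) (G : 'rV[R]_m -> U),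
    sys_data E DomE F G /\
    exp_stable (Close (rcomp (Sys E DomE F G) (Sys A DomA B C))).
Proof.
move=> _ st dt qf.
have [n0 [pi0 [iota0 [A0 [B0 [C0' up]]]]]] : exists n0 pi0 iota0 A0 B0 C0',
    @unstable_part R U X Y (Sys A DomA B C) n0 pi0 iota0 A0 B0 C0'.
  (* The value 1 of [eps] is arbitrary: only the unstable part is extracted from this
     decomposition. *)
  have [n [Xs [pu [ps [ju [js [Mu [Bu [Cu [As [Ds [Bs [Cs [Ts [dec dTs _]]]]]]]]]]]]]]] :=
    quasi_finite_decomposition qf ltr01.
  exact: unstable_part_exists dec dTs.
have inC0 u x y : Sys A DomA B C u x y -> C0 u by case.
have [K [AK [bK stK AKE]]] := state_feedback up inC0 st.
have [L [AL [bL stL ALE]]] := output_injection up dt.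
have bBK : bounded_lin (fun z => B0 (K z)) by exact: bounded_lin_comp bK (up_B up).
have [k [bG [k0 bG0 HG]]] := observer_loop_gain bBK bK bL stK stL.
(* The [+ 1] covers the case [k = 0]. *)
have eps0 : 0 < (2 * (k + 1))^-1 by rewrite invr_gt0; lra.
have [n [Xs [pu [ps [ju [js [Mu [Bu [Cu [As [Ds [Bs [Cs [Ts [dec dTs [be1 [al [be10 al0 ale io1]]]]]]]]]]]]]]]]]] :=
  quasi_finite_decomposition qf eps0.
have [A1 [pr [[M1 [b1 [M10 b10 HM1]]] inj0 red]]] := reduced_form up dec dTs.
have [M [b [M0 b0 HM]]] := dTs.
have alk : al * k <= 2^-1.
  apply: (@le_trans _ _ ((2 * (k + 1))^-1 * k)); first by rewrite ler_wpM2r // ltW.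
  rewrite mulrC ler_pdivrMr; last by lra.
  by rewrite mulrA mulVf ?mul1r ?pnatr_eq0 // lerDl.
(* The rate must be at most [be1] to keep the gain bound and at most [bG] for the loop gain;
   [2 be < b] leaves room for both exponentials of [graph_gain], and [be < b1] for the decay of [e1]
   and [p]. *)
have [be [be0 bebe1 bebG beb beb1]] : exists be : R,
    [/\ 0 < be, be <= be1, be <= bG, 2 * be < b & be < b1].
  exists (Num.min (Num.min be1 bG) (Num.min (b / 3) (b1 / 2))); split.
  - by rewrite !lt_min be10 bG0 /= !divr_gt0.
  - by rewrite !ge_min lexx.
  - by rewrite !ge_min lexx orbT.
  - apply: (@le_lt_trans _ _ (2 * (b / 3))); last by lra.
    by rewrite ler_pM2l // !ge_min lexx !orbT.
  - apply: (@le_lt_trans _ _ (b1 / 2)); last by lra.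
    by rewrite !ge_min lexx !orbT.
have io : io_bound (Sys As Ds Bs Cs) be al by exact: io_bound_slower io1.
have bB1 := bounded_lin_comp (dec_Bu dec) (bounded_lin_mulmxr 1 pr).
have [Kf Kf0 Hgraph] := loop_graph_decay bBK bK bL (dec_Cu dec) (dec_SG dec) (dec_Bs dec) (dec_Cs dec)
  M0 M10 be0 al0 k0 HM HM1 beb beb1 alk io (HG be (ltW be0) bebG).
have beb' : be < b by lra.
have [Kx Kx0 Hdec] := loop_decay bBK bK bL (dec_Cu dec) bB1 (dec_SG dec) (dec_Bs dec) (dec_Cs dec)
  M0 M10 be0 beb' beb1 HM HM1 Kf0 Hgraph.
have [E [F [bF ctrl]]] := controller_exists A0 A1 (up_B up) bB1 (up_C up) (dec_Cu dec) bK bL.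
exists (n0 + n)%N, (fun h => h *m E), setT, F, (fun h => K (lsubmx h)); split.
  by apply: finite_sys_data => //; exact: bounded_lin_comp (bounded_lin_lsubmx R n0 n) bK.
exact: (closed_loop_stable up dec inj0 red bK bL AKE ALE ctrl be0 Kx0 Hdec).
Qed.
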